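(* Let $c_o\in\mathbf{R}$ and let $X:\Sigma\to\mathbf{R}^3$ be an axially symmetric immersion, with axis of rotation the $z$-axis, satisfying $H\neq -c_o$ on $\Sigma$, and assume that the surface is contained in a domain on which $z\neq0$ holds. Then the immersion satisfies $$H+c_o=-\frac{\nu_3}{z}$$ on $\Sigma$ (and, hence, is critical for the Helfrich energy $\mathcal{H}[\Sigma]=\int_\Sigma(H+c_o)^2\,d\Sigma$) if and only if it is critical for the functional $$\mathcal{G}[\Sigma]:=\int_\Sigma\frac{1}{z^2}\,d\Sigma+2c_o\int_\Sigma\frac{\nu_3}{z}\,d\Sigma$$ for variations vanishing on $\partial\Sigma$.
   Context: $\Sigma$ is a compact, connected, oriented surface with smooth boundary and $X:\Sigma\to\mathbf{R}^3$ is an immersion of class $\mathcal{C}^4$ up to the boundary, with unit normal $\nu$ (oriented so that $\nu$ points out of convex domains). $H$ is the mean curvature with sign convention $2H=-\mathrm{tr}(d\nu)$, equivalently $\Delta X=2H\nu$ (the round sphere of radius $R$ with outward normal has $H=-1/R$), and $K$ is the Gaussian curvature. $E_3=(0,0,1)$, $z=X\cdot E_3$, $\nu_3=\nu\cdot E_3$. The immersion is critical for $\mathcal{H}$ if it is critical with respect to compactly supported variations, i.e. if $\Delta H+2(H+c_o)(H[H-c_o]-K)=0$ in the interior of $\Sigma$, $\Delta$ being the Laplacian of the induced metric. Axially symmetric means that the surface is a surface of revolution, obtained by rotating a planar profile curve about an axis. *)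

(* Defs.v *)
From Stdlib Require Import Reals List.
From Coquelicot Require Import Coquelicot.
Open Scope R_scope.

Record vec := Vec { cx : R; cy : R; cz : R }.

Definition vzero : vec := Vec 0 0 0.

Definition dot (v w : vec) : R := cx v * cx w + cy v * cy w + cz v * cz w.

Definition cross (v w : vec) : vec :=
  Vec (cy v * cz w - cz v * cy w)
      (cz v * cx w - cx v * cz w)
      (cx v * cy w - cy v * cx w).

Definition vnorm (v : vec) : R := sqrt (dot v v).

Definition vscal (a : R) (v : vec) : vec := Vec (a * cx v) (a * cy v) (a * cz v).

Definition pd1 (f : R -> R -> R) (x y : R) : R := Derive (fun s => f s y) x.
Definition pd2 (f : R -> R -> R) (x y : R) : R := Derive (fun s => f x s) y.

Definition vpd1 (F : R -> R -> vec) (x y : R) : vec :=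
  Vec (pd1 (fun s t => cx (F s t)) x y)
      (pd1 (fun s t => cy (F s t)) x y)
      (pd1 (fun s t => cz (F s t)) x y).
Definition vpd2 (F : R -> R -> vec) (x y : R) : vec :=
  Vec (pd2 (fun s t => cx (F s t)) x y)
      (pd2 (fun s t => cy (F s t)) x y)
      (pd2 (fun s t => cz (F s t)) x y).

(* [Ck2 k U f]: f is of class C^k on U.  [U] is meant to be open. *)
Fixpoint Ck2 (k : nat) (U : R -> R -> Prop) (f : R -> R -> R) : Prop :=
  match k with
  | O => forall x y, U x y -> continuity_2d_pt f x y
  | S k' =>
      (forall x y, U x y ->
         ex_derive (fun s => f s y) x /\ ex_derive (fun s => f x s) y) /\
      Ck2 k' U (pd1 f) /\ Ck2 k' U (pd2 f)
  end.

(* The same for functions of three variables (t, x, y). *)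
Fixpoint Ck3 (k : nat) (U : R -> R -> R -> Prop) (f : R -> R -> R -> R) : Prop :=
  match k with
  | O => forall t x y, U t x y ->
      continuous (fun p : R * (R * R) => f (fst p) (fst (snd p)) (snd (snd p)))
                 (t, (x, y))
  | S k' =>
      (forall t x y, U t x y ->
         ex_derive (fun s => f s x y) t /\
         ex_derive (fun s => f t s y) x /\
         ex_derive (fun s => f t x s) y) /\
      Ck3 k' U (fun t x y => Derive (fun s => f s x y) t) /\
      Ck3 k' U (fun t x y => Derive (fun s => f t s y) x) /\
      Ck3 k' U (fun t x y => Derive (fun s => f t x s) y)
  end.

(* Geometry of an oriented parametrized surface (x, y) |-> F x y. *)

Definition normal_vec (F : R -> R -> vec) (x y : R) : vec :=
  cross (vpd1 F x y) (vpd2 F x y).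

Definition area_density (F : R -> R -> vec) (x y : R) : R :=
  vnorm (normal_vec F x y).

Definition unit_normal (F : R -> R -> vec) (x y : R) : vec :=
  vscal (/ area_density F x y) (normal_vec F x y).

(* H = - tr(d nu) / 2, the trace being g^{ij} <d_i nu, d_j F> where g is the
   induced metric. *)
Definition mean_curvature (F : R -> R -> vec) (x y : R) : R :=
  let F1 := vpd1 F x y in
  let F2 := vpd2 F x y in
  let n1 := vpd1 (unit_normal F) x y in
  let n2 := vpd2 (unit_normal F) x y in
  let g11 := dot F1 F1 in
  let g12 := dot F1 F2 in
  let g22 := dot F2 F2 in
  - (g22 * dot n1 F1 - g12 * (dot n1 F2 + dot n2 F1) + g11 * dot n2 F2)
    / (2 * (g11 * g22 - g12 * g12)).

(* The compact connected oriented surfaces that rotating a planar curve can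
   produce, in coordinates (u, theta): u in [u0, u1] runs along the profile and
   theta, of period 2 PI, is the angle of rotation.  For [Arc], each end of the
   profile gives either a boundary circle or, if the profile meets the axis
   there, a single interior point of the surface; this yields the annulus, the
   disc and the sphere.  For [Loop] the profile is closed, u has period u1 - u0
   and the surface is a torus.  The orientation is that of (u, theta); reversing
   the profile gives the opposite unit normal. *)

Inductive profile_end := Boundary | Pole.
Inductive profile_shape := Arc (e0 e1 : profile_end) | Loop.

Record surface := Surface {
  u0 : R;
  u1 : R;
  u0_lt_u1 : u0 < u1;
  shape : profile_shape
}.

Definition in_surface (S : surface) (u : R) : Prop :=
  match shape S with
  | Arc _ _ => u0 S <= u <= u1 S
  | Loop => True
  end.

Definition on_boundary (S : surface) (u : R) : Prop :=
  match shape S with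
  | Arc e0 e1 => (e0 = Boundary /\ u = u0 S) \/ (e1 = Boundary /\ u = u1 S)
  | Loop => False
  end.

Definition near_boundary (S : surface) (eta u : R) : Prop :=
  match shape S with
  | Arc e0 e1 =>
      (e0 = Boundary /\ u <= u0 S + eta) \/ (e1 = Boundary /\ u1 S - eta <= u)
  | Loop => False
  end.

(* Y : R -> R -> vec defines a map on the surface. *)
Definition well_defined (S : surface) (Y : R -> R -> vec) : Prop :=
  (forall u theta, in_surface S u -> Y u (theta + 2 * PI) = Y u theta) /\
  match shape S with
  | Arc e0 e1 =>
      (e0 = Pole -> forall theta, Y (u0 S) theta = Y (u0 S) 0) /\
      (e1 = Pole -> forall theta, Y (u1 S) theta = Y (u1 S) 0)
  | Loop => forall u theta, Y (u + (u1 S - u0 S)) theta = Y u theta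
  end.

(* Coordinate charts.  [to_param] maps chart coordinates to (u, theta);
   [chart_dom] is the coordinate domain; [chart_nbhd delta], for delta > 0, is
   an open set containing it, strictly larger only across boundary circles. *)
Record chart := Chart {
  to_param : R -> R -> R * R;
  chart_dom : R -> R -> Prop;
  chart_nbhd : R -> R -> R -> Prop
}.

Definition local_rep (c : chart) (Y : R -> R -> vec) (x y : R) : vec :=
  Y (fst (to_param c x y)) (snd (to_param c x y)).

Definition cylinder_chart (S : surface) : chart :=
  Chart (fun u theta => (u, theta))
    (fun u _ =>
       match shape S with
       | Arc e0 e1 =>
           (match e0 with Boundary => u0 S <= u | Pole => u0 S < u end) /\
           (match e1 with Boundary => u <= u1 S | Pole => u < u1 S end)
       | Loop => True
       end)
    (fun delta u _ =>
       match shape S with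
       | Arc e0 e1 =>
           (match e0 with Boundary => u0 S - delta < u | Pole => u0 S < u end) /\
           (match e1 with Boundary => u < u1 S + delta | Pole => u < u1 S end)
       | Loop => True
       end).

Definition radius (x y : R) : R := sqrt (x ^ 2 + y ^ 2).

(* x = radius * cos angle and y = radius * sin angle; the value at the origin
   is irrelevant. *)
Definition angle (x y : R) : R :=
  if Rle_dec 0 y then acos (x / radius x y) else - acos (x / radius x y).

(* Discs around the poles, in Cartesian coordinates.  In the second one the
   angle is reversed so that both are positively oriented. *)
Definition pole0_chart (S : surface) : chart :=
  Chart (fun x y => (u0 S + radius x y, angle x y))
    (fun x y => radius x y < u1 S - u0 S)
    (fun _ x y => radius x y < u1 S - u0 S).

Definition pole1_chart (S : surface) : chart :=
  Chart (fun x y => (u1 S - radius x y, - angle x y))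
    (fun x y => radius x y < u1 S - u0 S)
    (fun _ x y => radius x y < u1 S - u0 S).

Definition charts (S : surface) : list chart :=
  cylinder_chart S ::
  match shape S with
  | Arc e0 e1 =>
      (match e0 with Pole => pole0_chart S :: nil | Boundary => nil end) ++
      (match e1 with Pole => pole1_chart S :: nil | Boundary => nil end)
  | Loop => nil
  end.

(* Class C^4 up to the boundary, that is, on an open neighbourhood. *)
Definition C4_map (S : surface) (X : R -> R -> vec) : Prop :=
  exists delta, 0 < delta /\
  forall c, In c (charts S) ->
    Ck2 4 (chart_nbhd c delta) (fun x y => cx (local_rep c X x y)) /\
    Ck2 4 (chart_nbhd c delta) (fun x y => cy (local_rep c X x y)) /\
    Ck2 4 (chart_nbhd c delta) (fun x y => cz (local_rep c X x y)).

(* Joint C^4 regularity of a family X_t, |t| < eps, up to the boundary. *)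
Definition C4_family (S : surface) (eps : R) (Y : R -> R -> R -> vec) : Prop :=
  exists delta, 0 < delta /\
  forall c, In c (charts S) ->
    let U := fun t x y => Rabs t < eps /\ chart_nbhd c delta x y in
    Ck3 4 U (fun t x y => cx (local_rep c (Y t) x y)) /\
    Ck3 4 U (fun t x y => cy (local_rep c (Y t) x y)) /\
    Ck3 4 U (fun t x y => cz (local_rep c (Y t) x y)).

Definition regular (S : surface) (X : R -> R -> vec) : Prop :=
  forall c, In c (charts S) -> forall x y, chart_dom c x y ->
    normal_vec (local_rep c X) x y <> vzero.

Definition immersion_C4 (S : surface) (X : R -> R -> vec) : Prop :=
  well_defined S X /\ C4_map S X /\ regular S X.

Definition axially_symmetric (S : surface) (X : R -> R -> vec) : Prop :=
  exists r z : R -> R, forall u theta, in_surface S u ->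
    X u theta = Vec (r u * cos theta) (r u * sin theta) (z u).

(* Integral with respect to the area induced by X.  The coordinates
   (u, theta) cover the surface up to curves and poles. *)
Definition surface_integral (S : surface) (X : R -> R -> vec)
    (f : R -> R -> R) : R :=
  RInt (fun u =>
    RInt (fun theta => f u theta * area_density X u theta) 0 (2 * PI))
    (u0 S) (u1 S).

Definition helfrich_energy (S : surface) (co : R) (X : R -> R -> vec) : R :=
  surface_integral S X (fun u theta => (mean_curvature X u theta + co) ^ 2).

Definition G_energy (S : surface) (co : R) (X : R -> R -> vec) : R :=
  surface_integral S X (fun u theta => 1 / (cz (X u theta)) ^ 2) +
  2 * co *
  surface_integral S X
    (fun u theta => cz (unit_normal X u theta) / cz (X u theta)).

(* Y t, |t| < eps, is a variation of X through immersions; no restriction at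
   the boundary yet. *)
Definition variation (S : surface) (X : R -> R -> vec) (eps : R)
    (Y : R -> R -> R -> vec) : Prop :=
  0 < eps /\
  C4_family S eps Y /\
  (forall t, Rabs t < eps -> well_defined S (Y t) /\ regular S (Y t)) /\
  (forall u theta, in_surface S u -> Y 0 u theta = X u theta).

Definition vanishes_on_boundary (S : surface) (X : R -> R -> vec) (eps : R)
    (Y : R -> R -> R -> vec) : Prop :=
  forall t u theta, Rabs t < eps -> on_boundary S u -> Y t u theta = X u theta.

(* The support is contained in a compact subset, independent of t, of the
   interior of the surface. *)
Definition compactly_supported (S : surface) (X : R -> R -> vec) (eps : R)
    (Y : R -> R -> R -> vec) : Prop :=
  exists eta, 0 < eta /\
  forall t u theta, Rabs t < eps -> in_surface S u -> near_boundary S eta u ->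
    Y t u theta = X u theta.

Definition G_critical (S : surface) (co : R) (X : R -> R -> vec) : Prop :=
  forall eps Y, variation S X eps Y -> vanishes_on_boundary S X eps Y ->
    is_derive (fun t => G_energy S co (Y t)) 0 0.

Definition helfrich_critical (S : surface) (co : R) (X : R -> R -> vec) : Prop :=
  forall eps Y, variation S X eps Y -> compactly_supported S X eps Y ->
    is_derive (fun t => helfrich_energy S co (Y t)) 0 0.

Definition reduced_membrane_equation (S : surface) (co : R)
    (X : R -> R -> vec) : Prop :=
  forall c, In c (charts S) -> forall x y, chart_dom c x y ->
    mean_curvature (local_rep c X) x y + co =
    - (cz (unit_normal (local_rep c X) x y) / cz (local_rep c X x y)).

(* Main.v *)
Require Import Defs.
From Stdlib Require Import Reals List Lra Lia ZArith Classical ClassicalEpsilon.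
From Coquelicot Require Import Coquelicot.
Open Scope R_scope.

(** Write [N = X_1 x X_2] for the coordinate normal of a surface, [nu] for the
    unit normal, and let the defect [Psi = H + co + nu_3 / z] measure the failure
    of the reduced membrane equation.  Everything rests on two pointwise
    identities for immersed surfaces off the plane [z = 0].

    The first variation of [G].  For a variation with velocity [V] the integrand
    of [G] changes at the rate [- 2 Psi (V . N) / z^2] plus a divergence
    ([first_variation_G]).  The divergence integrates to zero when [V] vanishes
    on the boundary ([G_derivative]), so [Psi = 0] makes the surface critical for
    [G].  Conversely, bumps localised around a point, in a constant direction,
    show that [Psi] vanishes on the open cylinder when the surface is critical
    ([defect_zero_rect]), and continuity carries this to the boundary and to the
    poles ([critical_membrane]).

    The Helfrich energy.  Since [2 H nu_3 = Delta z] and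
    [|grad z|^2 = 1 - nu_3^2], expanding [Psi^2] gives
    [(H + co)^2 = Psi^2 - (1 / z^2 + 2 co nu_3 / z) - div (grad z / z)]
    ([helfrich_density_identity]).  For variations with compact support the
    Helfrich energy is therefore the integral of [Psi^2], minus [G], minus a
    constant boundary flux ([helfrich_identity]).  Where [Psi = 0] the first
    term is stationary because it is quadratic, and [G] is stationary by the first
    part.

    Both identities reduce to vector algebra through
    [X_2 x nu_1 - X_1 x nu_2 = 2 H N] ([curvature_identity]), which follows from
    [nu] being a unit field.

    The analytic difficulty is that integrals are taken in the coordinates
    [(u, theta)], which degenerate at poles, while regularity at a pole is known
    in Cartesian coordinates.  In polar coordinates around a pole an integrand is
    the Cartesian one times the Jacobian [rho], and the flux of a vector field
    through a parallel carries a factor [rho] as well.  As polar coordinates make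
    sense for negative [rho], integrands and fluxes continue across the pole
    ([extend_to_ends], [density_extend], [flux_extend]).  After that one differentiates
    under the integral sign ([is_derive_dint]) and applies the divergence theorem
    ([dint_divergence]) on a closed rectangle. *)

(** * Calculus in three variables *)

Definition cont3 (f : R -> R -> R -> R) (t x y : R) : Prop :=
  continuous (fun p : R * (R * R) => f (fst p) (fst (snd p)) (snd (snd p)))
    (t, (x, y)).

Definition near3 (P : R -> R -> R -> Prop) (t x y : R) : Prop :=
  locally (t, (x, y))
    (fun p : R * (R * R) => P (fst p) (fst (snd p)) (snd (snd p))).

Definition open3 (U : R -> R -> R -> Prop) : Prop :=
  forall t x y, U t x y -> near3 U t x y.

Lemma near3_box P t x y :
  near3 P t x y <->
  exists d : posreal, forall t' x' y',
    Rabs (t' - t) < d -> Rabs (x' - x) < d -> Rabs (y' - y) < d -> P t' x' y'.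
Proof.
  split; intros [d H]; exists d.
  - intros t' x' y' A B C. apply (H (t', (x', y'))). repeat split; assumption.
  - intros [t' [x' y']] [A [B C]]. apply H; assumption.
Qed.

Lemma near3_and P Q t x y :
  near3 P t x y -> near3 Q t x y ->
  near3 (fun a b c => P a b c /\ Q a b c) t x y.
Proof. intros A B. exact (filter_and _ _ A B). Qed.

Lemma near3_imp (P Q : R -> R -> R -> Prop) t x y :
  (forall a b c, P a b c -> Q a b c) -> near3 P t x y -> near3 Q t x y.
Proof. intros H. unfold near3. apply filter_imp. intros p. apply H. Qed.

Lemma near3_pt P t x y : near3 P t x y -> P t x y.
Proof. intros H. exact (locally_singleton _ _ H). Qed.

Lemma near3_near3 P t x y : near3 P t x y -> near3 (near3 P) t x y.
Proof.
  intros H. apply locally_locally in H. revert H. unfold near3. apply filter_imp.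
  intros [a [b c]] H. exact H.
Qed.

Lemma near3_slices P t x y :
  near3 P t x y ->
  locally t (fun s => P s x y) /\ locally x (fun s => P t s y) /\
  locally y (fun s => P t x s).
Proof.
  intros H. apply near3_box in H. destruct H as [d H].
  assert (Z : forall a, Rabs (a - a) < d).
  { intros a. unfold Rminus. rewrite Rplus_opp_r, Rabs_R0. apply d. }
  repeat split; exists d; intros s Hs; apply H; auto.
Qed.

Lemma near3_slices2 P t x y :
  near3 P t x y ->
  locally_2d (fun a b => P a b y) t x /\ locally_2d (fun a b => P a x b) t y /\
  locally_2d (fun a b => P t a b) x y.
Proof.
  intros H. apply near3_box in H. destruct H as [d H].
  assert (Z : forall a, Rabs (a - a) < d).
  { intros a. unfold Rminus. rewrite Rplus_opp_r, Rabs_R0. apply d. }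
  repeat split; exists d; intros a b Ha Hb; apply H; auto.
Qed.

Lemma near3_2d P t x y :
  near3 P t x y -> locally_2d (fun a b => P t a b) x y.
Proof. intros H. apply (near3_slices2 _ _ _ _ H). Qed.

Lemma cont3_ext_near f g t x y :
  near3 (fun a b c => f a b c = g a b c) t x y -> cont3 f t x y -> cont3 g t x y.
Proof. intros H. apply continuous_ext_loc. exact H. Qed.

Lemma cont3_eps f t x y :
  cont3 f t x y <->
  (forall eps : posreal, near3 (fun a b c => Rabs (f a b c - f t x y) < eps) t x y).
Proof.
  split.
  - intros H eps. unfold cont3, continuous in H. cbn in H.
    apply (H (fun v => Rabs (v - f t x y) < eps)). exists eps. intros v Hv. exact Hv.
  - intros H P [eps HP]. specialize (H eps). unfold near3 in H. unfold filtermap.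
    revert H. apply filter_imp. intros p Hp. apply HP. exact Hp.
Qed.

Lemma cont3_comp1 (phi : R -> R) f t x y :
  cont3 f t x y -> continuous phi (f t x y) ->
  cont3 (fun a b c => phi (f a b c)) t x y.
Proof.
  intros H K. exact (continuous_comp _ phi (t, (x, y)) H K).
Qed.

Lemma cont3_comp3 f a b c t x y :
  cont3 a t x y -> cont3 b t x y -> cont3 c t x y ->
  cont3 f (a t x y) (b t x y) (c t x y) ->
  cont3 (fun p q r => f (a p q r) (b p q r) (c p q r)) t x y.
Proof.
  intros A B C H.
  pose (g1 := fun p : R * (R * R) => a (fst p) (fst (snd p)) (snd (snd p))).
  pose (g2 := fun p : R * (R * R) =>
    (b (fst p) (fst (snd p)) (snd (snd p)), c (fst p) (fst (snd p)) (snd (snd p)))).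
  apply (continuous_comp_2 g1 g2
    (fun p q => f p (fst q) (snd q)) (t, (x, y))).
  - exact A.
  - apply (continuous_comp_2 _ _ (fun u v : R => (u, v)) (t, (x, y)) B C).
    apply continuous_ext with (f := fun z : R * R => z).
    + intros [u v]. reflexivity.
    + apply continuous_id.
  - exact H.
Qed.

Lemma cont3_const k t x y : cont3 (fun _ _ _ => k) t x y.
Proof. apply continuous_const. Qed.
Lemma cont3_t t x y : cont3 (fun a _ _ => a) t x y.
Proof. apply continuous_fst. Qed.
Lemma cont3_x t x y : cont3 (fun _ a _ => a) t x y.
Proof.
  apply (continuous_comp snd (fun q : R * R => fst q)).
  apply continuous_snd. apply continuous_fst.
Qed.
Lemma cont3_y t x y : cont3 (fun _ _ a => a) t x y.
Proof.
  apply (continuous_comp snd (fun q : R * R => snd q)).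
  apply continuous_snd. apply continuous_snd.
Qed.
Lemma cont3_plus f g t x y :
  cont3 f t x y -> cont3 g t x y -> cont3 (fun a b c => f a b c + g a b c) t x y.
Proof. intros A B. exact (continuous_plus _ _ _ A B). Qed.
Lemma cont3_opp f t x y : cont3 f t x y -> cont3 (fun a b c => - f a b c) t x y.
Proof. intros A. exact (continuous_opp _ _ A). Qed.
Lemma cont3_mult f g t x y :
  cont3 f t x y -> cont3 g t x y -> cont3 (fun a b c => f a b c * g a b c) t x y.
Proof. intros A B. exact (continuous_mult _ _ _ A B). Qed.

Lemma cont3_slices2 f t x y : cont3 f t x y ->
  continuity_2d_pt (fun a b => f a b y) t x /\ continuity_2d_pt (fun a b => f a x b) t y /\
  continuity_2d_pt (fun a b => f t a b) x y.
Proof.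
  intros H. pose proof (proj1 (cont3_eps f t x y) H) as K.
  split; [|split]; intros eps; apply (near3_slices2 _ _ _ _ (K eps)).
Qed.

Lemma cont3_2d f t x y : cont3 f t x y -> continuity_2d_pt (fun a b => f t a b) x y.
Proof. intros H. apply (cont3_slices2 f t x y H). Qed.

Lemma cont3_neq0 f t x y :
  cont3 f t x y -> f t x y <> 0 -> near3 (fun a b c => f a b c <> 0) t x y.
Proof.
  intros H N.
  pose proof (proj1 (cont3_eps f t x y) H (mkposreal _ (Rabs_pos_lt _ N))) as K.
  revert K. apply near3_imp. cbn. intros a b c K Z. rewrite Z in K.
  replace (0 - f t x y) with (- f t x y) in K by ring. rewrite Rabs_Ropp in K. lra.
Qed.

Lemma cont3_lt f t x y k :
  cont3 f t x y -> f t x y < k -> near3 (fun a b c => f a b c < k) t x y.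
Proof.
  intros H N.
  assert (P : 0 < k - f t x y) by lra.
  pose proof (proj1 (cont3_eps f t x y) H (mkposreal _ P)) as K.
  revert K. apply near3_imp. cbn. intros a b c K. apply Rabs_def2 in K. lra.
Qed.

(** The three coordinate directions, so that statements about partial
    derivatives are proved once. *)
Inductive dir := dirT | dirX | dirY.

Definition line (d : dir) (f : R -> R -> R -> R) (t x y : R) : R -> R :=
  match d with
  | dirT => fun s => f s x y
  | dirX => fun s => f t s y
  | dirY => fun s => f t x s
  end.

Definition coord (d : dir) (t x y : R) : R :=
  match d with dirT => t | dirX => x | dirY => y end.

Definition D3 (d : dir) (f : R -> R -> R -> R) (t x y : R) : R :=
  Derive (line d f t x y) (coord d t x y).

Definition ex_D3 (d : dir) (f : R -> R -> R -> R) (t x y : R) : Prop :=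
  ex_derive (line d f t x y) (coord d t x y).

Lemma Ck3_S k U f :
  Ck3 (S k) U f <->
  (forall d t x y, U t x y -> ex_D3 d f t x y) /\ (forall d, Ck3 k U (D3 d f)).
Proof.
  split.
  - intros [A [B [C D]]]. split.
    + intros d t x y H. destruct (A t x y H) as [P [Q T]]. destruct d; assumption.
    + intros []; assumption.
  - intros [A B]. split.
    + intros t x y H. exact (conj (A dirT t x y H) (conj (A dirX t x y H) (A dirY t x y H))).
    + exact (conj (B dirT) (conj (B dirX) (B dirY))).
Qed.

Lemma line_near d P t x y :
  near3 P t x y ->
  locally (coord d t x y)
    (fun s => match d with dirT => P s x y | dirX => P t s y | dirY => P t x s end).
Proof. intros H. apply near3_slices in H. destruct d; apply H. Qed.

Lemma line_ext_near d f g t x y :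
  near3 (fun a b c => f a b c = g a b c) t x y ->
  locally (coord d t x y) (fun s => line d f t x y s = line d g t x y s).
Proof.
  intros H. generalize (line_near d _ _ _ _ H). apply filter_imp.
  intros s. destruct d; trivial.
Qed.

Lemma D3_ext_near d f g t x y :
  near3 (fun a b c => f a b c = g a b c) t x y -> D3 d f t x y = D3 d g t x y.
Proof. intros H. apply Derive_ext_loc. apply line_ext_near. exact H. Qed.

Lemma ex_D3_ext_near d f g t x y :
  near3 (fun a b c => f a b c = g a b c) t x y -> ex_D3 d f t x y -> ex_D3 d g t x y.
Proof. intros H. apply ex_derive_ext_loc. apply line_ext_near. exact H. Qed.

Lemma Ck3_ext k U f g :
  open3 U -> (forall t x y, U t x y -> f t x y = g t x y) ->
  Ck3 k U f -> Ck3 k U g.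
Proof.
  intros O. revert f g. induction k as [|k IH]; intros f g E H.
  - intros t x y Hu. apply (cont3_ext_near f).
    + generalize (O _ _ _ Hu). apply near3_imp. exact E.
    + exact (H t x y Hu).
  - assert (N : forall t x y, U t x y -> near3 (fun a b c => f a b c = g a b c) t x y).
    { intros t x y Hu. generalize (O _ _ _ Hu). apply near3_imp. exact E. }
    apply Ck3_S in H. destruct H as [A B]. apply Ck3_S. split.
    + intros d t x y Hu. apply (ex_D3_ext_near d f); auto.
    + intros d. apply (IH (D3 d f)); auto.
      intros t x y Hu. apply D3_ext_near. auto.
Qed.

Lemma Ck3_sub k (U V : R -> R -> R -> Prop) f :
  (forall t x y, V t x y -> U t x y) -> Ck3 k U f -> Ck3 k V f.
Proof.
  intros S. revert f. induction k as [|k IH]; intros f H.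
  - intros t x y Hv. apply H. auto.
  - apply Ck3_S in H. apply Ck3_S. destruct H as [A B]. split; auto.
Qed.

Lemma Ck3_union k (U V W : R -> R -> R -> Prop) f :
  (forall t x y, W t x y -> U t x y \/ V t x y) ->
  Ck3 k U f -> Ck3 k V f -> Ck3 k W f.
Proof.
  intros S. revert f. induction k as [|k IH]; intros f H K.
  - intros t x y Hw. destruct (S _ _ _ Hw); [apply H | apply K]; auto.
  - apply Ck3_S in H. apply Ck3_S in K. apply Ck3_S.
    destruct H as [A B], K as [A' B']. split; auto.
    intros d t x y Hw. destruct (S _ _ _ Hw); auto.
Qed.

Lemma mean_value_bound (g : R -> R) a b M :
  (forall s, Rabs (s - a) <= Rabs (b - a) -> ex_derive g s /\ Rabs (Derive g s) <= M) ->
  Rabs (g b - g a) <= M * Rabs (b - a).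
Proof.
  intros H.
  assert (I : forall s, Rmin a b <= s <= Rmax a b -> Rabs (s - a) <= Rabs (b - a)).
  { intros s. unfold Rmin, Rmax. destruct (Rle_dec a b); intros J;
    unfold Rabs; destruct (Rcase_abs (s - a)); destruct (Rcase_abs (b - a)); lra. }
  destruct (MVT_gen g a b (Derive g)) as [c [Hc E]].
  - intros s Hs. apply Derive_correct. apply H. apply I. lra.
  - intros s Hs. apply derivable_continuous_pt. apply ex_derive_Reals_0.
    apply H. apply I. lra.
  - rewrite E, Rabs_mult. apply Rmult_le_compat_r. apply Rabs_pos. apply H. auto.
Qed.

(** Move one coordinate at a time and use the mean value theorem. *)
Lemma C1_cont3 f t x y :
  near3 (fun a b c => forall d, ex_D3 d f a b c) t x y ->
  (forall d, cont3 (D3 d f) t x y) -> cont3 f t x y.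
Proof.
  intros H K. apply cont3_eps. intros eps.
  set (M := 1 + Rabs (D3 dirT f t x y) + Rabs (D3 dirX f t x y) + Rabs (D3 dirY f t x y)).
  assert (M0 : 0 < M).
  { unfold M. pose proof (Rabs_pos (D3 dirT f t x y)).
    pose proof (Rabs_pos (D3 dirX f t x y)). pose proof (Rabs_pos (D3 dirY f t x y)). lra. }
  assert (B : near3 (fun a b c => forall d, Rabs (D3 d f a b c) <= M) t x y).
  { assert (Bd : forall d, near3 (fun a b c => Rabs (D3 d f a b c) <= M) t x y).
    { intros d. generalize (proj1 (cont3_eps _ _ _ _) (K d) (mkposreal 1 Rlt_0_1)).
      apply near3_imp. cbn. intros a b c Q.
      pose proof (Rabs_triang (D3 d f a b c - D3 d f t x y) (D3 d f t x y)) as T.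
      replace (D3 d f a b c - D3 d f t x y + D3 d f t x y) with (D3 d f a b c) in T by ring.
      pose proof (Rabs_pos (D3 dirT f t x y)).
      pose proof (Rabs_pos (D3 dirX f t x y)). pose proof (Rabs_pos (D3 dirY f t x y)).
      unfold M. destruct d; lra. }
    generalize (near3_and _ _ _ _ _ (Bd dirT) (near3_and _ _ _ _ _ (Bd dirX) (Bd dirY))).
    apply near3_imp. intros a b c [P [Q T]] []; assumption. }
  pose proof (near3_and _ _ _ _ _ H B) as HB. apply near3_box in HB.
  destruct HB as [d HB].
  assert (P0 : 0 < Rmin d (eps / (4 * M))).
  { apply Rmin_glb_lt. apply d. apply Rdiv_lt_0_compat. apply eps. lra. }
  apply near3_box. exists (mkposreal _ P0). cbn. intros a b c Ha Hb Hc.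
  assert (Z : forall r, Rabs (r - r) < d).
  { intros r. unfold Rminus. rewrite Rplus_opp_r, Rabs_R0. apply d. }
  pose proof (Rmin_l d (eps / (4 * M))). pose proof (Rmin_r d (eps / (4 * M))).
  assert (E1 : Rabs (f a b c - f t b c) <= M * Rabs (a - t)).
  { apply (mean_value_bound (fun s => f s b c)). intros s Hs.
    destruct (HB s b c) as [P Q]; try lra. exact (conj (P dirT) (Q dirT)). }
  assert (E2 : Rabs (f t b c - f t x c) <= M * Rabs (b - x)).
  { apply (mean_value_bound (fun s => f t s c)). intros s Hs.
    destruct (HB t s c) as [P Q]; auto; try lra. exact (conj (P dirX) (Q dirX)). }
  assert (E3 : Rabs (f t x c - f t x y) <= M * Rabs (c - y)).
  { apply (mean_value_bound (fun s => f t x s)). intros s Hs.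
    destruct (HB t x s) as [P Q]; auto; try lra. exact (conj (P dirY) (Q dirY)). }
  assert (F : forall r, r < Rmin d (eps / (4 * M)) -> M * r < eps / 4).
  { intros r Hr. replace (eps / 4) with (M * (eps / (4 * M))) by (field; lra).
    apply Rmult_lt_compat_l; lra. }
  pose proof (F _ Ha). pose proof (F _ Hb). pose proof (F _ Hc).
  replace (f a b c - f t x y) with
    ((f a b c - f t b c) + ((f t b c - f t x c) + (f t x c - f t x y))) by ring.
  pose proof (Rabs_triang (f a b c - f t b c) ((f t b c - f t x c) + (f t x c - f t x y))).
  pose proof (Rabs_triang (f t b c - f t x c) (f t x c - f t x y)).
  pose proof (cond_pos eps). lra.
Qed.

Lemma Ck3_cont U f : open3 U -> Ck3 1 U f -> Ck3 0 U f.
Proof.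
  intros O H t x y Hu. apply Ck3_S in H. destruct H as [A B].
  apply C1_cont3.
  - generalize (O _ _ _ Hu). apply near3_imp. auto.
  - intros d. exact (B d t x y Hu).
Qed.

Lemma Ck3_le k m U f : open3 U -> (k <= m)%nat -> Ck3 m U f -> Ck3 k U f.
Proof.
  intros O. assert (S1 : forall k f, Ck3 (S k) U f -> Ck3 k U f).
  { clear k m f. induction k as [|k IH]; intros f H.
    - apply Ck3_cont; auto.
    - apply Ck3_S in H. apply Ck3_S. destruct H; split; auto. }
  intros L. induction L; auto.
Qed.

Lemma Ck3_cont_pt k U f t x y : open3 U -> Ck3 k U f -> U t x y -> cont3 f t x y.
Proof.
  intros O H Hu. exact (Ck3_le 0 k U f O (Nat.le_0_l k) H t x y Hu).
Qed.

Lemma Ck3_D k U f d : Ck3 (S k) U f -> Ck3 k U (D3 d f).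
Proof. intros H. apply Ck3_S in H. apply H. Qed.

Lemma Ck3_ex_D k U f d t x y : Ck3 (S k) U f -> U t x y -> ex_D3 d f t x y.
Proof. intros H. apply Ck3_S in H. destruct H. auto. Qed.

Lemma Ck3_const k U c : open3 U -> Ck3 k U (fun _ _ _ => c).
Proof.
  intros O. revert c. induction k as [|k IH]; intros c.
  - intros t x y _. apply cont3_const.
  - apply Ck3_S. split.
    + intros [] t x y _; apply (ex_derive_const (V := R_NormedModule)).
    + intros d. apply (Ck3_ext k U (fun _ _ _ => 0)); auto.
      intros t x y _. destruct d; symmetry; apply (Derive_const c).
Qed.

Lemma Ck3_coord k U d : open3 U -> Ck3 k U (coord d).
Proof.
  intros O. destruct k as [|k].
  - intros t x y _. destruct d; [apply cont3_t | apply cont3_x | apply cont3_y].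
  - apply Ck3_S. split.
    + intros e t x y _. destruct d, e; unfold ex_D3, line, coord; auto_derive; exact I.
    + intros e.
      assert (E : forall t x y, (match d, e with dirT, dirT | dirX, dirX | dirY, dirY => 1 | _, _ => 0 end)
        = D3 e (coord d) t x y).
      { intros t x y. destruct d, e; unfold D3, line, coord; symmetry;
          apply is_derive_unique; auto_derive; trivial. }
      apply (Ck3_ext k U _ _ O (fun t x y _ => E t x y)). apply Ck3_const. exact O.
Qed.

Lemma Ck3_plus k U f g :
  open3 U -> Ck3 k U f -> Ck3 k U g -> Ck3 k U (fun t x y => f t x y + g t x y).
Proof.
  intros O. revert f g. induction k as [|k IH]; intros f g H K.
  - intros t x y Hu. apply cont3_plus; [apply H | apply K]; exact Hu.
  - apply Ck3_S in H. apply Ck3_S in K. destruct H as [A B], K as [A' B'].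
    apply Ck3_S. split.
    + intros d t x y Hu. specialize (A d t x y Hu). specialize (A' d t x y Hu).
      destruct d; exact (ex_derive_plus _ _ _ A A').
    + intros d. apply (Ck3_ext k U (fun t x y => D3 d f t x y + D3 d g t x y)); auto.
      intros t x y Hu. specialize (A d t x y Hu). specialize (A' d t x y Hu).
      symmetry. destruct d; exact (Derive_plus _ _ _ A A').
Qed.

Lemma Ck3_mult k U f g :
  open3 U -> Ck3 k U f -> Ck3 k U g -> Ck3 k U (fun t x y => f t x y * g t x y).
Proof.
  intros O. revert f g. induction k as [|k IH]; intros f g H K.
  - intros t x y Hu. apply cont3_mult; [apply H | apply K]; exact Hu.
  - pose proof (Ck3_le k (S k) U f O (Nat.le_succ_diag_r k) H) as Hf.
    pose proof (Ck3_le k (S k) U g O (Nat.le_succ_diag_r k) K) as Hg.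
    apply Ck3_S in H. apply Ck3_S in K. destruct H as [A B], K as [A' B'].
    apply Ck3_S. split.
    + intros d t x y Hu. specialize (A d t x y Hu). specialize (A' d t x y Hu).
      destruct d; exact (ex_derive_mult _ _ _ A A').
    + intros d. apply (Ck3_ext k U
        (fun t x y => D3 d f t x y * g t x y + f t x y * D3 d g t x y)); auto.
      * intros t x y Hu. specialize (A d t x y Hu). specialize (A' d t x y Hu).
        symmetry. destruct d; exact (Derive_mult _ _ _ A A').
      * apply Ck3_plus; auto.
Qed.

Fixpoint Ck1 (k : nat) (V : R -> Prop) (phi : R -> R) : Prop :=
  match k with
  | O => forall x, V x -> continuous phi x
  | S k' => (forall x, V x -> ex_derive phi x) /\ Ck1 k' V (Derive phi)
  end.

Lemma Ck3_comp k U V phi f :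
  open3 U -> Ck1 k V phi -> Ck3 k U f -> (forall t x y, U t x y -> V (f t x y)) ->
  Ck3 k U (fun t x y => phi (f t x y)).
Proof.
  intros O. revert phi f. induction k as [|k IH]; intros phi f P H S.
  - intros t x y Hu. apply cont3_comp1; auto. apply H. exact Hu.
  - pose proof (Ck3_le k _ U f O (Nat.le_succ_diag_r k) H) as Hf.
    apply Ck3_S in H. destruct H as [A B]. destruct P as [P Q].
    apply Ck3_S. split.
    + intros d t x y Hu. specialize (A d t x y Hu). specialize (P _ (S t x y Hu)).
      destruct d; exact (ex_derive_comp phi _ _ P A).
    + intros d. apply (Ck3_ext k U
        (fun t x y => D3 d f t x y * Derive phi (f t x y))); auto.
      * intros t x y Hu. specialize (A d t x y Hu). specialize (P _ (S t x y Hu)).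
        symmetry. destruct d; exact (Derive_comp phi _ _ P A).
      * apply Ck3_mult; auto.
Qed.

Lemma Ck1_ext k (V : R -> Prop) (phi psi : R -> R) :
  open V -> (forall x, V x -> phi x = psi x) -> Ck1 k V phi -> Ck1 k V psi.
Proof.
  intros O. revert phi psi. induction k as [|k IH]; intros phi psi E H.
  - intros x Hx. apply (continuous_ext_loc psi phi).
    + generalize (O x Hx). apply filter_imp. intros z Hz. auto.
    + apply H. exact Hx.
  - destruct H as [A B]. split.
    + intros x Hx. apply (ex_derive_ext_loc phi); auto.
      generalize (O x Hx). apply filter_imp. auto.
    + apply (IH (Derive phi)); auto. intros x Hx. apply Derive_ext_loc.
      generalize (O x Hx). apply filter_imp. auto.
Qed.

(** For the families [1 / x^n] and [1 / sqrt x^n], closed under differentiation up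
    to constant factors. *)
Lemma Ck1_powers (V : R -> Prop) (phi : nat -> R -> R) (a : nat -> R) (next : nat -> nat) :
  open V ->
  (forall n c x, V x -> is_derive (fun x => c * phi n x) x (c * a n * phi (next n) x)) ->
  forall k n c, Ck1 k V (fun x => c * phi n x).
Proof.
  intros O E. induction k as [|k IH]; intros n c.
  - intros x Hx. apply (@ex_derive_continuous R_AbsRing R_NormedModule).
    eexists. apply E; exact Hx.
  - split.
    + intros x Hx. eexists. apply E; exact Hx.
    + apply (Ck1_ext k _ (fun x => c * a n * phi (next n) x)); auto.
      intros x Hx. symmetry. apply is_derive_unique. apply E; exact Hx.
Qed.

Lemma Ck1_inv k : Ck1 k (fun x => x <> 0) Rinv.
Proof.
  apply (Ck1_ext k _ (fun x => 1 * / x ^ 1)).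
  - exact (open_neq 0).
  - intros x Hx. field. exact Hx.
  - apply (Ck1_powers _ (fun n x => / x ^ n) (fun n => - INR n) S (open_neq 0)).
    intros n c x Hx. auto_derive. apply pow_nonzero; exact Hx.
    destruct n as [|n]; [cbn; field; exact Hx|].
    pose proof (pow_nonzero x n Hx). cbn [Nat.pred]. rewrite S_INR. cbn [pow].
    field. auto.
Qed.

Lemma Ck1_sqrt k : Ck1 k (fun x => 0 < x) sqrt.
Proof.
  assert (P : forall k n c, Ck1 k (fun x => 0 < x) (fun x => c * / sqrt x ^ n)).
  { apply (Ck1_powers _ (fun n x => / sqrt x ^ n) (fun n => - INR n / 2) (fun n => S (S n))
      (open_gt 0)).
    intros n c x Hx. pose proof (sqrt_lt_R0 x Hx) as Hs.
    auto_derive. split; auto. split; auto. apply pow_nonzero; lra.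
    destruct n as [|n]; [cbn; field; lra|].
    pose proof (pow_nonzero (sqrt x) n (Rgt_not_eq _ _ Hs)).
    cbn [Nat.pred]. rewrite S_INR. cbn [pow]. field. lra. }
  destruct k as [|k].
  - intros x Hx. apply continuous_sqrt.
  - split.
    + intros x Hx. auto_derive. exact Hx.
    + apply (Ck1_ext k _ (fun x => (1 / 2) * / sqrt x ^ 1)); [exact (open_gt 0) | | apply P].
      intros x Hx. symmetry. apply is_derive_unique. auto_derive. exact Hx.
      pose proof (sqrt_lt_R0 x Hx). field. lra.
Qed.

Lemma Ck3_inv k U f :
  open3 U -> Ck3 k U f -> (forall t x y, U t x y -> f t x y <> 0) ->
  Ck3 k U (fun t x y => / f t x y).
Proof. intros O H N. apply (Ck3_comp k U (fun x => x <> 0) Rinv); auto. apply Ck1_inv. Qed.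

Lemma Ck3_sqrt k U f :
  open3 U -> Ck3 k U f -> (forall t x y, U t x y -> 0 < f t x y) ->
  Ck3 k U (fun t x y => sqrt (f t x y)).
Proof. intros O H N. apply (Ck3_comp k U (fun x => 0 < x) sqrt); auto. apply Ck1_sqrt. Qed.

Lemma Ck3_opp k U f : open3 U -> Ck3 k U f -> Ck3 k U (fun t x y => - f t x y).
Proof.
  intros O H. apply (Ck3_ext k U (fun t x y => (-1) * f t x y)); auto.
  intros; ring. apply Ck3_mult; auto. apply Ck3_const; auto.
Qed.

Lemma Ck3_minus k U f g :
  open3 U -> Ck3 k U f -> Ck3 k U g -> Ck3 k U (fun t x y => f t x y - g t x y).
Proof. intros O H K. apply Ck3_plus; auto. apply Ck3_opp; auto. Qed.

Lemma Ck3_div k U f g :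
  open3 U -> Ck3 k U f -> Ck3 k U g -> (forall t x y, U t x y -> g t x y <> 0) ->
  Ck3 k U (fun t x y => f t x y / g t x y).
Proof. intros O H K N. apply Ck3_mult; auto. apply Ck3_inv; auto. Qed.

Lemma Ck3_pow k U f n : open3 U -> Ck3 k U f -> Ck3 k U (fun t x y => f t x y ^ n).
Proof.
  intros O H. induction n as [|n IH]; cbn [pow].
  - apply Ck3_const; auto.
  - apply Ck3_mult; auto.
Qed.

Lemma Ck3_Schwarz U f t x y d e :
  open3 U -> Ck3 2 U f -> U t x y -> D3 d (D3 e f) t x y = D3 e (D3 d f) t x y.
Proof.
  intros O H Hu.
  assert (E1 : forall d a b c, U a b c -> ex_D3 d f a b c).
  { intros d' a b c. apply (Ck3_ex_D 1). exact H. }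
  assert (E2 : forall d e a b c, U a b c -> ex_D3 d (D3 e f) a b c).
  { intros d' e' a b c. apply (Ck3_ex_D 0). apply Ck3_D. exact H. }
  assert (C : forall d e, cont3 (D3 d (D3 e f)) t x y).
  { intros d' e'. exact (Ck3_D 0 U _ d' (Ck3_D 1 U f e' H) t x y Hu). }
  pose proof (near3_slices2 _ _ _ _ (O _ _ _ Hu)) as [Ntx [Nty Nxy]].
  assert (TX : D3 dirT (D3 dirX f) t x y = D3 dirX (D3 dirT f) t x y).
  { refine (Schwarz (fun a b => f a b y) t x _ _ _).
    - revert Ntx. apply locally_2d_impl. apply locally_2d_forall. intros a b K.
      exact (conj (E1 dirT a b y K) (conj (E1 dirX a b y K)
        (conj (E2 dirT dirX a b y K) (E2 dirX dirT a b y K)))).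
    - exact (proj1 (cont3_slices2 _ _ _ _ (C dirT dirX))).
    - exact (proj1 (cont3_slices2 _ _ _ _ (C dirX dirT))). }
  assert (TY : D3 dirT (D3 dirY f) t x y = D3 dirY (D3 dirT f) t x y).
  { refine (Schwarz (fun a b => f a x b) t y _ _ _).
    - revert Nty. apply locally_2d_impl. apply locally_2d_forall. intros a b K.
      exact (conj (E1 dirT a x b K) (conj (E1 dirY a x b K)
        (conj (E2 dirT dirY a x b K) (E2 dirY dirT a x b K)))).
    - exact (proj1 (proj2 (cont3_slices2 _ _ _ _ (C dirT dirY)))).
    - exact (proj1 (proj2 (cont3_slices2 _ _ _ _ (C dirY dirT)))). }
  assert (XY : D3 dirX (D3 dirY f) t x y = D3 dirY (D3 dirX f) t x y).
  { refine (Schwarz (fun a b => f t a b) x y _ _ _).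
    - revert Nxy. apply locally_2d_impl. apply locally_2d_forall. intros a b K.
      exact (conj (E1 dirX t a b K) (conj (E1 dirY t a b K)
        (conj (E2 dirX dirY t a b K) (E2 dirY dirX t a b K)))).
    - exact (proj2 (proj2 (cont3_slices2 _ _ _ _ (C dirX dirY)))).
    - exact (proj2 (proj2 (cont3_slices2 _ _ _ _ (C dirY dirX)))). }
  destruct d, e; congruence.
Qed.

Lemma Ck2_Ck3 k (V : R -> R -> Prop) (U : R -> R -> R -> Prop) f :
  open3 U -> (forall t x y, U t x y -> V x y) ->
  Ck2 k V f -> Ck3 k U (fun _ x y => f x y).
Proof.
  intros O S. revert f. induction k as [|k IH]; intros f H.
  - intros t x y Hu. specialize (H x y (S _ _ _ Hu)).
    apply (proj2 (cont3_eps (fun _ a b => f a b) t x y)). intros eps.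
    specialize (H eps). destruct H as [r H]. apply near3_box. exists r. intros a b c _ Hb Hc. apply H; auto.
  - destruct H as [A [B C]]. apply Ck3_S. split.
    + intros d t x y Hu. destruct (A x y (S _ _ _ Hu)) as [P Q]. destruct d; auto.
      apply (ex_derive_const (V := R_NormedModule)).
    + intros [].
      * apply (Ck3_ext k U (fun _ _ _ => 0)); auto.
        { intros t x y _. symmetry. apply (Derive_const (f x y)). }
        apply Ck3_const; auto.
      * apply (IH (pd1 f)). exact B.
      * apply (IH (pd2 f)). exact C.
Qed.

(** * Iterated integrals over a rectangle *)

Definition rect (a b c d x y : R) : Prop := a <= x <= b /\ c <= y <= d.

Definition cont_rect (a b c d : R) (f : R -> R -> R) : Prop :=
  forall x y, rect a b c d x y -> continuity_2d_pt f x y.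

Definition dint (a b c d : R) (f : R -> R -> R) : R :=
  RInt (fun x => RInt (fun y => f x y) c d) a b.

(** Compactness of the rectangle turns neighbourhoods of its points at time 0
    into a common time interval.  All short times below come from here. *)
Lemma tube a b c d (P : R -> R -> R -> Prop) :
  (forall x y, rect a b c d x y -> near3 P 0 x y) ->
  exists r : posreal, forall t x y, Rabs t < r -> rect a b c d x y -> P t x y.
Proof.
  intros H.
  assert (C : forall x y, exists r : posreal, rect a b c d x y ->
    forall t' x' y', Rabs t' < r -> Rabs (x' - x) < r -> Rabs (y' - y) < r -> P t' x' y').
  { intros x y. destruct (classic (rect a b c d x y)) as [Hr|Hr].
    - specialize (H x y Hr). apply near3_box in H. destruct H as [r Q].
      exists r. intros _ t' x' y' Ht. apply Q. now rewrite Rminus_0_r.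
    - exists (mkposreal 1 Rlt_0_1). contradiction. }
  pose (r := fun x y => proj1_sig (constructive_indefinite_description _ (C x y))).
  assert (Hr : forall x y, rect a b c d x y -> forall t' x' y',
    Rabs t' < r x y -> Rabs (x' - x) < r x y -> Rabs (y' - y) < r x y -> P t' x' y').
  { intros x y. exact (proj2_sig (constructive_indefinite_description _ (C x y))). }
  destruct (compactness_value_2d a b c d r) as [e He].
  exists e. intros t x y Ht [Hx Hy].
  apply NNPP. intros N. apply (He x y Hx Hy). intros [u [v [Hu [Hv [A [B D]]]]]].
  apply N. apply (Hr u v); auto. split; auto. lra.
Qed.

(** Composing with [clamp] gives two-sided continuity at the end points, which
    the existence theorems for integrals ask for. *)
Definition clamp (a b x : R) : R := Rmax a (Rmin b x).

Lemma clamp_in a b x : a <= b -> a <= clamp a b x <= b.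
Proof.
  intros H. unfold clamp, Rmax, Rmin.
  destruct (Rle_dec b x); destruct (Rle_dec a _); lra.
Qed.

Lemma clamp_id a b x : a <= x <= b -> clamp a b x = x.
Proof.
  intros H. unfold clamp, Rmax, Rmin.
  destruct (Rle_dec b x); destruct (Rle_dec a _); lra.
Qed.

Lemma clamp_lip a b x y : Rabs (clamp a b x - clamp a b y) <= Rabs (x - y).
Proof.
  unfold clamp, Rmax, Rmin.
  destruct (Rle_dec b x); destruct (Rle_dec b y); repeat destruct (Rle_dec a _);
  unfold Rabs; repeat destruct Rcase_abs; lra.
Qed.

Lemma continuity_2d_slice f x y :
  continuity_2d_pt f x y -> continuous (fun y => f x y) y.
Proof.
  intros H. apply continuity_pt_filterlim. intros eps He.
  destruct (H (mkposreal eps He)) as [r Hr]. exists r. split. apply r.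
  intros z [_ Hz]. apply Hr; auto.
  unfold Rminus. rewrite Rplus_opp_r, Rabs_R0. apply r.
Qed.

Lemma ex_RInt_cont (f : R -> R) p q :
  (forall x, Rmin p q <= x <= Rmax p q -> continuous f x) -> ex_RInt f p q.
Proof. apply (ex_RInt_continuous (V := R_CompleteNormedModule)). Qed.

Section Rectangle.
Variables a b c d : R.
Hypothesis ab : a <= b.
Hypothesis cd : c <= d.

Lemma cont_rect_inner f x :
  cont_rect a b c d f -> a <= x <= b -> ex_RInt (fun y => f x y) c d.
Proof.
  intros H Hx. apply ex_RInt_cont. intros y Hy. rewrite Rmin_left, Rmax_right in Hy; auto.
  apply continuity_2d_slice. apply H. split; auto.
Qed.

Lemma RInt_clamp_continuous f x :
  cont_rect a b c d f ->
  continuous (fun x => RInt (fun y => f (clamp a b x) y) c d) x.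
Proof.
  intros H. apply continuity_pt_filterlim. intros eps He.
  assert (He' : 0 < eps / (2 * (d - c + 1))). { apply Rdiv_lt_0_compat; lra. }
  destruct (uniform_continuity_2d f a b c d (fun x y p q => H x y (conj p q))
    (mkposreal _ He')) as [r Hr].
  exists r. split. apply r. intros z [_ Hz].
  change (Rabs (z - x) < r) in Hz.
  change (Rabs (RInt (fun y => f (clamp a b z) y) c d -
    RInt (fun y => f (clamp a b x) y) c d) < eps).
  assert (I : forall x, ex_RInt (fun y => f (clamp a b x) y) c d).
  { intros w. apply cont_rect_inner; auto. apply clamp_in; auto. }
  assert (E : RInt (fun y => f (clamp a b z) y) c d - RInt (fun y => f (clamp a b x) y) c d
    = RInt (fun y => f (clamp a b z) y - f (clamp a b x) y) c d).
  { symmetry. exact (RInt_minus _ _ c d (I z) (I x)). }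
  rewrite E.
  apply Rle_lt_trans with ((d - c) * (eps / (2 * (d - c + 1)))).
  - apply abs_RInt_le_const; auto.
    + exact (ex_RInt_minus _ _ c d (I z) (I x)).
    + intros y Hy. left. apply Hr; auto using clamp_in.
      * eapply Rle_lt_trans. apply clamp_lip. exact Hz.
      * unfold Rminus. rewrite Rplus_opp_r, Rabs_R0. apply r.
  - apply Rlt_le_trans with ((d - c + 1) * (eps / (d - c + 1))).
    + replace (eps / (2 * (d - c + 1))) with (eps / (d - c + 1) / 2) by (field; lra).
      assert (0 < eps / (d - c + 1)) by (apply Rdiv_lt_0_compat; lra). nra.
    + right. field. lra.
Qed.

Lemma cont_rect_outer f :
  cont_rect a b c d f -> ex_RInt (fun x => RInt (fun y => f x y) c d) a b.
Proof.
  intros H. apply ex_RInt_ext with (fun x => RInt (fun y => f (clamp a b x) y) c d).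
  - intros x Hx. rewrite Rmin_left, Rmax_right in Hx; auto. rewrite clamp_id; lra.
  - apply ex_RInt_cont. intros x _. apply RInt_clamp_continuous. exact H.
Qed.

Lemma dint_ext f g :
  (forall x y, a < x < b -> c < y < d -> f x y = g x y) ->
  dint a b c d f = dint a b c d g.
Proof.
  intros H. apply RInt_ext. intros x Hx. apply RInt_ext. intros y Hy.
  rewrite Rmin_left, Rmax_right in Hx, Hy; auto.
Qed.

Lemma dint_lin f g k :
  cont_rect a b c d f -> cont_rect a b c d g ->
  dint a b c d (fun x y => f x y + k * g x y) =
  dint a b c d f + k * dint a b c d g.
Proof.
  intros F G. unfold dint.
  rewrite (RInt_ext (V := R_CompleteNormedModule) _ (fun x => plus (RInt (fun y => f x y) c d)
     (scal k (RInt (fun y => g x y) c d)))).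
  - assert (K := cont_rect_outer g G).
    rewrite (RInt_plus (V := R_CompleteNormedModule)).
    + rewrite (RInt_scal (V := R_CompleteNormedModule)); [reflexivity | exact K].
    + apply cont_rect_outer. exact F.
    + exact (ex_RInt_scal _ _ _ _ K).
  - intros x Hx. rewrite Rmin_left, Rmax_right in Hx; auto.
    assert (Hx' : a <= x <= b) by lra.
    assert (K := cont_rect_inner g x G Hx').
    rewrite <- (RInt_scal (V := R_CompleteNormedModule)) by exact K.
    rewrite <- (RInt_plus (V := R_CompleteNormedModule)).
    + reflexivity.
    + apply cont_rect_inner; auto.
    + exact (ex_RInt_scal _ _ _ _ K).
Qed.

Lemma cont_rect_lin f g k :
  cont_rect a b c d f -> cont_rect a b c d g ->
  cont_rect a b c d (fun x y => f x y + k * g x y).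
Proof.
  intros F G x y H. apply continuity_2d_pt_plus; auto.
  apply continuity_2d_pt_mult; auto. apply continuity_2d_pt_const.
Qed.

Lemma dint_bound f M :
  cont_rect a b c d f -> (forall x y, rect a b c d x y -> Rabs (f x y) <= M) ->
  Rabs (dint a b c d f) <= (b - a) * ((d - c) * M).
Proof.
  intros F H. apply abs_RInt_le_const; auto.
  - apply cont_rect_outer. exact F.
  - intros x Hx. apply abs_RInt_le_const; auto.
    + apply cont_rect_inner; auto.
    + intros y Hy. apply H. split; auto.
Qed.

(** The tube lemma makes the difference quotients converge uniformly on the
    rectangle. *)
Lemma is_derive_dint (k : R -> R -> R -> R) :
  (forall x y, rect a b c d x y ->
     near3 (ex_D3 dirT k) 0 x y /\ near3 (cont3 k) 0 x y /\ cont3 (D3 dirT k) 0 x y) ->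
  is_derive (fun t => dint a b c d (k t)) 0 (dint a b c d (D3 dirT k 0)).
Proof.
  intros H. apply is_derive_Reals. intros eps He.
  set (m := (b - a) * (d - c)).
  assert (m0 : 0 <= m) by (apply Rmult_le_pos; lra).
  assert (He' : 0 < eps / (2 * (m + 1))) by (apply Rdiv_lt_0_compat; lra).
  destruct (tube a b c d (fun t x y => (ex_D3 dirT k t x y /\ cont3 k t x y) /\
    Rabs (D3 dirT k t x y - D3 dirT k 0 x y) <= eps / (2 * (m + 1)))) as [r Hr].
  { intros x y Hxy. destruct (H x y Hxy) as [A [B C]].
    apply near3_and. apply near3_and; auto.
    (* both values of the derivative are close to its value at the centre of the box *)
    assert (He2 : 0 < eps / (2 * (m + 1)) / 2) by lra.
    pose proof (proj1 (cont3_eps _ _ _ _) C (mkposreal _ He2)) as K. cbn in K.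
    apply near3_box in K. destruct K as [q K]. apply near3_box. exists q.
    intros t' x' y' Ht Hx Hy.
    pose proof (K t' x' y' Ht Hx Hy) as K1.
    assert (Z : Rabs (0 - 0) < q) by (rewrite Rminus_0_r, Rabs_R0; apply q).
    pose proof (K 0 x' y' Z Hx Hy) as K2.
    apply Rabs_def2 in K1. apply Rabs_def2 in K2.
    apply Rabs_le. lra. }
  exists r. intros h Hh0 Hh.
  assert (Z0 : Rabs 0 < r) by (rewrite Rabs_R0; apply r).
  assert (Ck : forall t, Rabs t < r -> cont_rect a b c d (k t)).
  { intros t Ht x y Hxy. apply cont3_2d. apply (Hr t x y Ht Hxy). }
  assert (Cd : cont_rect a b c d (D3 dirT k 0)).
  { intros x y Hxy. apply cont3_2d. apply (H x y Hxy). }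
  rewrite Rplus_0_l.
  assert (E : dint a b c d (k h) - dint a b c d (k 0) - h * dint a b c d (D3 dirT k 0)
    = dint a b c d (fun x y => (k h x y + (-1) * k 0 x y) + (- h) * D3 dirT k 0 x y)).
  { rewrite dint_lin; auto. rewrite dint_lin; auto. ring. apply cont_rect_lin; auto. }
  assert (B : Rabs (dint a b c d (k h) - dint a b c d (k 0) - h * dint a b c d (D3 dirT k 0))
    <= m * (eps / (2 * (m + 1)) * Rabs h)).
  { rewrite E. unfold m at 1. rewrite Rmult_assoc. apply dint_bound.
    - repeat apply cont_rect_lin; auto.
    - intros x y Hxy.
      pose proof (mean_value_bound (fun s => k s x y - s * D3 dirT k 0 x y) 0 h
        (eps / (2 * (m + 1)))) as MV.
      replace (k h x y + -1 * k 0 x y + - h * D3 dirT k 0 x y) with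
        (k h x y - h * D3 dirT k 0 x y - (k 0 x y - 0 * D3 dirT k 0 x y)) by ring.
      replace (Rabs h) with (Rabs (h - 0)) by (now rewrite Rminus_0_r).
      apply MV. intros s Hs. rewrite !Rminus_0_r in Hs.
      destruct (Hr s x y) as [[A _] D]; auto. lra.
      assert (I : is_derive (fun s => k s x y - s * D3 dirT k 0 x y) s
         (D3 dirT k s x y - D3 dirT k 0 x y)).
      { apply (is_derive_minus (fun s => k s x y)).
        - apply Derive_correct. exact A.
        - auto_derive; auto. ring. }
      split. eexists; exact I.
      replace (Derive _ s) with (D3 dirT k s x y - D3 dirT k 0 x y). exact D.
      symmetry. apply is_derive_unique. exact I. }
  replace ((dint a b c d (k h) - dint a b c d (k 0)) / h - dint a b c d (D3 dirT k 0)) with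
    ((dint a b c d (k h) - dint a b c d (k 0) - h * dint a b c d (D3 dirT k 0)) / h)
    by (field; auto).
  unfold Rdiv. rewrite Rabs_mult, Rabs_inv.
  assert (hp : 0 < Rabs h) by (apply Rabs_pos_lt; auto).
  apply Rle_lt_trans with (m * (eps / (2 * (m + 1)) * Rabs h) * / Rabs h).
  - apply Rmult_le_compat_r; auto. left. apply Rinv_0_lt_compat; auto.
  - replace (m * (eps / (2 * (m + 1)) * Rabs h) * / Rabs h) with
      (m * (eps / (2 * (m + 1)))) by (field; lra).
    apply Rlt_le_trans with ((m + 1) * (eps / (m + 1))).
    + replace (eps / (2 * (m + 1))) with (eps / (m + 1) / 2) by (field; lra).
      assert (0 < eps / (m + 1)) by (apply Rdiv_lt_0_compat; lra). nra.
    + right. field. lra.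
Qed.

(** The integral of [P] over vertical segments is an antiderivative of the
    integral of [D], the contribution of [Q] being zero by periodicity.  The
    derivatives are taken in the interior only because the sides of the
    rectangle will include poles, where the coordinates degenerate. *)
Lemma dint_divergence (P Pu Q Qy D : R -> R -> R) :
  cont_rect a b c d P -> cont_rect a b c d D ->
  (forall x y, a < x < b ->
     is_derive (fun s => P s y) x (Pu x y) /\ continuity_2d_pt Pu x y /\
     is_derive (fun s => Q x s) y (Qy x y) /\ continuity_2d_pt Qy x y /\
     D x y = Pu x y + Qy x y) ->
  (forall x, a < x < b -> Q x d = Q x c) ->
  dint a b c d D = RInt (fun y => P b y) c d - RInt (fun y => P a y) c d.
Proof.
  intros HP HD H Per.
  set (p := fun x : R => RInt (fun y => P (clamp a b x) y) c d).
  set (e := fun x : R => RInt (fun y => D (clamp a b x) y) c d).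
  assert (Ce : forall x, continuous e x) by (intros; apply RInt_clamp_continuous; auto).
  assert (Cp : forall x, continuous p x) by (intros; apply RInt_clamp_continuous; auto).
  assert (Ie : forall x y, ex_RInt e x y).
  { intros. apply ex_RInt_cont. auto. }
  assert (Dp : forall x, a < x < b -> is_derive p x (e x)).
  { intros x Hx.
    assert (Lx : locally x (fun z => a < z < b)).
    { apply (open_and _ _ (open_gt a) (open_lt b)). exact Hx. }
    apply is_derive_ext_loc with (fun x => RInt (fun y => P x y) c d).
    { revert Lx. apply filter_imp. intros z Hz. unfold p. rewrite clamp_id; auto. lra. }
    assert (E : RInt (fun y => Derive (fun u => P u y) x) c d = e x).
    { unfold e. rewrite clamp_id by lra.
      assert (EQ : RInt (fun y => Qy x y) c d = 0).
      { apply is_RInt_unique.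
        replace 0 with (minus (Q x d) (Q x c)).
        - apply (is_RInt_derive (fun y => Q x y)).
          + intros y Hy. rewrite Rmin_left, Rmax_right in Hy; auto. apply H; auto.
          + intros y Hy. rewrite Rmin_left, Rmax_right in Hy; auto.
            apply continuity_2d_slice. apply H; auto.
        - rewrite Per; auto. unfold minus, plus, opp; cbn; ring. }
      assert (IQ : ex_RInt (fun y => Qy x y) c d).
      { apply ex_RInt_cont. intros y Hy. rewrite Rmin_left, Rmax_right in Hy; auto.
        apply continuity_2d_slice. apply H; auto. }
      assert (ID : ex_RInt (fun y => D x y) c d).
      { apply cont_rect_inner; auto. lra. }
      assert (EM : RInt (fun y => D x y - Qy x y) c d =
        RInt (fun y => D x y) c d - RInt (fun y => Qy x y) c d).
      { exact (RInt_minus _ _ c d ID IQ). }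
      rewrite EQ, Rminus_0_r in EM. rewrite <- EM. apply RInt_ext.
      intros y Hy. destruct (H x y Hx) as [A [_ [_ [_ B]]]]. rewrite B.
      transitivity (Pu x y). apply is_derive_unique. exact A.
      change (Pu x y = Pu x y + Qy x y - Qy x y). ring. }
    rewrite <- E.
    apply (is_derive_RInt_param (fun x y => P x y)).
    - revert Lx. apply filter_imp. intros z Hz y Hy.
      exists (Pu z y). destruct (H z y Hz) as [A _]. exact A.
    - intros y _. apply (continuity_2d_pt_ext_loc Pu).
      + destruct Lx as [r Lx]. exists r. intros u v Hu _. symmetry.
        destruct (H u v (Lx u Hu)) as [A _]. apply is_derive_unique. exact A.
      + apply H; auto.
    - revert Lx. apply filter_imp. intros z Hz. apply cont_rect_inner; auto. lra. }
  assert (De : forall x, is_derive (RInt e a) x (e x)).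
  { intros x. apply (is_derive_RInt e (RInt e a) a x); auto.
    apply filter_forall. intros z. apply (RInt_correct (V := R_CompleteNormedModule)). apply Ie. }
  destruct (MVT_gen (fun x => p x - RInt e a x) a b (fun _ => 0)) as [w [_ W]].
  - intros x Hx. rewrite Rmin_left, Rmax_right in Hx; auto.
    replace 0 with (minus (e x) (e x)) by (unfold minus, plus, opp; cbn; ring).
    apply (is_derive_minus p); auto.
  - intros x _. apply continuity_pt_filterlim.
    apply (continuous_minus p); auto.
    apply (@ex_derive_continuous R_AbsRing R_NormedModule). eexists. apply De.
  - rewrite RInt_point in W. change (@zero R_CompleteNormedModule) with 0 in W.
    assert (E1 : dint a b c d D = RInt e a b).
    { apply RInt_ext. intros x Hx. rewrite Rmin_left, Rmax_right in Hx; auto.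
      unfold e. rewrite clamp_id; auto. lra. }
    rewrite E1. unfold p in W. rewrite !clamp_id in W by lra.
    transitivity (RInt (fun y => P b y) c d - (RInt (fun y => P a y) c d - 0)); lra.
Qed.
End Rectangle.

Lemma RInt_pos_pt (g : R -> R) a b x :
  a < x < b -> (forall y, continuous g y) -> (forall y, a <= y <= b -> 0 <= g y) ->
  0 < g x -> 0 < RInt g a b.
Proof.
  intros Hx C P G.
  assert (L : locally x (fun y => 0 < g y)).
  { apply (C x (fun v => 0 < v)). apply (open_gt 0). exact G. }
  destruct L as [r L].
  set (h := Rmin (r / 2) (Rmin (x - a) (b - x) / 2)).
  assert (h0 : 0 < h).
  { unfold h. apply Rmin_glb_lt. pose proof (cond_pos r); lra.
    assert (0 < Rmin (x - a) (b - x)) by (apply Rmin_glb_lt; lra). lra. }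
  assert (h1 : h <= r / 2) by apply Rmin_l.
  assert (h2 : h <= Rmin (x - a) (b - x) / 2) by apply Rmin_r.
  pose proof (Rmin_l (x - a) (b - x)). pose proof (Rmin_r (x - a) (b - x)).
  assert (I : forall p q, ex_RInt g p q).
  { intros. apply ex_RInt_cont. auto. }
  rewrite <- (RInt_Chasles g a (x - h) b), <- (RInt_Chasles g (x - h) (x + h) b) by auto.
  change (0 < RInt g a (x - h) + (RInt g (x - h) (x + h) + RInt g (x + h) b)).
  assert (0 <= RInt g a (x - h)). { apply RInt_ge_0; auto. lra. intros; apply P; lra. }
  assert (0 <= RInt g (x + h) b). { apply RInt_ge_0; auto. lra. intros; apply P; lra. }
  assert (0 < RInt g (x - h) (x + h)).
  { apply RInt_gt_0; auto. lra. intros y Hy. apply L.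
    unfold ball; cbn; unfold AbsRing_ball, abs, minus, plus, opp; cbn.
    apply Rabs_def1; pose proof (cond_pos r); lra. }
  lra.
Qed.

Lemma dint_pos_pt a b c d f x y :
  a < x < b -> c < y < d -> cont_rect a b c d f ->
  (forall x y, rect a b c d x y -> 0 <= f x y) -> 0 < f x y -> 0 < dint a b c d f.
Proof.
  intros Hx Hy F P G.
  assert (ab : a <= b) by lra. assert (cd : c <= d) by lra.
  assert (Cl : forall p q, a <= clamp a b p <= b /\ c <= clamp c d q <= d).
  { intros; split; apply clamp_in; auto. }
  assert (E : forall p, RInt (fun y => f (clamp a b p) (clamp c d y)) c d =
     RInt (fun y => f (clamp a b p) y) c d).
  { intros p. apply RInt_ext. intros q Hq. rewrite Rmin_left, Rmax_right in Hq; auto.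
    rewrite (clamp_id c d); auto. lra. }
  assert (C2 : forall p q, continuous (fun y => f (clamp a b p) (clamp c d y)) q).
  { intros p q. apply (continuous_comp (clamp c d) (fun y => f (clamp a b p) y)).
    - apply continuity_pt_filterlim. intros eps He. exists eps. split; auto.
      intros z [_ Hz]. eapply Rle_lt_trans. apply clamp_lip. exact Hz.
    - apply continuity_2d_slice. apply F. apply Cl. }
  assert (I : dint a b c d f =
    RInt (fun x => RInt (fun y => f (clamp a b x) (clamp c d y)) c d) a b).
  { apply RInt_ext. intros p Hp. rewrite Rmin_left, Rmax_right in Hp; auto.
    rewrite E, clamp_id; auto. lra. }
  rewrite I. apply (RInt_pos_pt _ a b x Hx).
  - intros p. apply (continuous_ext (fun x => RInt (fun y => f (clamp a b x) y) c d)).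
    intros z; symmetry; apply E.
    apply RInt_clamp_continuous; auto.
  - intros p _. apply RInt_ge_0; auto.
    + apply ex_RInt_cont. auto.
    + intros q _. apply P. apply Cl.
  - apply (RInt_pos_pt _ c d y Hy); auto.
    + intros q _. apply P. apply Cl.
    + rewrite !clamp_id by lra. exact G.
Qed.

Lemma zero_closure a b c d f x y :
  a < b -> c < d -> rect a b c d x y -> continuity_2d_pt f x y ->
  (forall x y, a < x < b -> c < y < d -> f x y = 0) -> f x y = 0.
Proof.
  intros ab cd [Hx Hy] C Z.
  destruct (Req_dec (f x y) 0) as [E|N]; auto. exfalso.
  destruct (C (mkposreal _ (Rabs_pos_lt _ N))) as [r Hr]. cbn in Hr.
  assert (A : forall a b x, a < b -> a <= x <= b -> exists z, a < z < b /\ Rabs (z - x) < r).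
  { clear - r. intros a b x ab Hx. set (h := Rmin (r / 2) ((b - a) / 4)).
    pose proof (cond_pos r).
    assert (0 < h) by (apply Rmin_glb_lt; lra).
    assert (h <= r / 2) by apply Rmin_l. assert (h <= (b - a) / 4) by apply Rmin_r.
    destruct (Rle_dec x ((a + b) / 2)).
    - exists (x + h). split. lra. apply Rabs_def1; lra.
    - exists (x - h). split. lra. apply Rabs_def1; lra. }
  destruct (A a b x ab Hx) as [z [Hz1 Hz2]]. destruct (A c d y cd Hy) as [w [Hw1 Hw2]].
  specialize (Hr z w Hz2 Hw2). rewrite (Z z w Hz1 Hw1) in Hr.
  replace (0 - f x y) with (- f x y) in Hr by ring. rewrite Rabs_Ropp in Hr. lra.
Qed.

(** * Vector calculus *)

Definition vadd (v w : vec) : vec := Vec (cx v + cx w) (cy v + cy w) (cz v + cz w).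
Definition E3 : vec := Vec 0 0 1.

Lemma vec_eq v w : cx v = cx w -> cy v = cy w -> cz v = cz w -> v = w.
Proof. destruct v, w. cbn. intros -> -> ->. reflexivity. Qed.

Definition VCk3 (k : nat) (U : R -> R -> R -> Prop) (F : R -> R -> R -> vec) : Prop :=
  Ck3 k U (fun t x y => cx (F t x y)) /\
  Ck3 k U (fun t x y => cy (F t x y)) /\
  Ck3 k U (fun t x y => cz (F t x y)).

Definition DV (d : dir) (F : R -> R -> R -> vec) (t x y : R) : vec :=
  Vec (D3 d (fun t x y => cx (F t x y)) t x y)
      (D3 d (fun t x y => cy (F t x y)) t x y)
      (D3 d (fun t x y => cz (F t x y)) t x y).

Definition ex_DV (d : dir) (F : R -> R -> R -> vec) (t x y : R) : Prop :=
  ex_D3 d (fun t x y => cx (F t x y)) t x y /\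
  ex_D3 d (fun t x y => cy (F t x y)) t x y /\
  ex_D3 d (fun t x y => cz (F t x y)) t x y.

Section Closure.
Variable U : R -> R -> R -> Prop.
Hypothesis O : open3 U.

Lemma VCk3_D k F d : VCk3 (S k) U F -> VCk3 k U (DV d F).
Proof.
  intros [A [B C]].
  exact (conj (Ck3_D k U _ d A) (conj (Ck3_D k U _ d B) (Ck3_D k U _ d C))).
Qed.

Lemma VCk3_ex_D k F d t x y : VCk3 (S k) U F -> U t x y -> ex_DV d F t x y.
Proof.
  intros [A [B C]] H.
  exact (conj (Ck3_ex_D k U _ d _ _ _ A H) (conj (Ck3_ex_D k U _ d _ _ _ B H)
    (Ck3_ex_D k U _ d _ _ _ C H))).
Qed.

Lemma VCk3_le k m F : (k <= m)%nat -> VCk3 m U F -> VCk3 k U F.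
Proof.
  intros L [A [B C]].
  exact (conj (Ck3_le k m U _ O L A) (conj (Ck3_le k m U _ O L B) (Ck3_le k m U _ O L C))).
Qed.

Lemma VCk3_const k v : VCk3 k U (fun _ _ _ => v).
Proof. split; [|split]; apply Ck3_const; auto. Qed.

Lemma VCk3_add k F G : VCk3 k U F -> VCk3 k U G ->
  VCk3 k U (fun t x y => vadd (F t x y) (G t x y)).
Proof. intros [A [B C]] [A' [B' C']]. split; [|split]; cbn; apply Ck3_plus; auto. Qed.

Lemma VCk3_scal k f F : Ck3 k U f -> VCk3 k U F ->
  VCk3 k U (fun t x y => vscal (f t x y) (F t x y)).
Proof. intros H [A [B C]]. split; [|split]; cbn; apply Ck3_mult; auto. Qed.

Lemma VCk3_cross k F G : VCk3 k U F -> VCk3 k U G ->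
  VCk3 k U (fun t x y => cross (F t x y) (G t x y)).
Proof.
  intros [A [B C]] [A' [B' C']].
  split; [|split]; cbn; apply Ck3_minus; auto; apply Ck3_mult; auto.
Qed.

Lemma Ck3_dot k F G : VCk3 k U F -> VCk3 k U G ->
  Ck3 k U (fun t x y => dot (F t x y) (G t x y)).
Proof.
  intros [A [B C]] [A' [B' C']]. unfold dot.
  apply Ck3_plus; auto. apply Ck3_plus; auto. all: apply Ck3_mult; auto.
Qed.

Lemma VCk3_ext k F G : (forall t x y, U t x y -> F t x y = G t x y) ->
  VCk3 k U F -> VCk3 k U G.
Proof.
  intros H [A [B C]].
  split; [|split]; [revert A | revert B | revert C]; apply Ck3_ext; auto;
    intros t x y Hu; rewrite (H t x y Hu); reflexivity.
Qed.
End Closure.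

Lemma VCk3_sub k (U V : R -> R -> R -> Prop) F :
  (forall t x y, V t x y -> U t x y) -> VCk3 k U F -> VCk3 k V F.
Proof.
  intros H [A [B C]]. split; [|split]; apply (Ck3_sub k U V); auto.
Qed.

Lemma VCk3_union k (U V W : R -> R -> R -> Prop) F :
  (forall t x y, W t x y -> U t x y \/ V t x y) ->
  VCk3 k U F -> VCk3 k V F -> VCk3 k W F.
Proof.
  intros H [A1 [B1 C1]] [A2 [B2 C2]].
  split; [|split]; apply (Ck3_union k U V W); auto.
Qed.

Lemma D3_plus d f g t x y : ex_D3 d f t x y -> ex_D3 d g t x y ->
  ex_D3 d (fun t x y => f t x y + g t x y) t x y /\
  D3 d (fun t x y => f t x y + g t x y) t x y = D3 d f t x y + D3 d g t x y.
Proof.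
  intros A B. split.
  - destruct d; exact (ex_derive_plus _ _ _ A B).
  - destruct d; exact (Derive_plus _ _ _ A B).
Qed.

Lemma D3_mult d f g t x y : ex_D3 d f t x y -> ex_D3 d g t x y ->
  ex_D3 d (fun t x y => f t x y * g t x y) t x y /\
  D3 d (fun t x y => f t x y * g t x y) t x y =
  D3 d f t x y * g t x y + f t x y * D3 d g t x y.
Proof.
  intros A B. split.
  - destruct d; exact (ex_derive_mult _ _ _ A B).
  - destruct d; exact (Derive_mult _ _ _ A B).
Qed.

Lemma D3_minus d f g t x y : ex_D3 d f t x y -> ex_D3 d g t x y ->
  ex_D3 d (fun t x y => f t x y - g t x y) t x y /\
  D3 d (fun t x y => f t x y - g t x y) t x y = D3 d f t x y - D3 d g t x y.
Proof.
  intros A B. split.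
  - destruct d; exact (ex_derive_minus _ _ _ A B).
  - destruct d; exact (Derive_minus _ _ _ A B).
Qed.

Lemma D3_comp d phi f t x y : ex_D3 d f t x y -> ex_derive phi (f t x y) ->
  ex_D3 d (fun t x y => phi (f t x y)) t x y /\
  D3 d (fun t x y => phi (f t x y)) t x y = D3 d f t x y * Derive phi (f t x y).
Proof.
  intros A B. split.
  - destruct d; exact (ex_derive_comp phi _ _ B A).
  - destruct d; exact (Derive_comp phi _ _ B A).
Qed.

Lemma D3_const d c t x y :
  ex_D3 d (fun _ _ _ => c) t x y /\ D3 d (fun _ _ _ => c) t x y = 0.
Proof.
  split; destruct d; first [apply (ex_derive_const (V := R_NormedModule)) | apply (Derive_const c)].
Qed.

Lemma D3_dot d F G t x y : ex_DV d F t x y -> ex_DV d G t x y ->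
  ex_D3 d (fun t x y => dot (F t x y) (G t x y)) t x y /\
  D3 d (fun t x y => dot (F t x y) (G t x y)) t x y =
  dot (DV d F t x y) (G t x y) + dot (F t x y) (DV d G t x y).
Proof.
  intros [A [B C]] [A' [B' C']].
  destruct (D3_mult d _ _ t x y A A') as [P1 Q1].
  destruct (D3_mult d _ _ t x y B B') as [P2 Q2].
  destruct (D3_mult d _ _ t x y C C') as [P3 Q3].
  destruct (D3_plus d _ _ t x y P1 P2) as [P4 Q4].
  destruct (D3_plus d _ _ t x y P4 P3) as [P5 Q5].
  split. exact P5. unfold dot in *. rewrite Q5, Q4, Q1, Q2, Q3. cbn. ring.
Qed.

Lemma DV_cross d F G t x y : ex_DV d F t x y -> ex_DV d G t x y ->
  ex_DV d (fun t x y => cross (F t x y) (G t x y)) t x y /\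
  DV d (fun t x y => cross (F t x y) (G t x y)) t x y =
  vadd (cross (DV d F t x y) (G t x y)) (cross (F t x y) (DV d G t x y)).
Proof.
  intros [A [B C]] [A' [B' C']].
  assert (K : forall f g h k, ex_D3 d f t x y -> ex_D3 d g t x y ->
    ex_D3 d h t x y -> ex_D3 d k t x y ->
    ex_D3 d (fun t x y => f t x y * g t x y - h t x y * k t x y) t x y /\
    D3 d (fun t x y => f t x y * g t x y - h t x y * k t x y) t x y =
    (D3 d f t x y * g t x y + f t x y * D3 d g t x y) -
    (D3 d h t x y * k t x y + h t x y * D3 d k t x y)).
  { intros f g h k Hf Hg Hh Hk.
    destruct (D3_mult d _ _ t x y Hf Hg) as [P1 Q1].
    destruct (D3_mult d _ _ t x y Hh Hk) as [P2 Q2].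
    destruct (D3_minus d _ _ t x y P1 P2) as [P3 Q3].
    split. exact P3. rewrite Q3, Q1, Q2. reflexivity. }
  destruct (K _ _ _ _ B C' C B') as [P1 Q1].
  destruct (K _ _ _ _ C A' A C') as [P2 Q2].
  destruct (K _ _ _ _ A B' B A') as [P3 Q3].
  split. exact (conj P1 (conj P2 P3)).
  apply vec_eq.
  - etransitivity. exact Q1. cbn. ring.
  - etransitivity. exact Q2. cbn. ring.
  - etransitivity. exact Q3. cbn. ring.
Qed.

Lemma DV_scal d f F t x y : ex_D3 d f t x y -> ex_DV d F t x y ->
  ex_DV d (fun t x y => vscal (f t x y) (F t x y)) t x y /\
  DV d (fun t x y => vscal (f t x y) (F t x y)) t x y =
  vadd (vscal (D3 d f t x y) (F t x y)) (vscal (f t x y) (DV d F t x y)).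
Proof.
  intros H [A [B C]].
  destruct (D3_mult d _ _ t x y H A) as [P1 Q1].
  destruct (D3_mult d _ _ t x y H B) as [P2 Q2].
  destruct (D3_mult d _ _ t x y H C) as [P3 Q3].
  split. exact (conj P1 (conj P2 P3)). apply vec_eq; assumption.
Qed.

Lemma DV_add d F G t x y : ex_DV d F t x y -> ex_DV d G t x y ->
  ex_DV d (fun t x y => vadd (F t x y) (G t x y)) t x y /\
  DV d (fun t x y => vadd (F t x y) (G t x y)) t x y =
  vadd (DV d F t x y) (DV d G t x y).
Proof.
  intros [A [B C]] [A' [B' C']].
  destruct (D3_plus d _ _ t x y A A') as [P1 Q1].
  destruct (D3_plus d _ _ t x y B B') as [P2 Q2].
  destruct (D3_plus d _ _ t x y C C') as [P3 Q3].
  split. exact (conj P1 (conj P2 P3)). apply vec_eq; assumption.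
Qed.

Lemma DV_const d v t x y :
  ex_DV d (fun _ _ _ => v) t x y /\ DV d (fun _ _ _ => v) t x y = vzero.
Proof.
  split.
  - split; [|split]; apply D3_const.
  - apply vec_eq; exact (proj2 (D3_const d _ t x y)).
Qed.

(** * Families of regular surfaces off the plane z = 0 *)

Lemma dot_pos v : v <> vzero -> 0 < dot v v.
Proof.
  intros H. destruct v as [a b c]. unfold dot; cbn.
  destruct (Req_dec a 0) as [Ha|Ha]; [|nra].
  destruct (Req_dec b 0) as [Hb|Hb]; [|nra].
  destruct (Req_dec c 0) as [Hc|Hc]; [|nra].
  subst. contradiction H. reflexivity.
Qed.

Lemma vnorm_pos v : v <> vzero -> 0 < vnorm v.
Proof. intros H. apply sqrt_lt_R0. apply dot_pos. exact H. Qed.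

Lemma vnorm_sqr v : vnorm v * vnorm v = dot v v.
Proof. apply sqrt_sqrt. unfold dot. nra. Qed.

(** The two divergences of this development come from members of this family:
    [(0, 1, 2 co)] for the first variation of [G] and [(1, 0, 0)] for
    [Delta z / z]. *)
Definition field_W (a b c : R) (F : R -> R -> vec) (x y : R) : vec :=
  vadd (vscal (a / cz (F x y) + b / cz (F x y) ^ 2) (unit_normal F x y))
       (vscal (c / cz (F x y)) E3).

(** The failure of the reduced membrane equation. *)
Definition defect (co : R) (F : R -> R -> vec) (x y : R) : R :=
  mean_curvature F x y + co + cz (unit_normal F x y) / cz (F x y).

(** For the one-form [w |-> V . (w x W)] along the surface: its value on the
    second coordinate vector and minus its value on the first one, that is, the
    components whose divergence is its exterior derivative. *)
Definition flux1 (V W : R -> R -> vec) (F : R -> R -> vec) (x y : R) : R :=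
  dot (V x y) (cross (vpd2 F x y) (W x y)).
Definition flux2 (V W : R -> R -> vec) (F : R -> R -> vec) (x y : R) : R :=
  dot (V x y) (cross (W x y) (vpd1 F x y)).

Definition dens_area (F : R -> R -> vec) (x y : R) : R :=
  1 / cz (F x y) ^ 2 * area_density F x y.
Definition dens_normal (F : R -> R -> vec) (x y : R) : R :=
  cz (unit_normal F x y) / cz (F x y) * area_density F x y.
Definition dens_helfrich (co : R) (F : R -> R -> vec) (x y : R) : R :=
  (mean_curvature F x y + co) ^ 2 * area_density F x y.
Definition dens_defect (co : R) (F : R -> R -> vec) (x y : R) : R :=
  defect co F x y ^ 2 * area_density F x y.

Record regular_family (U : R -> R -> R -> Prop) (F : R -> R -> R -> vec) : Prop := {
  rf_open : open3 U;
  rf_smooth : VCk3 4 U F;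
  rf_regular : forall t x y, U t x y -> normal_vec (F t) x y <> vzero;
  rf_z : forall t x y, U t x y -> cz (F t x y) <> 0
}.

Section Family.
Variables (U : R -> R -> R -> Prop) (F : R -> R -> R -> vec).
Hypothesis RF : regular_family U F.
Let O := rf_open U F RF.

Let N t x y := normal_vec (F t) x y.
Let A t x y := area_density (F t) x y.
Let n t x y := unit_normal (F t) x y.
Let F1 := DV dirX F.
Let F2 := DV dirY F.
Let z t x y := cz (F t x y).

Lemma smooth_F1 : VCk3 3 U F1.
Proof. apply VCk3_D. apply RF. Qed.
Lemma smooth_F2 : VCk3 3 U F2.
Proof. apply VCk3_D. apply RF. Qed.
Lemma smooth_N : VCk3 3 U N.
Proof. exact (VCk3_cross U O 3 F1 F2 smooth_F1 smooth_F2). Qed.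

Lemma A_pos t x y : U t x y -> 0 < A t x y.
Proof. intros H. apply vnorm_pos. apply (rf_regular U F RF); auto. Qed.

Lemma smooth_A : Ck3 3 U A.
Proof.
  apply (Ck3_sqrt 3 U (fun t x y => dot (N t x y) (N t x y)) O).
  - apply (Ck3_dot U O); apply smooth_N.
  - intros t x y H. apply dot_pos. apply (rf_regular U F RF); auto.
Qed.

Lemma smooth_n : VCk3 3 U n.
Proof.
  apply (VCk3_scal U O 3 (fun t x y => / A t x y) N).
  - apply Ck3_inv; auto. apply smooth_A. intros t x y H. pose proof (A_pos t x y H). lra.
  - apply smooth_N.
Qed.

Lemma smooth_z : Ck3 3 U z.
Proof. apply (Ck3_le 3 4 U _ O); [lia|]. apply RF. Qed.

Lemma smooth_invz k : (k <= 3)%nat -> Ck3 k U (fun t x y => / z t x y).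
Proof.
  intros L. apply (Ck3_le k 3 U _ O L). apply Ck3_inv; auto. apply smooth_z.
  apply (rf_z U F RF).
Qed.

Lemma gram a b : dot a a * dot b b - dot a b * dot a b = dot (cross a b) (cross a b).
Proof. unfold dot, cross; cbn. ring. Qed.

Lemma smooth_H : Ck3 2 U (fun t x y => mean_curvature (F t) x y).
Proof.
  pose proof (VCk3_le U O 2 3 _ (Nat.le_succ_diag_r 2) smooth_F1) as S1.
  pose proof (VCk3_le U O 2 3 _ (Nat.le_succ_diag_r 2) smooth_F2) as S2.
  pose proof (VCk3_D U 2 _ dirX smooth_n) as T1.
  pose proof (VCk3_D U 2 _ dirY smooth_n) as T2.
  pose proof (Ck3_dot U O 2 _ _ S1 S1) as g11.
  pose proof (Ck3_dot U O 2 _ _ S1 S2) as g12.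
  pose proof (Ck3_dot U O 2 _ _ S2 S2) as g22.
  pose proof (Ck3_dot U O 2 _ _ T1 S1) as h11.
  pose proof (Ck3_dot U O 2 _ _ T1 S2) as h12.
  pose proof (Ck3_dot U O 2 _ _ T2 S1) as h21.
  pose proof (Ck3_dot U O 2 _ _ T2 S2) as h22.
  apply (Ck3_div 2 U
    (fun t x y => - (dot (F2 t x y) (F2 t x y) * dot (DV dirX n t x y) (F1 t x y)
      - dot (F1 t x y) (F2 t x y) * (dot (DV dirX n t x y) (F2 t x y) + dot (DV dirY n t x y) (F1 t x y))
      + dot (F1 t x y) (F1 t x y) * dot (DV dirY n t x y) (F2 t x y)))
    (fun t x y => 2 * (dot (F1 t x y) (F1 t x y) * dot (F2 t x y) (F2 t x y)
      - dot (F1 t x y) (F2 t x y) * dot (F1 t x y) (F2 t x y))) O).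
  - apply Ck3_opp; [exact O|]. apply Ck3_plus; [exact O| |apply Ck3_mult; assumption].
    apply Ck3_minus; [exact O|apply Ck3_mult; assumption|].
    apply Ck3_mult; [exact O|assumption|]. apply Ck3_plus; assumption.
  - apply Ck3_mult; auto. apply Ck3_const; auto.
    apply Ck3_minus; auto; apply Ck3_mult; auto.
  - intros t x y H E. rewrite gram in E.
    pose proof (dot_pos _ (rf_regular U F RF t x y H)) as P. unfold normal_vec in P.
    change (0 < dot (cross (F1 t x y) (F2 t x y)) (cross (F1 t x y) (F2 t x y))) in P. lra.
Qed.

Lemma smooth_nz k : (k <= 3)%nat ->
  Ck3 k U (fun t x y => cz (n t x y) / z t x y).
Proof.
  intros L. apply (Ck3_le k 3 U _ O L). apply Ck3_mult; auto. apply smooth_n.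
  apply smooth_invz; auto.
Qed.

Lemma smooth_defect co : Ck3 2 U (fun t x y => defect co (F t) x y).
Proof.
  apply Ck3_plus; auto. apply Ck3_plus; auto. apply smooth_H. apply Ck3_const; auto.
  apply smooth_nz. lia.
Qed.

Lemma smooth_A2 : Ck3 2 U A.
Proof. apply (Ck3_le 2 3 U _ O). lia. apply smooth_A. Qed.

Lemma smooth_dens_area : Ck3 2 U (fun t x y => dens_area (F t) x y).
Proof.
  apply Ck3_mult; auto; [|apply smooth_A2]. apply Ck3_div; auto.
  apply Ck3_const; auto. apply Ck3_pow; auto.
  apply (Ck3_le 2 3 U z O). lia. apply smooth_z.
  intros t x y H. apply pow_nonzero. apply (rf_z U F RF); auto.
Qed.

Lemma smooth_dens_normal : Ck3 2 U (fun t x y => dens_normal (F t) x y).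
Proof.
  apply Ck3_mult; auto; [|apply smooth_A2]. apply smooth_nz. lia.
Qed.

Lemma smooth_dens_helfrich co : Ck3 2 U (fun t x y => dens_helfrich co (F t) x y).
Proof.
  apply Ck3_mult; auto; [|apply smooth_A2]. apply Ck3_pow; auto.
  apply Ck3_plus; auto. apply smooth_H. apply Ck3_const; auto.
Qed.

Lemma smooth_dens_defect co : Ck3 2 U (fun t x y => dens_defect co (F t) x y).
Proof.
  apply Ck3_mult; auto; [|apply smooth_A2]. apply Ck3_pow; auto. apply smooth_defect.
Qed.

Lemma smooth_W a b c : VCk3 2 U (fun t => field_W a b c (F t)).
Proof.
  assert (Z : Ck3 2 U z).
  { apply (Ck3_le 2 3 U _ O). lia. apply smooth_z. }
  apply VCk3_add; auto; apply VCk3_scal; auto.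
  - apply Ck3_plus; auto; apply Ck3_div; auto; try (apply Ck3_const; auto).
    + apply (rf_z U F RF).
    + apply Ck3_pow; auto.
    + intros t x y H. apply pow_nonzero. apply (rf_z U F RF); auto.
  - apply (VCk3_le U O 2 3). lia. apply smooth_n.
  - apply Ck3_div; auto. apply Ck3_const; auto. apply (rf_z U F RF).
  - apply VCk3_const; auto.
Qed.

Section Point.
Variables t x y : R.
Hypothesis Hu : U t x y.

Lemma normal_decomp : N t x y = vscal (A t x y) (n t x y).
Proof.
  pose proof (A_pos t x y Hu). apply vec_eq; cbn; fold (A t x y); unfold N; field; lra.
Qed.

Lemma n_unit : dot (n t x y) (n t x y) = 1.
Proof.
  pose proof (A_pos t x y Hu) as P.
  assert (E : dot (N t x y) (N t x y) = A t x y * A t x y) by (symmetry; apply vnorm_sqr).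
  unfold n, unit_normal. fold (A t x y) (N t x y).
  replace (dot (vscal (/ A t x y) (N t x y)) (vscal (/ A t x y) (N t x y)))
    with (dot (N t x y) (N t x y) / (A t x y * A t x y)).
  - rewrite E. field. lra.
  - unfold dot, vscal; cbn. field. lra.
Qed.

Lemma n_dot_N : dot (N t x y) (n t x y) = A t x y.
Proof.
  rewrite normal_decomp.
  replace (dot (vscal (A t x y) (n t x y)) (n t x y)) with
    (A t x y * dot (n t x y) (n t x y)) by (unfold dot, vscal; cbn; ring).
  rewrite n_unit. ring.
Qed.
End Point.

Lemma n_dot_dn d t x y : U t x y -> dot (n t x y) (DV d n t x y) = 0.
Proof.
  intros Hu.
  pose proof (VCk3_ex_D U 2 n d t x y smooth_n Hu) as E.
  destruct (D3_dot d n n t x y E E) as [_ Q].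
  assert (Z : D3 d (fun t x y => dot (n t x y) (n t x y)) t x y = 0).
  { rewrite (D3_ext_near d _ (fun _ _ _ => 1)). apply D3_const.
    generalize (O t x y Hu). apply near3_imp. intros a b c Habc. apply n_unit. exact Habc. }
  rewrite Z in Q.
  replace (dot (DV d n t x y) (n t x y)) with (dot (n t x y) (DV d n t x y)) in Q
    by (unfold dot; ring). lra.
Qed.

(** Expand [(a x b) x (u x (a x b))] with the triple product formula in two ways. *)
Lemma normal_component u a b :
  dot u a = 0 -> dot u b = 0 ->
  vscal (dot (cross a b) (cross a b)) u = vscal (dot u (cross a b)) (cross a b).
Proof.
  intros Ha Hb.
  assert (E : vadd (vscal (dot (cross a b) (cross a b)) u)
                   (vscal (- dot u (cross a b)) (cross a b)) =
    vadd (vscal (dot u b) (cross (cross a b) a)) (vscal (- dot u a) (cross (cross a b) b))).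
  { apply vec_eq; unfold dot, cross, vscal, vadd; cbn; ring. }
  rewrite Ha, Hb in E.
  pose proof (f_equal cx E) as E1. pose proof (f_equal cy E) as E2.
  pose proof (f_equal cz E) as E3. clear E Ha Hb.
  apply vec_eq; unfold vscal, vadd in *; cbn [cx cy cz] in *; lra.
Qed.

(** The left-hand side is normal because the derivatives of the unit field [nu]
    are tangent, and its normal component is the trace of the shape operator. *)
Lemma curvature_identity t x y : U t x y ->
  vadd (cross (F2 t x y) (DV dirX n t x y)) (vscal (-1) (cross (F1 t x y) (DV dirY n t x y)))
  = vscal (2 * mean_curvature (F t) x y) (N t x y).
Proof.
  intros Hu.
  pose proof (n_dot_dn dirX t x y Hu) as O1. pose proof (n_dot_dn dirY t x y Hu) as O2.
  pose proof (A_pos t x y Hu) as AP.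
  pose proof (dot_pos _ (rf_regular U F RF t x y Hu)) as NP.
  pose proof (normal_decomp t x y Hu) as ND.
  set (m1 := DV dirX n t x y) in *. set (m2 := DV dirY n t x y) in *.
  set (u := vadd _ _).
  change (N t x y) with (cross (F1 t x y) (F2 t x y)) in *.
  change (normal_vec (F t) x y) with (cross (F1 t x y) (F2 t x y)) in *.
  set (a := F1 t x y) in *. set (b := F2 t x y) in *.
  assert (M1 : dot (cross a b) m1 = 0).
  { rewrite ND. transitivity (A t x y * dot (n t x y) m1).
    unfold dot, vscal; cbn; ring. rewrite O1; ring. }
  assert (M2 : dot (cross a b) m2 = 0).
  { rewrite ND. transitivity (A t x y * dot (n t x y) m2).
    unfold dot, vscal; cbn; ring. rewrite O2; ring. }
  assert (P1 : dot u a = 0).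
  { rewrite <- M1. unfold u, dot, vadd, vscal, cross; cbn. ring. }
  assert (P2 : dot u b = 0).
  { rewrite <- M2. unfold u, dot, vadd, vscal, cross; cbn. ring. }
  pose proof (normal_component u a b P1 P2) as E.
  assert (EH : dot u (cross a b) =
    2 * mean_curvature (F t) x y * dot (cross a b) (cross a b)).
  { unfold mean_curvature. rewrite <- gram.
    change (vpd1 (F t) x y) with a. change (vpd2 (F t) x y) with b.
    change (vpd1 (unit_normal (F t)) x y) with m1.
    change (vpd2 (unit_normal (F t)) x y) with m2.
    rewrite <- gram in NP.
    transitivity (- (dot b b * dot m1 a - dot a b * (dot m1 b + dot m2 a) + dot a a * dot m2 b)).
    - unfold u, dot, vadd, vscal, cross; cbn. ring.
    - field. lra. }
  rewrite EH in E.
  pose proof (f_equal cx E) as E1. pose proof (f_equal cy E) as E2.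
  pose proof (f_equal cz E) as E3'. clear E.
  assert (C : forall p q r, 0 < r -> r * p = 2 * mean_curvature (F t) x y * r * q ->
    p = 2 * mean_curvature (F t) x y * q).
  { intros p q r Hr Heq. apply (Rmult_eq_reg_l r); [|lra]. rewrite Heq. ring. }
  apply vec_eq; cbn [vscal cx cy cz] in *; (eapply C; [exact NP|]); assumption.
Qed.

Lemma D3_invz d (f : R -> R) t x y : U t x y -> ex_derive f (z t x y) ->
  ex_D3 d (fun t x y => f (z t x y)) t x y /\
  D3 d (fun t x y => f (z t x y)) t x y = cz (DV d F t x y) * Derive f (z t x y).
Proof.
  intros Hu E. apply D3_comp; auto.
  exact (Ck3_ex_D 2 U z d t x y smooth_z Hu).
Qed.

Lemma DV_W a b c d t x y : U t x y ->
  DV d (fun t => field_W a b c (F t)) t x y =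
  vadd (vadd (vscal (- (a / z t x y ^ 2 + 2 * b / z t x y ^ 3) * cz (DV d F t x y)) (n t x y))
             (vscal (a / z t x y + b / z t x y ^ 2) (DV d n t x y)))
       (vscal (- (c / z t x y ^ 2) * cz (DV d F t x y)) E3).
Proof.
  intros Hu. pose proof (rf_z U F RF t x y Hu) as Hz. fold (z t x y) in Hz.
  assert (I1 : is_derive (fun r : R => a / r + b / r ^ 2) (z t x y)
    (- (a / z t x y ^ 2 + 2 * b / z t x y ^ 3))).
  { auto_derive.
    - repeat split; auto; apply (pow_nonzero _ 2 Hz).
    - field. auto. }
  assert (I2 : is_derive (fun r : R => c / r) (z t x y) (- (c / z t x y ^ 2))).
  { auto_derive; auto. field. auto. }
  destruct (D3_invz d (fun r => a / r + b / r ^ 2) t x y Hu) as [P1 Q1]. eexists; exact I1.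
  destruct (D3_invz d (fun r => c / r) t x y Hu) as [P2 Q2]. eexists; exact I2.
  rewrite (is_derive_unique _ _ _ I1) in Q1. rewrite (is_derive_unique _ _ _ I2) in Q2.
  destruct (DV_scal d _ n t x y P1 (VCk3_ex_D U 2 n d t x y smooth_n Hu)) as [P3 Q3].
  destruct (DV_const d E3 t x y) as [P4 Q4].
  destruct (DV_scal d _ (fun _ _ _ => E3) t x y P2 P4) as [P5 Q5].
  destruct (DV_add d _ _ t x y P3 P5) as [_ Q6].
  etransitivity. exact Q6. rewrite Q3, Q5, Q1, Q2, Q4.
  apply vec_eq; cbn; ring.
Qed.

(** The part of [div_flux] in which [W] is differentiated.  Besides the
    curvature term it contains [z_1 F_2 - z_2 F_1 = - E_3 x N], multiplied by
    [nu] and by [E_3]. *)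
Lemma bracket_W a b c t x y : U t x y ->
  vadd (cross (F2 t x y) (DV dirX (fun t => field_W a b c (F t)) t x y))
    (vscal (-1) (cross (F1 t x y) (DV dirY (fun t => field_W a b c (F t)) t x y))) =
  vadd (vscal ((a / z t x y + b / z t x y ^ 2) * (2 * mean_curvature (F t) x y)
          + (a / z t x y ^ 2 + 2 * b / z t x y ^ 3) * cz (n t x y)
          + c / z t x y ^ 2) (N t x y))
       (vscal (- (a / z t x y ^ 2 + 2 * b / z t x y ^ 3) * A t x y
          - c / z t x y ^ 2 * cz (N t x y)) E3).
Proof.
  intros Hu. rewrite !DV_W by auto.
  pose proof (curvature_identity t x y Hu) as K.
  rewrite <- (n_dot_N t x y Hu).
  set (m1 := DV dirX n t x y) in *. set (m2 := DV dirY n t x y) in *.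
  change (N t x y) with (cross (F1 t x y) (F2 t x y)) in *.
  change (DV dirX F t x y) with (F1 t x y). change (DV dirY F t x y) with (F2 t x y).
  set (e := F1 t x y) in *. set (f := F2 t x y) in *. set (m := n t x y).
  generalize (a / z t x y + b / z t x y ^ 2) (a / z t x y ^ 2 + 2 * b / z t x y ^ 3)
    (c / z t x y ^ 2). intros al be ga.
  set (h := 2 * mean_curvature (F t) x y) in *.
  pose proof (f_equal cx K) as K1. pose proof (f_equal cy K) as K2.
  pose proof (f_equal cz K) as K3. clear K.
  cbn [vscal vadd cross cx cy cz] in K1, K2, K3.
  apply vec_eq; cbn [vscal vadd cross E3 cx cy cz]; unfold dot; cbn [cross cx cy cz];
  [ rewrite !Rmult_plus_distr_r, (Rmult_assoc al h), <- K1
  | rewrite !Rmult_plus_distr_r, (Rmult_assoc al h), <- K2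
  | rewrite !Rmult_plus_distr_r, (Rmult_assoc al h), <- K3 ]; ring.
Qed.

(** The second derivatives of [F] cancel by symmetry. *)
Lemma div_flux (V W : R -> R -> R -> vec) t x y :
  VCk3 1 U V -> VCk3 1 U W -> U t x y ->
  D3 dirX (fun t x y => flux1 (V t) (W t) (F t) x y) t x y +
  D3 dirY (fun t x y => flux2 (V t) (W t) (F t) x y) t x y =
  dot (DV dirX V t x y) (cross (F2 t x y) (W t x y)) +
  dot (DV dirY V t x y) (cross (W t x y) (F1 t x y)) +
  dot (V t x y) (vadd (cross (F2 t x y) (DV dirX W t x y))
                      (vscal (-1) (cross (F1 t x y) (DV dirY W t x y)))).
Proof.
  intros HV HW Hu.
  assert (S : DV dirX F2 t x y = DV dirY F1 t x y).
  { destruct (VCk3_le U O 2 4 F (ltac:(lia)) (rf_smooth U F RF)) as [S1 [S2 S3]].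
    apply vec_eq; apply (Ck3_Schwarz U); auto. }
  destruct (DV_cross dirX F2 W t x y) as [P1 Q1].
  { exact (VCk3_ex_D U 2 _ _ t x y smooth_F2 Hu). } { exact (VCk3_ex_D U 0 _ _ t x y HW Hu). }
  destruct (DV_cross dirY W F1 t x y) as [P2 Q2].
  { exact (VCk3_ex_D U 0 _ _ t x y HW Hu). } { exact (VCk3_ex_D U 2 _ _ t x y smooth_F1 Hu). }
  destruct (D3_dot dirX V _ t x y (VCk3_ex_D U 0 _ _ t x y HV Hu) P1) as [_ Q3].
  destruct (D3_dot dirY V _ t x y (VCk3_ex_D U 0 _ _ t x y HV Hu) P2) as [_ Q4].
  rewrite Q1 in Q3. rewrite Q2 in Q4.
  etransitivity. apply (f_equal2 Rplus Q3 Q4).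
  rewrite S.
  unfold dot, vadd, vscal, cross; cbn [cx cy cz]. ring.
Qed.

(** The integrand of [G] is [|N| / z^2 + 2 co N_3 / z].  Its time derivative
    pairs [W = nu / z^2 + (2 co / z) E_3] with the time derivative of [N], in
    which the velocity is differentiated; moving these derivatives to [W] leaves
    the divergence and, by [bracket_W], a multiple of the defect. *)
Lemma first_variation_G co t x y : U t x y ->
  D3 dirT (fun t x y => dens_area (F t) x y) t x y +
  2 * co * D3 dirT (fun t x y => dens_normal (F t) x y) t x y =
  (D3 dirX (fun t x y => flux1 (DV dirT F t) (field_W 0 1 (2 * co) (F t)) (F t) x y) t x y +
   D3 dirY (fun t x y => flux2 (DV dirT F t) (field_W 0 1 (2 * co) (F t)) (F t) x y) t x y)
  - 2 / z t x y ^ 2 * defect co (F t) x y * dot (DV dirT F t x y) (N t x y).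
Proof.
  intros Hu. pose proof (rf_z U F RF t x y Hu) as Hz. fold (z t x y) in Hz.
  pose proof (A_pos t x y Hu) as AP.
  assert (SV : VCk3 3 U (DV dirT F)) by (apply VCk3_D; apply RF).
  pose proof (div_flux (DV dirT F) (fun t => field_W 0 1 (2 * co) (F t)) t x y
    (VCk3_le U O 1 3 _ (ltac:(lia)) SV) (VCk3_le U O 1 2 _ (ltac:(lia)) (smooth_W 0 1 (2 * co))) Hu)
    as DF. cbv beta in DF.
  rewrite (bracket_W 0 1 (2 * co) t x y Hu) in DF.
  destruct (rf_smooth U F RF) as [X1 [X2 X3]].
  assert (L2 : forall f, Ck3 4 U f -> Ck3 2 U f).
  { intros f. apply Ck3_le; auto. }
  assert (Sx : DV dirT F1 t x y = DV dirX (DV dirT F) t x y).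
  { apply vec_eq; apply (Ck3_Schwarz U); auto. }
  assert (Sy : DV dirT F2 t x y = DV dirY (DV dirT F) t x y).
  { apply vec_eq; apply (Ck3_Schwarz U); auto. }
  destruct (DV_cross dirT F1 F2 t x y (VCk3_ex_D U 2 _ _ t x y smooth_F1 Hu)
    (VCk3_ex_D U 2 _ _ t x y smooth_F2 Hu)) as [_ QN].
  rewrite Sx, Sy in QN.
  change (fun t x y => cross (F1 t x y) (F2 t x y)) with N in QN.
  set (Nt := DV dirT N t x y) in *.
  assert (EA : D3 dirT A t x y = dot (n t x y) Nt).
  { pose proof (VCk3_ex_D U 2 _ dirT t x y smooth_N Hu) as EN.
    pose proof (VCk3_ex_D U 2 _ dirT t x y smooth_n Hu) as En.
    destruct (D3_dot dirT N n t x y EN En) as [_ QA].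
    assert (Z : D3 dirT (fun t x y => dot (N t x y) (n t x y)) t x y = D3 dirT A t x y).
    { apply D3_ext_near. generalize (O t x y Hu). apply near3_imp. exact n_dot_N. }
    rewrite Z in QA.
    assert (Z2 : dot (N t x y) (DV dirT n t x y) = 0).
    { rewrite (normal_decomp t x y Hu).
      transitivity (A t x y * dot (n t x y) (DV dirT n t x y)).
      unfold dot, vscal; cbn; ring. rewrite n_dot_dn by auto. ring. }
    rewrite QA, Z2. unfold dot. fold Nt. ring. }
  assert (E1 : D3 dirT (fun t x y => dens_area (F t) x y) t x y =
    - (2 * cz (DV dirT F t x y) / z t x y ^ 3) * A t x y + dot (n t x y) Nt / z t x y ^ 2).
  { assert (I1 : is_derive (fun r : R => 1 / r ^ 2) (z t x y) (- (2 / z t x y ^ 3))).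
    { auto_derive.
      - repeat split; auto; apply (pow_nonzero _ 2 Hz).
      - field. auto. }
    destruct (D3_invz dirT (fun r => 1 / r ^ 2) t x y Hu) as [P1 Q1]. eexists; exact I1.
    rewrite (is_derive_unique _ _ _ I1) in Q1.
    destruct (D3_mult dirT _ A t x y P1 (Ck3_ex_D 2 U _ _ t x y smooth_A Hu)) as [_ Q2].
    etransitivity. exact Q2. rewrite Q1, EA. field. auto. }
  assert (E2 : D3 dirT (fun t x y => dens_normal (F t) x y) t x y =
    - (cz (DV dirT F t x y) / z t x y ^ 2) * cz (N t x y) + cz Nt / z t x y).
  { assert (I1 : is_derive (fun r : R => / r) (z t x y) (- (1 / z t x y ^ 2))).
    { auto_derive; auto. field. auto. }
    destruct (D3_invz dirT (fun r => / r) t x y Hu) as [P1 Q1]. eexists; exact I1.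
    rewrite (is_derive_unique _ _ _ I1) in Q1.
    destruct (VCk3_ex_D U 2 _ dirT t x y smooth_N Hu) as [_ [_ EN]].
    destruct (D3_mult dirT _ _ t x y P1 EN) as [_ Q2].
    transitivity (D3 dirT (fun t x y => / z t x y * cz (N t x y)) t x y).
    - apply D3_ext_near. generalize (O t x y Hu). apply near3_imp. intros p q r Hpqr.
      rewrite (normal_decomp p q r Hpqr). unfold dens_normal. cbn [vscal cz].
      fold (n p q r) (A p q r) (z p q r). unfold Rdiv. ring.
    - rewrite Q2, Q1. change (D3 dirT (fun t x y => cz (N t x y)) t x y) with (cz Nt).
      field. auto. }
  rewrite E1, E2, DF, QN. unfold field_W, defect.
  fold (n t x y) (z t x y).
  unfold dot. cbn [vadd vscal cross E3 cx cy cz].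
  field. auto.
Qed.

(** Expanding the square of the defect, the mixed term [2 H nu_3 / z] is
    [Delta z / z = div (grad z / z) + |grad z|^2 / z^2], and
    [|grad z|^2 = 1 - nu_3^2]; the remaining terms are those of [G]. *)
Lemma helfrich_density_identity co t x y : U t x y ->
  dens_helfrich co (F t) x y =
  dens_defect co (F t) x y - (dens_area (F t) x y + 2 * co * dens_normal (F t) x y) -
  (D3 dirX (fun t x y => flux1 (fun _ _ => E3) (field_W 1 0 0 (F t)) (F t) x y) t x y +
   D3 dirY (fun t x y => flux2 (fun _ _ => E3) (field_W 1 0 0 (F t)) (F t) x y) t x y).
Proof.
  intros Hu. pose proof (rf_z U F RF t x y Hu) as Hz. fold (z t x y) in Hz.
  pose proof (A_pos t x y Hu) as AP.
  pose proof (div_flux (fun _ _ _ => E3) (fun t => field_W 1 0 0 (F t)) t x y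
    (VCk3_const U O 1 E3) (VCk3_le U O 1 2 _ (ltac:(lia)) (smooth_W 1 0 0)) Hu) as DF.
  cbv beta in DF. rewrite (bracket_W 1 0 0 t x y Hu) in DF.
  destruct (DV_const dirX E3 t x y) as [_ C1]. destruct (DV_const dirY E3 t x y) as [_ C2].
  rewrite DF, C1, C2, (normal_decomp t x y Hu).
  unfold dens_helfrich, dens_defect, dens_area, dens_normal, defect.
  fold (n t x y) (z t x y) (A t x y).
  unfold dot. cbn [vzero vadd vscal cross E3 cx cy cz].
  field. auto.
Qed.
End Family.

(** * Locality of the geometric operators *)

Lemma near2_pt (P : R -> R -> Prop) x y : locally_2d P x y -> P x y.
Proof. apply locally_2d_singleton. Qed.

Lemma pd_ext f g x y : locally_2d (fun a b => f a b = g a b) x y ->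
  pd1 f x y = pd1 g x y /\ pd2 f x y = pd2 g x y.
Proof.
  intros H. split; apply Derive_ext_loc.
  - exact (locally_2d_1d_const_y _ _ _ H).
  - exact (locally_2d_1d_const_x _ _ _ H).
Qed.

Lemma vpd_ext (F G : R -> R -> vec) x y :
  locally_2d (fun a b => F a b = G a b) x y ->
  vpd1 F x y = vpd1 G x y /\ vpd2 F x y = vpd2 G x y.
Proof.
  intros H.
  assert (K : forall c : vec -> R, locally_2d (fun a b => c (F a b) = c (G a b)) x y).
  { intros c. revert H. apply locally_2d_impl. apply locally_2d_forall. intros a b E.
    now rewrite E. }
  destruct (pd_ext _ _ _ _ (K cx)) as [A1 A2]. destruct (pd_ext _ _ _ _ (K cy)) as [B1 B2].
  destruct (pd_ext _ _ _ _ (K cz)) as [C1 C2].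
  split; apply vec_eq; assumption.
Qed.

Lemma unit_normal_ext (F G : R -> R -> vec) x y :
  locally_2d (fun a b => F a b = G a b) x y ->
  normal_vec F x y = normal_vec G x y /\ area_density F x y = area_density G x y /\
  unit_normal F x y = unit_normal G x y.
Proof.
  intros H. destruct (vpd_ext F G x y H) as [E1 E2].
  unfold unit_normal, area_density, normal_vec. rewrite E1, E2. auto.
Qed.

Lemma mean_curvature_ext (F G : R -> R -> vec) x y :
  locally_2d (fun a b => F a b = G a b) x y ->
  mean_curvature F x y = mean_curvature G x y.
Proof.
  intros H. destruct (vpd_ext F G x y H) as [E1 E2].
  assert (K : locally_2d (fun a b => unit_normal F a b = unit_normal G a b) x y).
  { apply locally_2d_locally in H. apply locally_locally in H. apply locally_2d_locally.
    revert H. apply filter_imp. intros [a b] H. apply unit_normal_ext.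
    apply locally_2d_locally. exact H. }
  destruct (vpd_ext _ _ _ _ K) as [E3 E4].
  unfold mean_curvature. rewrite E1, E2, E3, E4. reflexivity.
Qed.

Lemma field_W_ext a b c (F G : R -> R -> vec) x y :
  locally_2d (fun a b => F a b = G a b) x y -> field_W a b c F x y = field_W a b c G x y.
Proof.
  intros H. unfold field_W. destruct (unit_normal_ext F G x y H) as [_ [_ E]].
  rewrite E, (near2_pt _ _ _ H). reflexivity.
Qed.

Lemma dens_ext co (F G : R -> R -> vec) x y :
  locally_2d (fun a b => F a b = G a b) x y ->
  dens_area F x y = dens_area G x y /\ dens_normal F x y = dens_normal G x y /\
  dens_helfrich co F x y = dens_helfrich co G x y /\ dens_defect co F x y = dens_defect co G x y /\
  defect co F x y = defect co G x y.
Proof.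
  intros H. unfold dens_area, dens_normal, dens_helfrich, dens_defect, defect.
  destruct (unit_normal_ext F G x y H) as [_ [E1 E2]].
  rewrite E1, E2, (mean_curvature_ext F G x y H), (near2_pt _ _ _ H). auto.
Qed.

(** * Polar coordinates *)

Lemma Ck3_differentiable U f t x y : open3 U -> Ck3 1 U f -> U t x y ->
  differentiable_pt_lim (fun a b => f t a b) x y (D3 dirX f t x y) (D3 dirY f t x y).
Proof.
  intros O H Hu. apply filterdiff_differentiable_pt_lim.
  change (filterdiff (fun u : R * R => f t (fst u) (snd u)) (locally (x, y))
    (fun u : R * R => plus (scal (fst u) (D3 dirX f t x y)) (scal (snd u) (D3 dirY f t x y)))).
  apply (is_derive_filterdiff (fun a b => f t a b) x y (fun a b => D3 dirX f t a b)).
  - apply (locally_2d_locally (fun a b => is_derive (fun s => f t s b) a (D3 dirX f t a b))).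
    apply (near3_2d (fun t a b => is_derive (fun s => f t s b) a (D3 dirX f t a b))).
    generalize (O _ _ _ Hu). apply near3_imp. intros p q r Hp.
    apply Derive_correct. exact (Ck3_ex_D 0 U f dirX p q r H Hp).
  - apply Derive_correct. exact (Ck3_ex_D 0 U f dirY t x y H Hu).
  - apply continuity_2d_pt_filterlim. apply (cont3_2d (D3 dirX f)).
    exact (Ck3_D 0 U f dirX H t x y Hu).
Qed.

Section Polar.
Variables ue sg : R.

(** Polar coordinates around the pole at [ue], with distance [sg * (u - ue)].
    For [sg = -1] the angle is reversed, so that the Jacobian determinant is
    [sg * (u - ue)] in both cases.  The formulas make sense on both sides of
    [u = ue], which is what allows continuation across a pole. *)
Definition px (u th : R) : R := sg * (u - ue) * cos th.
Definition py (u th : R) : R := (u - ue) * sin th.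

Lemma pull_D U f t u th : open3 U -> Ck3 1 U f -> U t (px u th) (py u th) ->
  (ex_D3 dirX (fun t u th => f t (px u th) (py u th)) t u th /\
   D3 dirX (fun t u th => f t (px u th) (py u th)) t u th =
   sg * cos th * D3 dirX f t (px u th) (py u th) + sin th * D3 dirY f t (px u th) (py u th)) /\
  (ex_D3 dirY (fun t u th => f t (px u th) (py u th)) t u th /\
   D3 dirY (fun t u th => f t (px u th) (py u th)) t u th =
   (u - ue) * (- (sg * sin th) * D3 dirX f t (px u th) (py u th)
               + cos th * D3 dirY f t (px u th) (py u th))).
Proof.
  intros O H Hu. pose proof (Ck3_differentiable U f t _ _ O H Hu) as D.
  assert (Xu : is_derive (fun s => px s th) u (sg * cos th)).
  { unfold px. auto_derive; auto. ring. }
  assert (Yu : is_derive (fun s => py s th) u (sin th)).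
  { unfold py. auto_derive; auto. ring. }
  assert (Xt : is_derive (fun s => px u s) th (- (sg * (u - ue) * sin th))).
  { unfold px. auto_derive; auto. ring. }
  assert (Yt : is_derive (fun s => py u s) th ((u - ue) * cos th)).
  { unfold py. auto_derive; auto. ring. }
  apply is_derive_Reals in Xu. apply is_derive_Reals in Yu.
  apply is_derive_Reals in Xt. apply is_derive_Reals in Yt.
  assert (K : forall (g : R -> R) (s l l' : R), derivable_pt_lim g s l -> l = l' ->
    ex_derive g s /\ Derive g s = l').
  { intros g s l l' Hg <-. apply is_derive_Reals in Hg. split.
    - exists l. exact Hg.
    - apply is_derive_unique. exact Hg. }
  split.
  - apply (K _ _ _ _ (derivable_pt_lim_comp_2d (fun a b => f t a b)
      (fun s => px s th) (fun s => py s th) u _ _ _ _ D Xu Yu)). ring.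
  - apply (K _ _ _ _ (derivable_pt_lim_comp_2d (fun a b => f t a b)
      (fun s => px u s) (fun s => py u s) th _ _ _ _ D Xt Yt)). ring.
Qed.

Lemma pull_DV U F t u th : open3 U -> VCk3 1 U F -> U t (px u th) (py u th) ->
  vpd1 (fun u th => F t (px u th) (py u th)) u th =
   vadd (vscal (sg * cos th) (DV dirX F t (px u th) (py u th)))
        (vscal (sin th) (DV dirY F t (px u th) (py u th))) /\
  vpd2 (fun u th => F t (px u th) (py u th)) u th =
   vscal (u - ue) (vadd (vscal (- (sg * sin th)) (DV dirX F t (px u th) (py u th)))
        (vscal (cos th) (DV dirY F t (px u th) (py u th)))).
Proof.
  intros O [A [B C]] Hu.
  destruct (pull_D U _ t u th O A Hu) as [[_ A1] [_ A2]].
  destruct (pull_D U _ t u th O B Hu) as [[_ B1] [_ B2]].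
  destruct (pull_D U _ t u th O C Hu) as [[_ C1] [_ C2]].
  split; apply vec_eq; assumption.
Qed.

Lemma px_cont t u th : cont3 (fun _ u th => px u th) t u th.
Proof.
  apply cont3_mult. apply cont3_mult. apply cont3_const.
  apply cont3_plus. apply cont3_x. apply cont3_opp. apply cont3_const.
  apply (cont3_comp1 cos (fun _ _ c => c)). apply cont3_y. apply continuous_cos.
Qed.

Lemma py_cont t u th : cont3 (fun _ u th => py u th) t u th.
Proof.
  apply cont3_mult.
  apply cont3_plus. apply cont3_x. apply cont3_opp. apply cont3_const.
  apply (cont3_comp1 sin (fun _ _ c => c)). apply cont3_y. apply continuous_sin.
Qed.

Lemma pull_cont f t u th : cont3 f t (px u th) (py u th) ->
  cont3 (fun t u th => f t (px u th) (py u th)) t u th.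
Proof.
  intros H. apply (cont3_comp3 f (fun t _ _ => t) (fun _ u th => px u th)
    (fun _ u th => py u th)).
  - apply cont3_t.
  - apply px_cont.
  - apply py_cont.
  - exact H.
Qed.

Lemma pull_near P t u th : near3 P t (px u th) (py u th) ->
  near3 (fun t u th => P t (px u th) (py u th)) t u th.
Proof.
  intros H. apply near3_box in H. destruct H as [d H].
  pose proof (proj1 (cont3_eps _ _ _ _) (px_cont t u th) d) as A.
  pose proof (proj1 (cont3_eps _ _ _ _) (py_cont t u th) d) as B.
  pose proof (proj1 (cont3_eps _ _ _ _) (cont3_t t u th) d) as C.
  generalize (near3_and _ _ _ _ _ A (near3_and _ _ _ _ _ B C)).
  apply near3_imp. cbn. intros a b c [K [L M]]. apply H; assumption.
Qed.

(** The formula for [H] only involves first derivatives of the position and of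
    the unit normal, which all transform by the same Jacobian matrix; it is a
    trace, so the matrix cancels. *)
Lemma curvature_change (a b c d : R) (e f p q : vec) :
  a * d - b * c <> 0 -> dot (cross e f) (cross e f) <> 0 ->
  let e' := vadd (vscal a e) (vscal b f) in
  let f' := vadd (vscal c e) (vscal d f) in
  let p' := vadd (vscal a p) (vscal b q) in
  let q' := vadd (vscal c p) (vscal d q) in
  - (dot f' f' * dot p' e' - dot e' f' * (dot p' f' + dot q' e') + dot e' e' * dot q' f')
    / (2 * (dot e' e' * dot f' f' - dot e' f' * dot e' f')) =
  - (dot f f * dot p e - dot e f * (dot p f + dot q e) + dot e e * dot q f)
    / (2 * (dot e e * dot f f - dot e f * dot e f)).
Proof.
  intros D G. cbv zeta. rewrite <- gram in G.
  set (e' := vadd (vscal a e) (vscal b f)). set (f' := vadd (vscal c e) (vscal d f)).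
  set (p' := vadd (vscal a p) (vscal b q)). set (q' := vadd (vscal c p) (vscal d q)).
  assert (E : dot e' e' * dot f' f' - dot e' f' * dot e' f' =
    (a * d - b * c) * (a * d - b * c) * (dot e e * dot f f - dot e f * dot e f)).
  { unfold e', f', dot, vadd, vscal; cbn. ring. }
  assert (M : dot f' f' * dot p' e' - dot e' f' * (dot p' f' + dot q' e') + dot e' e' * dot q' f' =
    (a * d - b * c) * (a * d - b * c) *
    (dot f f * dot p e - dot e f * (dot p f + dot q e) + dot e e * dot q f)).
  { unfold e', f', p', q', dot, vadd, vscal; cbn. ring. }
  rewrite E, M. field. split; auto.
Qed.

Lemma cross_polar (r th : R) (e f : vec) :
  cross (vadd (vscal (sg * cos th) e) (vscal (sin th) f))
        (vscal r (vadd (vscal (- (sg * sin th)) e) (vscal (cos th) f))) =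
  vscal (sg * r) (cross e f).
Proof.
  pose proof (sin2_cos2 th) as T. unfold Rsqr in T.
  assert (K : forall w, r * sg * (sin th * sin th + cos th * cos th) * w = r * sg * w).
  { intros w. rewrite T. ring. }
  apply vec_eq; cbn [cross vscal vadd cx cy cz];
  match goal with |- _ = sg * r * ?w => transitivity (r * sg * (sin th * sin th + cos th * cos th) * w); [ring | rewrite K; ring] end.
Qed.

Section Invariance.
Variables (U : R -> R -> R -> Prop) (G : R -> R -> R -> vec).
Hypothesis RF : regular_family U G.
Let O := rf_open U G RF.
Let F t u th := G t (px u th) (py u th).

Lemma normal_polar t u th : U t (px u th) (py u th) -> 0 < sg * (u - ue) ->
  normal_vec (F t) u th = vscal (sg * (u - ue)) (normal_vec (G t) (px u th) (py u th)) /\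
  area_density (F t) u th = sg * (u - ue) * area_density (G t) (px u th) (py u th) /\
  unit_normal (F t) u th = unit_normal (G t) (px u th) (py u th).
Proof.
  intros Hu Hr.
  destruct (pull_DV U G t u th O (VCk3_le U O 1 4 _ ltac:(lia) (rf_smooth U G RF)) Hu) as [E1 E2].
  assert (EN : normal_vec (F t) u th = vscal (sg * (u - ue)) (normal_vec (G t) (px u th) (py u th))).
  { unfold normal_vec at 1. unfold F. rewrite E1, E2. apply cross_polar. }
  assert (EA : area_density (F t) u th = sg * (u - ue) * area_density (G t) (px u th) (py u th)).
  { unfold area_density, vnorm. rewrite EN.
    set (N := normal_vec (G t) (px u th) (py u th)).
    replace (dot (vscal (sg * (u - ue)) N) (vscal (sg * (u - ue)) N)) with
      ((sg * (u - ue)) * (sg * (u - ue)) * dot N N) by (unfold dot, vscal; cbn; ring).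
    rewrite sqrt_mult_alt by nra. rewrite sqrt_square; lra. }
  split; [exact EN|]. split; [exact EA|].
  unfold unit_normal. rewrite EN, EA.
  pose proof (A_pos U G RF _ _ _ Hu) as AP.
  assert (S0 : sg <> 0) by (intro Z; rewrite Z in Hr; lra).
  assert (S1 : u - ue <> 0) by (intro Z; rewrite Z in Hr; lra).
  assert (S2 : area_density (G t) (px u th) (py u th) <> 0) by lra.
  apply vec_eq; cbn [vscal cx cy cz]; field; auto.
Qed.

Lemma curvature_polar t u th : U t (px u th) (py u th) -> 0 < sg * (u - ue) ->
  mean_curvature (F t) u th = mean_curvature (G t) (px u th) (py u th).
Proof.
  intros Hu Hr.
  destruct (pull_DV U G t u th O (VCk3_le U O 1 4 _ ltac:(lia) (rf_smooth U G RF)) Hu) as [E1 E2].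
  destruct (pull_DV U (fun t => unit_normal (G t)) t u th O
    (VCk3_le U O 1 3 _ ltac:(lia) (smooth_n U G RF)) Hu) as [E3 E4].
  assert (L : locally_2d (fun a b => unit_normal (F t) a b = unit_normal (G t) (px a b) (py a b)) u th).
  { apply (near3_2d (fun t a b => unit_normal (F t) a b = unit_normal (G t) (px a b) (py a b))).
    pose proof (pull_near U t u th (O _ _ _ Hu)) as K1.
    assert (K2 : near3 (fun _ a _ => - (sg * (a - ue)) < 0) t u th).
    { apply (cont3_lt (fun _ a _ => - (sg * (a - ue)))); [|lra].
      apply cont3_opp. apply cont3_mult. apply cont3_const.
      apply cont3_plus. apply cont3_x. apply cont3_const. }
    generalize (near3_and _ _ _ _ _ K1 K2). apply near3_imp.
    intros p q r [H1 H2]. apply normal_polar; auto. lra. }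
  destruct (vpd_ext _ _ _ _ L) as [E5 E6]. rewrite E3 in E5. rewrite E4 in E6.
  unfold mean_curvature at 1. rewrite E5, E6. unfold F. rewrite E1, E2.
  replace (vscal (u - ue) (vadd (vscal (- (sg * sin th)) (DV dirX G t (px u th) (py u th)))
      (vscal (cos th) (DV dirY G t (px u th) (py u th))))) with
    (vadd (vscal (- ((u - ue) * (sg * sin th))) (DV dirX G t (px u th) (py u th)))
      (vscal ((u - ue) * cos th) (DV dirY G t (px u th) (py u th))))
    by (apply vec_eq; cbn; ring).
  set (n := fun t => unit_normal (G t)).
  replace (vscal (u - ue) (vadd (vscal (- (sg * sin th)) (DV dirX n t (px u th) (py u th)))
      (vscal (cos th) (DV dirY n t (px u th) (py u th))))) with
    (vadd (vscal (- ((u - ue) * (sg * sin th))) (DV dirX n t (px u th) (py u th)))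
      (vscal ((u - ue) * cos th) (DV dirY n t (px u th) (py u th))))
    by (apply vec_eq; cbn; ring).
  rewrite curvature_change.
  - reflexivity.
  - pose proof (sin2_cos2 th) as T. unfold Rsqr in T.
    replace (sg * cos th * ((u - ue) * cos th) - sin th * - ((u - ue) * (sg * sin th)))
      with (sg * (u - ue) * (sin th * sin th + cos th * cos th)) by ring.
    rewrite T. lra.
  - pose proof (dot_pos _ (rf_regular U G RF _ _ _ Hu)) as P. apply Rgt_not_eq. exact P.
Qed.

Lemma dens_polar co t u th : U t (px u th) (py u th) -> 0 < sg * (u - ue) ->
  dens_area (F t) u th = sg * (u - ue) * dens_area (G t) (px u th) (py u th) /\
  dens_normal (F t) u th = sg * (u - ue) * dens_normal (G t) (px u th) (py u th) /\
  dens_helfrich co (F t) u th = sg * (u - ue) * dens_helfrich co (G t) (px u th) (py u th) /\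
  dens_defect co (F t) u th = sg * (u - ue) * dens_defect co (G t) (px u th) (py u th) /\
  defect co (F t) u th = defect co (G t) (px u th) (py u th).
Proof.
  intros Hu Hr. destruct (normal_polar t u th Hu Hr) as [_ [E1 E2]].
  pose proof (curvature_polar t u th Hu Hr) as E3.
  unfold dens_area, dens_normal, dens_helfrich, dens_defect, defect. rewrite E1, E2, E3. unfold F.
  repeat split; ring.
Qed.

Lemma W_polar a b c t u th : U t (px u th) (py u th) -> 0 < sg * (u - ue) ->
  field_W a b c (F t) u th = field_W a b c (G t) (px u th) (py u th).
Proof.
  intros Hu Hr. destruct (normal_polar t u th Hu Hr) as [_ [_ E2]].
  unfold field_W. rewrite E2. reflexivity.
Qed.
End Invariance.
End Polar.

(** * Angles and periods *)

Lemma shift_period {T : Type} (f : R -> T) p :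
  (forall x, f (x + p) = f x) -> forall k x, f (x + IZR k * p) = f x.
Proof.
  intros H k x.
  assert (N : forall n x, f (x + INR n * p) = f x).
  { clear k x. induction n as [|n IH]; intros x.
    - cbn. f_equal. ring.
    - rewrite S_INR. replace (x + (INR n + 1) * p) with ((x + INR n * p) + p) by ring.
      rewrite H. apply IH. }
  destruct (Z.le_gt_cases 0 k) as [Hk|Hk].
  - rewrite <- (Z2Nat.id k Hk), <- INR_IZR_INZ. apply N.
  - assert (Hk' : (0 <= - k)%Z) by lia.
    rewrite <- (N (Z.to_nat (- k)) (x + IZR k * p)).
    rewrite INR_IZR_INZ, Z2Nat.id by lia. rewrite opp_IZR. f_equal. ring.
Qed.

Lemma shift_into p a x : 0 < p -> exists k, a <= x + IZR k * p <= a + p.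
Proof.
  intros Hp. exists (1 - up ((x - a) / p))%Z.
  destruct (archimed ((x - a) / p)) as [A B]. rewrite minus_IZR.
  set (m := IZR (up ((x - a) / p))) in *.
  assert (E : x - a = (x - a) / p * p) by (field; lra).
  assert ((x - a) / p * p < m * p) by (apply Rmult_lt_compat_r; lra).
  assert (m * p <= ((x - a) / p + 1) * p) by (apply Rmult_le_compat_r; lra). nra.
Qed.

Lemma radius_sqr x y : radius x y * radius x y = x ^ 2 + y ^ 2.
Proof. apply sqrt_sqrt. nra. Qed.

Lemma radius_pos x y : 0 <= radius x y.
Proof. apply sqrt_pos. Qed.

Lemma angle_spec x y : 0 < radius x y ->
  radius x y * cos (angle x y) = x /\ radius x y * sin (angle x y) = y.
Proof.
  intros Hr. pose proof (radius_sqr x y) as Q. set (r := radius x y) in *.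
  assert (B : -1 <= x / r <= 1).
  { assert (E : x / r * r = x) by (field; lra).
    assert (-1 * r <= x / r * r <= 1 * r) by (rewrite E; nra).
    split; apply (Rmult_le_reg_r r); lra. }
  assert (C : r * cos (acos (x / r)) = x) by (rewrite cos_acos by auto; field; lra).
  assert (S : r * sin (acos (x / r)) = Rabs y).
  { rewrite sin_acos by auto. unfold Rsqr.
    rewrite <- (sqrt_square r) at 1 by lra.
    rewrite <- sqrt_mult_alt by nra.
    replace (r * r * (1 - x / r * (x / r))) with (Rsqr y).
    - apply sqrt_Rsqr_abs.
    - unfold Rsqr. replace (r * r * (1 - x / r * (x / r))) with (r * r - x * x) by (field; lra).
      rewrite Q. ring. }
  unfold angle. fold r. destruct (Rle_dec 0 y) as [Hy|Hy].
  - rewrite Rabs_right in S by lra. auto.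
  - rewrite Rabs_left in S by lra. rewrite cos_neg, sin_neg. split. auto. lra.
Qed.

Lemma sign_cases sg : sg * sg = 1 -> sg = 1 \/ sg = -1.
Proof.
  intros H. assert (F : (sg - 1) * (sg + 1) = 0) by lra. apply Rmult_integral in F. lra.
Qed.

Lemma same_angle a b : cos a = cos b -> sin a = sin b ->
  exists k, a = b + IZR k * (2 * PI).
Proof.
  intros C S.
  assert (E : cos (a - b) = 1).
  { rewrite cos_minus, C, S. pose proof (sin2_cos2 b) as T. unfold Rsqr in T. lra. }
  assert (H : sin ((a - b) / 2) = 0).
  { replace (a - b) with (2 * ((a - b) / 2)) in E by field.
    rewrite cos_2a_sin in E. nra. }
  destruct (sin_eq_0_0 _ H) as [k Hk]. exists k. lra.
Qed.

(** * Charts *)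

Notation sint S := (dint (u0 S) (u1 S) 0 (2 * PI)).
Notation scont S := (cont_rect (u0 S) (u1 S) 0 (2 * PI)).

Definition len (S : surface) : R := u1 S - u0 S.

Lemma len_pos S : 0 < len S.
Proof. unfold len. pose proof (u0_lt_u1 S). lra. Qed.

(** The charts around the poles at both ends, treated together: the pole is at
    [u = ue], and [sg] is 1 at the start of the profile and -1 at its end. *)
Record polar_chart (S : surface) (ue sg : R) (c : chart) : Prop := {
  pc_sg : sg * sg = 1;
  pc_in : In c (charts S);
  pc_param : forall x y, to_param c x y = (ue + sg * radius x y, sg * angle x y);
  pc_dom : forall x y, chart_dom c x y <-> radius x y < len S;
  pc_nbhd : forall d x y, chart_nbhd c d x y <-> radius x y < len S;
  pc_range : forall u, u0 S < u < u1 S <-> 0 < sg * (u - ue) < len S;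
  pc_side : forall u, u0 S <= u <= u1 S -> 0 <= sg * (u - ue);
  pc_surface : forall u, 0 <= sg * (u - ue) < len S -> in_surface S u;
  pc_end : u0 S <= ue <= u1 S;
  pc_constant : forall Y, well_defined S Y -> forall th, Y ue th = Y ue 0
}.

Lemma pole0_polar S e1 : shape S = Arc Pole e1 -> polar_chart S (u0 S) 1 (pole0_chart S).
Proof.
  intros E. pose proof (u0_lt_u1 S) as L.
  constructor; try (intros; reflexivity); try (unfold len; intros; lra).
  - unfold charts. rewrite E. right. left. reflexivity.
  - intros x y. cbn. f_equal; ring.
  - unfold in_surface, len. rewrite E. intros u Hu. lra.
  - intros Y [_ W]. rewrite E in W. apply W. reflexivity.
Qed.

Lemma pole1_polar S e0 : shape S = Arc e0 Pole -> polar_chart S (u1 S) (-1) (pole1_chart S).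
Proof.
  intros E. pose proof (u0_lt_u1 S) as L.
  constructor; try (intros; reflexivity); try (unfold len; intros; lra).
  - unfold charts. rewrite E. right. apply in_or_app. right. left. reflexivity.
  - intros x y. cbn. f_equal; ring.
  - unfold in_surface, len. rewrite E. intros u Hu. lra.
  - intros Y [_ W]. rewrite E in W. apply W. reflexivity.
Qed.

Lemma charts_cases S c : In c (charts S) ->
  c = cylinder_chart S \/ exists ue sg, polar_chart S ue sg c.
Proof.
  unfold charts. intros [H|H]. left; auto. right.
  destruct (shape S) as [e0 e1|] eqn:E; [|destruct H].
  apply in_app_or in H. destruct H as [H|H].
  - destruct e0; [destruct H|]. destruct H as [H|[]]. subst c.
    exists (u0 S), 1. apply (pole0_polar S e1 E).
  - destruct e1; [destruct H|]. destruct H as [H|[]]. subst c.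
    exists (u1 S), (-1). apply (pole1_polar S e0 E).
Qed.

Lemma polar_radius S ue sg c u th : polar_chart S ue sg c -> 0 <= sg * (u - ue) ->
  radius (px ue sg u th) (py ue u th) = sg * (u - ue).
Proof.
  intros P Hr. pose proof (pc_sg _ _ _ _ P) as sg2.
  pose proof (sin2_cos2 th) as T. unfold Rsqr in T.
  unfold radius. replace (px ue sg u th ^ 2 + py ue u th ^ 2) with
    ((sg * (u - ue)) * (sg * (u - ue))).
  apply sqrt_square; lra. unfold px, py.
  replace ((sg * (u - ue) * cos th) ^ 2) with
    (sg * sg * ((u - ue) * (u - ue)) * (cos th * cos th)) by ring.
  replace ((sg * (u - ue)) * (sg * (u - ue))) with
    (sg * sg * ((u - ue) * (u - ue))) by ring.
  rewrite sg2. transitivity ((u - ue) * (u - ue) * (sin th * sin th + cos th * cos th)).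
  rewrite T; ring. ring.
Qed.

(** The chart recovers the angle up to a multiple of [2 PI] only, which the
    periodicity absorbs. *)
Lemma polar_rep S ue sg c (Y : R -> R -> vec) u th :
  polar_chart S ue sg c -> 0 < sg * (u - ue) ->
  (forall th, Y u (th + 2 * PI) = Y u th) ->
  Y u th = local_rep c Y (px ue sg u th) (py ue u th).
Proof.
  intros P Hr Per. pose proof (pc_sg _ _ _ _ P) as sg2.
  unfold local_rep. rewrite (pc_param _ _ _ _ P). cbn [fst snd].
  assert (R : radius (px ue sg u th) (py ue u th) = sg * (u - ue)).
  { apply (polar_radius S ue sg c); auto. lra. }
  destruct (angle_spec (px ue sg u th) (py ue u th)) as [C D]. lra.
  rewrite R in *. set (phi := angle _ _) in *.
  assert (E1 : cos (sg * phi) = cos th /\ sin (sg * phi) = sin th).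
  { assert (H1 : cos phi = cos th).
    { apply (Rmult_eq_reg_l (sg * (u - ue))); [|lra]. rewrite C. reflexivity. }
    assert (H2 : sg * sin phi = sin th).
    { apply (Rmult_eq_reg_l (u - ue)); [|intro Z; rewrite Z in Hr; lra].
      transitivity (py ue u th); [|reflexivity]. rewrite <- D. ring. }
    pose proof (sign_cases sg sg2) as Sg.
    destruct Sg as [Sg|Sg]; rewrite Sg in *.
    - rewrite Rmult_1_l. lra.
    - replace (-1 * phi) with (- phi) by ring. rewrite cos_neg, sin_neg. lra. }
  destruct E1 as [E1 E2]. destruct (same_angle _ _ E1 E2) as [k Hk].
  rewrite Hk. replace (ue + sg * (sg * (u - ue))) with (ue + sg * sg * (u - ue)) by ring.
  rewrite sg2. replace (ue + 1 * (u - ue)) with u by ring.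
  symmetry. apply (shift_period (fun th => Y u th)). exact Per.
Qed.

Lemma cyl_dom_range S u th : chart_dom (cylinder_chart S) u th -> in_surface S u.
Proof.
  cbn. unfold in_surface. destruct (shape S) as [[] []|]; lra.
Qed.

Lemma cyl_dom_interior S u th : u0 S < u < u1 S -> chart_dom (cylinder_chart S) u th.
Proof. cbn. destruct (shape S) as [[] []|]; lra. Qed.

Lemma interior_in_surface S u : u0 S <= u <= u1 S -> in_surface S u.
Proof. unfold in_surface. destruct (shape S); auto. Qed.

Lemma dom_nbhd S c d x y : In c (charts S) -> 0 < d -> chart_dom c x y -> chart_nbhd c d x y.
Proof.
  intros H Hd. destruct (charts_cases S c H) as [E|[ue [sg P]]].
  - subst c. cbn. destruct (shape S) as [[] []|]; lra.
  - rewrite (pc_dom _ _ _ _ P), (pc_nbhd _ _ _ _ P). auto.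
Qed.

Lemma radius_cont t x y : cont3 (fun _ x y => radius x y) t x y.
Proof.
  apply (cont3_comp1 sqrt (fun _ x y => x ^ 2 + y ^ 2)); [|apply continuous_sqrt].
  cbn [pow]. repeat (apply cont3_plus || apply cont3_mult);
  first [apply cont3_const | apply cont3_x | apply cont3_y].
Qed.

Lemma nbhd_open S c d : In c (charts S) -> open3 (fun _ x y => chart_nbhd c d x y).
Proof.
  intros H t x y K. destruct (charts_cases S c H) as [E|[ue [sg P]]].
  - subst c. cbn in *.
    assert (G : forall k, k < x -> near3 (fun _ x _ => k < x) t x y).
    { intros k Hk. assert (Hk' : - x < - k) by lra.
      generalize (cont3_lt (fun _ x _ => - x) t x y (- k)
        (cont3_opp _ _ _ _ (cont3_x t x y)) Hk'). apply near3_imp. intros; lra. }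
    assert (G' : forall k, x < k -> near3 (fun _ x _ => x < k) t x y).
    { intros k Hk. apply cont3_lt; auto. apply cont3_x. }
    destruct (shape S) as [[] []|]; try (apply near3_and; [apply G | apply G']; lra).
    apply near3_box. exists (mkposreal 1 Rlt_0_1). trivial.
  - rewrite (pc_nbhd _ _ _ _ P) in K.
    generalize (cont3_lt _ t x y _ (radius_cont t x y) K). apply near3_imp.
    intros _ a b Hab. apply (pc_nbhd _ _ _ _ P). exact Hab.
Qed.

(** * Families of surfaces and continuation of integrands to the ends *)

Record surface_family (S : surface) (eps : R) (Y : R -> R -> R -> vec) : Prop := {
  sf_eps : 0 < eps;
  sf_smooth : C4_family S eps Y;
  sf_wd : forall t, Rabs t < eps -> well_defined S (Y t);
  sf_regular : forall t, Rabs t < eps -> regular S (Y t);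
  sf_z : forall t u th, Rabs t < eps -> in_surface S u -> cz (Y t u th) <> 0
}.

(** The normal and [z] are nonzero on the surface and, by continuity, near it; a
    chart neighbourhood may reach further beyond the boundary. *)
Definition chart_open (eps d : R) (Y : R -> R -> R -> vec) (c : chart) (t x y : R) : Prop :=
  (Rabs t < eps /\ chart_nbhd c d x y) /\
  (normal_vec (local_rep c (Y t)) x y <> vzero /\ cz (local_rep c (Y t) x y) <> 0).

Lemma time_open eps : open3 (fun t _ _ => Rabs t < eps).
Proof.
  intros t x y H. apply (cont3_lt (fun t _ _ => Rabs t)); auto.
  apply (cont3_comp1 Rabs (fun t _ _ => t)). apply cont3_t. apply continuous_Rabs.
Qed.

Lemma interior_near S eps t u th : Rabs t < eps -> u0 S < u < u1 S ->
  near3 (fun t u _ => Rabs t < eps /\ u0 S < u < u1 S) t u th.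
Proof.
  intros Ht Hu. apply near3_and. apply time_open; auto.
  apply near3_and.
  - assert (Hk : - u < - u0 S) by lra.
    generalize (cont3_lt (fun _ u _ => - u) t u th (- u0 S)
        (cont3_opp _ _ _ _ (cont3_x t u th)) Hk). apply near3_imp. intros; lra.
  - apply cont3_lt. apply cont3_x. lra.
Qed.

Lemma interior_2d S u th : u0 S < u < u1 S ->
  locally_2d (fun a _ => u0 S < a < u1 S) u th.
Proof.
  intros Hu. assert (Z0 : Rabs 0 < 1) by (rewrite Rabs_R0; lra).
  generalize (near3_2d _ _ _ _ (interior_near S 1 0 u th Z0 Hu)).
  apply locally_2d_impl. apply locally_2d_forall. intros p q H. apply H.
Qed.

Lemma polar_rep_near S ue sg c Z u th : polar_chart S ue sg c -> well_defined S Z ->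
  u0 S < u < u1 S ->
  locally_2d (fun a b => Z a b = local_rep c Z (px ue sg a b) (py ue a b)) u th.
Proof.
  intros P W Hu. generalize (interior_2d S u th Hu).
  apply locally_2d_impl. apply locally_2d_forall. intros a b Ha.
  apply (polar_rep S); auto.
  - apply (pc_range _ _ _ _ P). exact Ha.
  - intros th'. apply (proj1 W). apply interior_in_surface. lra.
Qed.

Lemma time_nbhd_open S eps c d : In c (charts S) ->
  open3 (fun t x y => Rabs t < eps /\ chart_nbhd c d x y).
Proof.
  intros H t x y [A B]. apply near3_and.
  - apply time_open. exact A.
  - apply (nbhd_open S c d H). exact B.
Qed.

Lemma vcont_neq0 (v : R -> R -> R -> vec) t x y :
  cont3 (fun t x y => cx (v t x y)) t x y -> cont3 (fun t x y => cy (v t x y)) t x y ->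
  cont3 (fun t x y => cz (v t x y)) t x y -> v t x y <> vzero ->
  near3 (fun t x y => v t x y <> vzero) t x y.
Proof.
  intros A B C N.
  assert (K : near3 (fun t x y => dot (v t x y) (v t x y) <> 0) t x y).
  { apply (cont3_neq0 (fun t x y => dot (v t x y) (v t x y))).
    - pose proof (cont3_mult _ _ _ _ _ A A) as A2. pose proof (cont3_mult _ _ _ _ _ B B) as B2.
      pose proof (cont3_mult _ _ _ _ _ C C) as C2.
      exact (cont3_plus _ _ _ _ _ (cont3_plus _ _ _ _ _ A2 B2) C2).
    - pose proof (dot_pos _ N). lra. }
  revert K. apply near3_imp. intros a b c K E. rewrite E in K. apply K.
  unfold dot, vzero; cbn. ring.
Qed.

Section Setting.
Variables (S : surface) (eps : R) (Y : R -> R -> R -> vec).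
Hypothesis SF : surface_family S eps Y.

Lemma local_rep_regular : exists d, 0 < d /\ forall c, In c (charts S) ->
  regular_family (chart_open eps d Y c) (fun t => local_rep c (Y t)).
Proof.
  destruct (sf_smooth _ _ _ SF) as [d [Hd H]]. exists d. split; auto.
  intros c Hc. specialize (H c Hc). cbv zeta in H.
  change (VCk3 4 (fun t x y => Rabs t < eps /\ chart_nbhd c d x y) (fun t => local_rep c (Y t))) in H.
  pose proof (time_nbhd_open S eps c d Hc) as O.
  constructor.
  - intros t x y [A [B C]]. apply near3_and. apply O; exact A. apply near3_and.
    + pose proof (VCk3_cross _ O 3 _ _ (VCk3_D _ 3 _ dirX H) (VCk3_D _ 3 _ dirY H)) as [N1 [N2 N3]].
      apply (vcont_neq0 (fun t x y => normal_vec (local_rep c (Y t)) x y)); auto.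
      * exact (Ck3_cont_pt 3 _ _ t x y O N1 A).
      * exact (Ck3_cont_pt 3 _ _ t x y O N2 A).
      * exact (Ck3_cont_pt 3 _ _ t x y O N3 A).
    + apply (cont3_neq0 (fun t x y => cz (local_rep c (Y t) x y))); auto.
      exact (Ck3_cont_pt 4 _ _ t x y O (proj2 (proj2 H)) A).
  - apply (VCk3_sub 4 _ _ _ (fun t x y K => proj1 K) H).
  - intros t x y K. apply K.
  - intros t x y K. apply K.
Qed.

Lemma dom_chart_open d c t x y : 0 < d -> In c (charts S) -> Rabs t < eps ->
  chart_dom c x y -> chart_open eps d Y c t x y.
Proof.
  intros Hd Hc Ht H. repeat split; auto.
  - apply (dom_nbhd S); auto.
  - apply (sf_regular _ _ _ SF t Ht c Hc x y H).
  - apply (sf_z _ _ _ SF t _ _ Ht).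
    destruct (charts_cases S c Hc) as [E|[ue [sg P]]].
    + subst c. apply (cyl_dom_range S _ y). exact H.
    + rewrite (pc_param _ _ _ _ P). cbn [fst]. apply (pc_surface _ _ _ _ P).
      apply (pc_dom _ _ _ _ P) in H. pose proof (radius_pos x y).
      replace (sg * (ue + sg * radius x y - ue)) with (sg * sg * radius x y) by ring.
      rewrite (pc_sg _ _ _ _ P). lra.
Qed.

Lemma in_cylinder : In (cylinder_chart S) (charts S).
Proof. left. reflexivity. Qed.

Lemma interior_open d t u th : 0 < d -> Rabs t < eps -> u0 S < u < u1 S ->
  chart_open eps d Y (cylinder_chart S) t u th.
Proof. intros Hd Ht Hu. apply dom_chart_open; auto using in_cylinder, cyl_dom_interior. Qed.

Lemma polar_open d ue sg c t u th : 0 < d -> polar_chart S ue sg c -> Rabs t < eps ->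
  0 <= sg * (u - ue) < len S -> chart_open eps d Y c t (px ue sg u th) (py ue u th).
Proof.
  intros Hd P Ht Hr. apply dom_chart_open; auto. exact (pc_in _ _ _ _ P).
  apply (pc_dom _ _ _ _ P). rewrite (polar_radius S ue sg c); auto; lra.
Qed.

Lemma time_near t : Rabs t < eps -> locally t (fun s => Rabs s < eps).
Proof. intros H. exact (proj1 (near3_slices _ t 0 0 (time_open eps t 0 0 H))). Qed.

(** Integrands live on the open cylinder, and the end points of the profile are
    poles or boundary circles.  The continuation is [k] itself at a boundary
    circle and is supplied by the polar chart at a pole; [Q] is the regularity
    that it is asked to have, any property of germs. *)
Lemma extend_to_ends (Q : (R -> R -> R -> R) -> R -> R -> R -> Prop) (k : R -> R -> R -> R) :
  (forall f g t u th, near3 (fun a b c => f a b c = g a b c) t u th -> Q f t u th -> Q g t u th) ->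
  (forall t u th, Rabs t < eps -> chart_dom (cylinder_chart S) u th -> Q k t u th) ->
  (forall ue sg c, polar_chart S ue sg c -> exists kp,
     (forall t u th, Rabs t < eps -> u0 S < u < u1 S -> kp t u th = k t u th) /\
     (forall t th, Rabs t < eps -> Q kp t ue th)) ->
  exists kb, (forall t u th, chart_dom (cylinder_chart S) u th -> u0 S <= u <= u1 S ->
       kb t u th = k t u th) /\
    (forall t u th, Rabs t < eps -> u0 S <= u <= u1 S -> Q kb t u th).
Proof.
  intros Qg Qk Qp. pose proof (u0_lt_u1 S) as L.
  destruct (shape S) as [e0 e1|] eqn:Sh.
  - assert (End : forall ei ue,
      (ei = Boundary -> forall th, chart_dom (cylinder_chart S) ue th) ->
      (ei = Pole -> exists sg c, polar_chart S ue sg c) -> exists k',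
      (forall t u th, Rabs t < eps -> u0 S < u < u1 S -> k' t u th = k t u th) /\
      (forall t th, Rabs t < eps -> Q k' t ue th) /\ (ei = Boundary -> k' = k)).
    { intros ei ue HB HP. destruct ei.
      - exists k. repeat split; auto.
      - destruct (HP eq_refl) as [sg [c P]]. destruct (Qp _ _ _ P) as [kp [A B]].
        exists kp. repeat split; auto. discriminate. }
    destruct (End e0 (u0 S)) as [k0 [A0 [B0 C0]]].
    { intros -> th. cbn. rewrite Sh. destruct e1; lra. }
    { intros ->. eexists _, _. apply (pole0_polar S e1 Sh). }
    destruct (End e1 (u1 S)) as [k1 [A1 [B1 C1]]].
    { intros -> th. cbn. rewrite Sh. destruct e0; lra. }
    { intros ->. eexists _, _. apply (pole1_polar S e0 Sh). }
    exists (fun t u th => if Rle_dec u (u0 S) then k0 t u th else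
      if Rle_dec (u1 S) u then k1 t u th else k t u th).
    assert (LT : forall t u th, u < u1 S -> near3 (fun _ u _ => u < u1 S) t u th).
    { intros t u th H. apply cont3_lt; auto. apply cont3_x. }
    assert (GT : forall t u th, u0 S < u -> near3 (fun _ u _ => u0 S < u) t u th).
    { intros t u th H. assert (Hk : - u < - u0 S) by lra.
      generalize (cont3_lt (fun _ u _ => - u) t u th (- u0 S)
        (cont3_opp _ _ _ _ (cont3_x t u th)) Hk). apply near3_imp. intros; lra. }
    split.
    + intros t u th D Hu. cbn in D. rewrite Sh in D.
      destruct (Rle_dec u (u0 S)); [|destruct (Rle_dec (u1 S) u); auto].
      * destruct e0; [rewrite C0; auto|]. destruct e1; lra.
      * destruct e1; [rewrite C1; auto|]. destruct e0; lra.
    + intros t u th Ht Hu. pose proof (time_open eps t u th Ht) as NT.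
      destruct (Req_dec u (u0 S)) as [->|N0]; [|destruct (Req_dec u (u1 S)) as [->|N1]].
      * apply (Qg k0); auto.
        generalize (near3_and _ _ _ _ _ NT (LT t (u0 S) th L)). apply near3_imp.
        intros a b c [Ha Hb]. destruct (Rle_dec b (u0 S)); auto.
        destruct (Rle_dec (u1 S) b); [lra|]. apply A0; auto. lra.
      * apply (Qg k1); auto.
        generalize (near3_and _ _ _ _ _ NT (GT t (u1 S) th L)). apply near3_imp.
        intros a b c [Ha Hb]. destruct (Rle_dec b (u0 S)); [lra|].
        destruct (Rle_dec (u1 S) b); auto. apply A1; auto. lra.
      * apply (Qg k).
        -- assert (La : u < u1 S) by lra. assert (Lb : u0 S < u) by lra.
           generalize (near3_and _ _ _ _ _ (LT t u th La) (GT t u th Lb)). apply near3_imp.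
           intros a b c [Ha Hb]. destruct (Rle_dec b (u0 S)); [lra|].
           destruct (Rle_dec (u1 S) b); [lra|]. reflexivity.
        -- apply Qk; auto. apply cyl_dom_interior. lra.
  - exists k. split; auto. intros t u th Ht Hu. apply Qk; auto. cbn. rewrite Sh. exact I.
Qed.
End Setting.

(** Integrands with respect to the coordinate measure, as opposed to scalars on
    the surface: [dn_polar] says that they pick up the Jacobian determinant. *)
Record density (K : (R -> R -> vec) -> R -> R -> R) : Prop := {
  dn_smooth : forall U F, regular_family U F -> Ck3 1 U (fun t x y => K (F t) x y);
  dn_local : forall F G x y, locally_2d (fun a b => F a b = G a b) x y -> K F x y = K G x y;
  dn_polar : forall ue sg U G t u th, regular_family U G ->
    U t (px ue sg u th) (py ue u th) -> 0 < sg * (u - ue) ->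
    K (fun a b => G t (px ue sg a b) (py ue a b)) u th =
    sg * (u - ue) * K (G t) (px ue sg u th) (py ue u th)
}.

Lemma density_intro K :
  (forall U F, regular_family U F -> Ck3 2 U (fun t x y => K (F t) x y)) ->
  (forall F G x y, locally_2d (fun a b => F a b = G a b) x y -> K F x y = K G x y) ->
  (forall ue sg U G t u th, regular_family U G ->
    U t (px ue sg u th) (py ue u th) -> 0 < sg * (u - ue) ->
    K (fun a b => G t (px ue sg a b) (py ue a b)) u th =
    sg * (u - ue) * K (G t) (px ue sg u th) (py ue u th)) -> density K.
Proof.
  intros A B C. constructor; auto.
  intros U F RF. apply (Ck3_le 1 2 U _ (rf_open _ _ RF)); auto.
Qed.

Lemma density_area : density dens_area.
Proof.
  apply density_intro; [exact smooth_dens_area | |]; intros.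
  - apply (dens_ext 0); auto.
  - apply (dens_polar ue sg U G H 0); auto.
Qed.

Lemma density_normal : density dens_normal.
Proof.
  apply density_intro; [exact smooth_dens_normal | |]; intros.
  - apply (dens_ext 0); auto.
  - apply (dens_polar ue sg U G H 0); auto.
Qed.

Lemma density_helfrich co : density (dens_helfrich co).
Proof.
  apply density_intro; [intros U F RF; apply (smooth_dens_helfrich U F RF) | |]; intros.
  - apply (dens_ext co); auto.
  - apply (dens_polar ue sg U G H co); auto.
Qed.

Lemma density_defect co : density (dens_defect co).
Proof.
  apply density_intro; [intros U F RF; apply (smooth_dens_defect U F RF) | |]; intros.
  - apply (dens_ext co); auto.
  - apply (dens_polar ue sg U G H co); auto.
Qed.

(** What differentiation under the integral sign needs, as a property of germs. *)
Definition C1_time (f : R -> R -> R -> R) (t x y : R) : Prop :=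
  near3 (ex_D3 dirT f) t x y /\ near3 (cont3 f) t x y /\ cont3 (D3 dirT f) t x y.

Lemma C1_time_germ f g t u th :
  near3 (fun a b c => f a b c = g a b c) t u th -> C1_time f t u th -> C1_time g t u th.
Proof.
  intros H [A [B C]]. pose proof (near3_near3 _ _ _ _ H) as HH.
  split; [|split].
  - generalize (near3_and _ _ _ _ _ HH A). apply near3_imp. intros a b c [P Q].
    exact (ex_D3_ext_near dirT f g a b c P Q).
  - generalize (near3_and _ _ _ _ _ HH B). apply near3_imp. intros a b c [P Q].
    exact (cont3_ext_near f g a b c P Q).
  - apply (cont3_ext_near (D3 dirT f)); auto.
    revert HH. apply near3_imp. intros a b c P. exact (D3_ext_near dirT f g a b c P).
Qed.

Lemma Ck3_C1_time U f t x y : open3 U -> Ck3 1 U f -> U t x y -> C1_time f t x y.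
Proof.
  intros O H Hu. split; [|split].
  - generalize (O _ _ _ Hu). apply near3_imp. intros a b c Habc. exact (Ck3_ex_D 0 U f dirT a b c H Habc).
  - generalize (O _ _ _ Hu). apply near3_imp. intros a b c Habc. exact (Ck3_cont_pt 1 U f a b c O H Habc).
  - exact (Ck3_D 0 U f dirT H t x y Hu).
Qed.

Lemma pull_C1_time ue sg U f t u th : open3 U -> Ck3 1 U f ->
  U t (px ue sg u th) (py ue u th) ->
  C1_time (fun t u th => sg * (u - ue) * f t (px ue sg u th) (py ue u th)) t u th.
Proof.
  intros O H Hu. pose proof (pull_near ue sg U t u th (O _ _ _ Hu)) as N.
  assert (L : forall t u th, cont3 (fun _ u _ => sg * (u - ue)) t u th).
  { intros. apply cont3_mult. apply cont3_const. apply cont3_plus. apply cont3_x. apply cont3_const. }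
  split; [|split].
  - revert N. apply near3_imp. intros a b c Habc.
    exact (ex_derive_scal (fun s => f s (px ue sg b c) (py ue b c)) (sg * (b - ue)) a
      (Ck3_ex_D 0 U f dirT _ _ _ H Habc)).
  - revert N. apply near3_imp. intros a b c Habc. apply cont3_mult; auto.
    apply pull_cont. exact (Ck3_cont_pt 1 U f _ _ _ O H Habc).
  - apply (cont3_ext_near (fun t u th => sg * (u - ue) * D3 dirT f t (px ue sg u th) (py ue u th))).
    + revert N. apply near3_imp. intros a b c Habc. symmetry.
      exact (Derive_scal (fun s => f s (px ue sg b c) (py ue b c)) (sg * (b - ue)) a).
    + apply cont3_mult; auto. apply pull_cont. exact (Ck3_D 0 U f dirT H _ _ _ Hu).
Qed.

Lemma Derive_translate (f : R -> R) p x : Derive (fun s => f (s + p)) x = Derive f (x + p).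
Proof.
  unfold Derive. f_equal. apply Lim_ext. intros h.
  replace (x + h + p) with (x + p + h) by ring. reflexivity.
Qed.

Lemma vpd_translate (F : R -> R -> vec) p q x y :
  vpd1 (fun a b => F (a + p) (b + q)) x y = vpd1 F (x + p) (y + q) /\
  vpd2 (fun a b => F (a + p) (b + q)) x y = vpd2 F (x + p) (y + q).
Proof.
  split; apply vec_eq; cbn [vpd1 vpd2 cx cy cz]; unfold pd1, pd2.
  - apply (Derive_translate (fun s => cx (F s (y + q)))).
  - apply (Derive_translate (fun s => cy (F s (y + q)))).
  - apply (Derive_translate (fun s => cz (F s (y + q)))).
  - apply (Derive_translate (fun s => cx (F (x + p) s))).
  - apply (Derive_translate (fun s => cy (F (x + p) s))).
  - apply (Derive_translate (fun s => cz (F (x + p) s))).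
Qed.

Lemma translate_invariant (F : R -> R -> vec) p q x y :
  locally_2d (fun a b => F (a + p) (b + q) = F a b) x y ->
  vpd1 F (x + p) (y + q) = vpd1 F x y /\ vpd2 F (x + p) (y + q) = vpd2 F x y /\
  normal_vec F (x + p) (y + q) = normal_vec F x y /\
  unit_normal F (x + p) (y + q) = unit_normal F x y /\
  mean_curvature F (x + p) (y + q) = mean_curvature F x y.
Proof.
  intros H. set (G := fun a b => F (a + p) (b + q)) in *.
  assert (U : forall x y, unit_normal G x y = unit_normal F (x + p) (y + q)).
  { intros a b. unfold unit_normal, area_density, normal_vec.
    destruct (vpd_translate F p q a b) as [E1 E2]. fold G in E1, E2.
    rewrite E1, E2. reflexivity. }
  destruct (vpd_translate F p q x y) as [E1 E2]. fold G in E1, E2.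
  destruct (vpd_ext G F x y H) as [E3 E4].
  destruct (unit_normal_ext G F x y H) as [E5 [_ E6]].
  pose proof (mean_curvature_ext G F x y H) as E7.
  repeat split.
  - rewrite <- E1. exact E3.
  - rewrite <- E2. exact E4.
  - rewrite <- E5. unfold normal_vec. rewrite E1, E2. reflexivity.
  - rewrite <- U. exact E6.
  - rewrite <- E7. unfold mean_curvature at 2. rewrite E1, E2.
    destruct (vpd_translate (unit_normal F) p q x y) as [E8 E9]. 
    destruct (vpd_ext (unit_normal G) (fun a b => unit_normal F (a + p) (b + q)) x y) as [E10 E11].
    { apply locally_2d_forall. exact U. }
    rewrite E10, E11, E8, E9. reflexivity.
Qed.

Section Integrands.
Variables (S : surface) (eps : R) (Y : R -> R -> R -> vec).
Hypothesis SF : surface_family S eps Y.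

Lemma two_pi_pos : 0 < 2 * PI.
Proof. pose proof PI_RGT_0. lra. Qed.

Lemma ends_le : u0 S <= u1 S.
Proof. pose proof (u0_lt_u1 S). lra. Qed.

(** At a pole the continuation is the integrand of the polar chart times the
    Jacobian [sg * (u - ue)], which changes sign smoothly there. *)
Lemma density_extend K : density K -> exists kb,
  (forall t u th, u0 S < u < u1 S -> kb t u th = K (Y t) u th) /\
  (forall t u th, Rabs t < eps -> u0 S <= u <= u1 S -> C1_time kb t u th).
Proof.
  intros DK. destruct (local_rep_regular S eps Y SF) as [r [Hr RF]].
  destruct (extend_to_ends S eps C1_time (fun t => K (Y t))) as [kb [E1 E2]].
  - apply C1_time_germ.
  - intros t u th Ht Hd.
    apply (Ck3_C1_time (chart_open eps r Y (cylinder_chart S))).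
    + apply (rf_open _ _ (RF _ (in_cylinder S))).
    + apply (dn_smooth K DK _ _ (RF _ (in_cylinder S))).
    + apply (dom_chart_open S eps Y SF); auto. apply in_cylinder.
  - intros ue sg k P.
    exists (fun t u th => sg * (u - ue) * K (local_rep k (Y t)) (px ue sg u th) (py ue u th)).
    pose proof (RF _ (pc_in _ _ _ _ P)) as RFk. split.
    + intros t u th Ht Hu. pose proof (proj1 (pc_range _ _ _ _ P u) Hu) as Hp.
      rewrite (dn_local K DK _ _ _ _ (polar_rep_near S ue sg k (Y t) u th P (sf_wd _ _ _ SF t Ht) Hu)).
      symmetry. apply (dn_polar K DK ue sg _ (fun t => local_rep k (Y t)) t u th RFk).
      * apply (polar_open S eps Y SF); auto. lra.
      * lra.
    + intros t th Ht. apply (pull_C1_time ue sg (chart_open eps r Y k)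
        (fun t x y => K (local_rep k (Y t)) x y)).
      * apply (rf_open _ _ RFk).
      * apply (dn_smooth K DK _ _ RFk).
      * apply (polar_open S eps Y SF); auto. pose proof (len_pos S).
        replace (ue - ue) with 0 by ring. lra.
  - exists kb. split; auto. intros t u th Hu. apply E1; [apply cyl_dom_interior; auto | lra].
Qed.

Lemma time_derivative K : density K ->
  exists D, scont S D /\
    (forall u th, u0 S < u < u1 S -> D u th = D3 dirT (fun t => K (Y t)) 0 u th) /\
    is_derive (fun t => sint S (K (Y t))) 0 (sint S D).
Proof.
  intros DK. destruct (density_extend K DK) as [kb [E1 E2]].
  assert (Z : Rabs 0 < eps) by (rewrite Rabs_R0; apply (sf_eps _ _ _ SF)).
  exists (fun u th => D3 dirT kb 0 u th). split; [|split].
  - intros u th [Hu _]. apply cont3_2d. apply (E2 0 u th Z Hu).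
  - intros u th Hu. apply Derive_ext. intros t. apply E1. exact Hu.
  - apply is_derive_ext with (fun t => sint S (kb t)).
    + intros t. apply dint_ext; [apply ends_le | pose proof two_pi_pos; lra |].
      intros u th Hu _. apply E1. exact Hu.
    + apply is_derive_dint; [apply ends_le | pose proof two_pi_pos; lra |].
      intros u th [Hu _]. apply (E2 0 u th Z Hu).
Qed.

Lemma density_integrable K t : density K -> Rabs t < eps ->
  exists f, scont S f /\ (forall u th, u0 S < u < u1 S -> f u th = K (Y t) u th).
Proof.
  intros DK Ht. destruct (density_extend K DK) as [kb [E1 E2]].
  exists (kb t). split; auto. intros u th [Hu _]. apply cont3_2d.
  destruct (E2 t u th Ht Hu) as [_ [B _]]. exact (near3_pt _ _ _ _ B).
Qed.

End Integrands.

Section Flux.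
Variables (S : surface) (eps : R) (Y : R -> R -> R -> vec).
Hypothesis SF : surface_family S eps Y.
Variable r : R.
Hypothesis Hr : 0 < r.
Hypothesis RF : forall c, In c (charts S) ->
  regular_family (chart_open eps r Y c) (fun t => local_rep c (Y t)).

Variables al be ga : R.
Let W t := field_W al be ga (Y t).

Variable V : R -> R -> R -> vec.
Hypothesis V_smooth : forall c, In c (charts S) ->
  VCk3 1 (chart_open eps r Y c) (fun t => local_rep c (V t)).
Hypothesis V_period : forall t u th, Rabs t < eps -> in_surface S u ->
  V t u (th + 2 * PI) = V t u th.

Lemma smooth_triple U (F G H : R -> R -> R -> vec) k : open3 U ->
  VCk3 k U F -> VCk3 k U G -> VCk3 k U H ->
  Ck3 k U (fun t x y => dot (F t x y) (cross (G t x y) (H t x y))).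
Proof. intros O A B C. apply Ck3_dot; auto. apply VCk3_cross; auto. Qed.

Lemma smooth_W1 c : In c (charts S) ->
  VCk3 1 (chart_open eps r Y c) (fun t => field_W al be ga (local_rep c (Y t))).
Proof.
  intros Hc. pose proof (RF c Hc) as Rc.
  apply (VCk3_le _ (rf_open _ _ Rc) 1 2). lia. apply (smooth_W _ _ Rc).
Qed.

Lemma smooth_DV1 c e : In c (charts S) ->
  VCk3 1 (chart_open eps r Y c) (DV e (fun t => local_rep c (Y t))).
Proof.
  intros Hc. pose proof (RF c Hc) as Rc.
  apply (VCk3_le _ (rf_open _ _ Rc) 1 3). lia. apply VCk3_D. apply Rc.
Qed.

(** The flux through a parallel is a one-form evaluated on its tangent vector,
    hence continues to a pole with value zero. *)
Lemma flux_extend : exists P : R -> R -> R -> R,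
  (forall t u th, chart_dom (cylinder_chart S) u th -> u0 S <= u <= u1 S ->
     P t u th = flux1 (V t) (W t) (Y t) u th) /\
  (forall t u th, Rabs t < eps -> u0 S <= u <= u1 S -> cont3 P t u th /\
     (~ chart_dom (cylinder_chart S) u th -> P t u th = 0)).
Proof.
  apply (extend_to_ends S eps (fun f t u th => cont3 f t u th /\
     (~ chart_dom (cylinder_chart S) u th -> f t u th = 0))).
  - intros f g t u th H [A B]. split.
    + exact (cont3_ext_near f g t u th H A).
    + intros D. rewrite <- (near3_pt _ _ _ _ H). auto.
  - intros t u th Ht D. split; [|contradiction].
    pose proof (RF _ (in_cylinder S)) as Rc.
    apply (Ck3_cont_pt 1 (chart_open eps r Y (cylinder_chart S))
      (fun t u th => flux1 (V t) (W t) (Y t) u th)).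
    + apply Rc.
    + apply (smooth_triple _ V (DV dirY Y) W 1 (rf_open _ _ Rc)).
      * apply (V_smooth _ (in_cylinder S)).
      * apply (smooth_DV1 _ dirY (in_cylinder S)).
      * apply (smooth_W1 _ (in_cylinder S)).
    + apply (dom_chart_open S eps Y SF); auto. apply in_cylinder.
  - intros ue sg c P. pose proof (pc_in _ _ _ _ P) as Hc. pose proof (RF c Hc) as Rc.
    set (G := fun t => local_rep c (Y t)).
    set (f := fun e t x y => dot (local_rep c (V t) x y)
      (cross (DV e G t x y) (field_W al be ga (G t) x y))).
    assert (Sf : forall e, Ck3 1 (chart_open eps r Y c) (f e)).
    { intros e. apply smooth_triple; auto. apply Rc. apply (smooth_DV1 c e Hc).
      apply (smooth_W1 c Hc). }
    exists (fun t u th => (u - ue) * (- (sg * sin th) * f dirX t (px ue sg u th) (py ue u th) +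
      cos th * f dirY t (px ue sg u th) (py ue u th))).
    split.
    + intros t u th Ht Hu. pose proof (proj1 (pc_range _ _ _ _ P u) Hu) as Hp.
      assert (Ho : chart_open eps r Y c t (px ue sg u th) (py ue u th)).
      { apply (polar_open S eps Y SF); auto. lra. }
      pose proof (polar_rep_near S ue sg c (Y t) u th P (sf_wd _ _ _ SF t Ht) Hu) as L.
      unfold flux1.
      rewrite (polar_rep S ue sg c (V t) u th P) by
        (try lra; intros; apply V_period; auto; apply interior_in_surface; lra).
      destruct (vpd_ext _ _ _ _ L) as [_ E2]. rewrite E2.
      destruct (pull_DV ue sg _ G t u th (rf_open _ _ Rc)
        (VCk3_le _ (rf_open _ _ Rc) 1 4 _ ltac:(lia) (rf_smooth _ _ Rc)) Ho) as [_ E3].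
      unfold G in E3 at 1. rewrite E3.
      unfold W. rewrite (field_W_ext al be ga _ _ u th L).
      pose proof (W_polar ue sg _ G Rc al be ga t u th Ho (proj1 Hp)) as E4.
      unfold G in E4 at 1. rewrite E4.
      unfold f, dot, cross, vadd, vscal; cbn [cx cy cz]. ring.
    + intros t th Ht. split; [|intros _; ring].
      assert (Ho : chart_open eps r Y c t (px ue sg ue th) (py ue ue th)).
      { apply (polar_open S eps Y SF); auto. pose proof (len_pos S).
        replace (ue - ue) with 0 by ring. lra. }
      assert (Cf : forall e, cont3 (fun t u th => f e t (px ue sg u th) (py ue u th)) t ue th).
      { intros e. apply (pull_cont ue sg (f e)). apply (Ck3_cont_pt 1 (chart_open eps r Y c)); auto. apply Rc. }
      apply cont3_mult.
      { apply cont3_plus. apply cont3_x. apply cont3_const. }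
      apply cont3_plus; apply cont3_mult; auto.
      * apply cont3_opp. apply cont3_mult. apply cont3_const.
        apply (cont3_comp1 sin (fun _ _ c => c)). apply cont3_y. apply continuous_sin.
      * apply (cont3_comp1 cos (fun _ _ c => c)). apply cont3_y. apply continuous_cos.
Qed.

Lemma theta_period t u th : Rabs t < eps -> u0 S < u < u1 S ->
  locally_2d (fun a b => Y t (a + 0) (b + 2 * PI) = Y t a b) u th.
Proof.
  intros Ht Hu.
  generalize (near3_2d _ _ _ _ (interior_near S eps t u th Ht Hu)).
  apply locally_2d_impl. apply locally_2d_forall. intros p q [_ Hp].
  rewrite Rplus_0_r. apply (sf_wd _ _ _ SF t Ht). apply interior_in_surface. lra.
Qed.

(** Only the two ends contribute; there the flux is that of the continuation
    [P], since the coordinate formula means nothing at a pole. *)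
Lemma flux_theorem P D t : Rabs t < eps ->
  (forall t u th, chart_dom (cylinder_chart S) u th -> u0 S <= u <= u1 S ->
     P t u th = flux1 (V t) (W t) (Y t) u th) ->
  (forall t u th, Rabs t < eps -> u0 S <= u <= u1 S -> cont3 P t u th) ->
  scont S D ->
  (forall u th, u0 S < u < u1 S ->
     D u th = D3 dirX (fun t => flux1 (V t) (W t) (Y t)) t u th +
              D3 dirY (fun t => flux2 (V t) (W t) (Y t)) t u th) ->
  sint S D =
  RInt (fun th => P t (u1 S) th) 0 (2 * PI) - RInt (fun th => P t (u0 S) th) 0 (2 * PI).
Proof.
  intros Ht E1 E2 CD ED.
  pose proof (RF _ (in_cylinder S)) as Rc. pose proof (rf_open _ _ Rc) as O.
  set (U := chart_open eps r Y (cylinder_chart S)) in *.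
  assert (S1 : Ck3 1 U (fun t => flux1 (V t) (W t) (Y t))).
  { apply (smooth_triple _ V (DV dirY Y) W 1 O).
    - apply (V_smooth _ (in_cylinder S)).
    - apply (smooth_DV1 _ dirY (in_cylinder S)).
    - apply (smooth_W1 _ (in_cylinder S)). }
  assert (S2 : Ck3 1 U (fun t => flux2 (V t) (W t) (Y t))).
  { apply (smooth_triple _ V W (DV dirX Y) 1 O).
    - apply (V_smooth _ (in_cylinder S)).
    - apply (smooth_W1 _ (in_cylinder S)).
    - apply (smooth_DV1 _ dirX (in_cylinder S)). }
  apply (dint_divergence _ _ _ _ (ends_le S) (Rlt_le _ _ two_pi_pos) (P t)
    (D3 dirX (fun t => flux1 (V t) (W t) (Y t)) t) (flux2 (V t) (W t) (Y t))
    (D3 dirY (fun t => flux2 (V t) (W t) (Y t)) t)).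
  - intros u th [Hu _]. apply (cont3_2d P). apply E2; auto.
  - exact CD.
  - intros u th Hu.
    assert (HU : U t u th) by (apply (interior_open S eps Y SF); auto).
    split; [|split; [|split; [|split]]].
    + apply (is_derive_ext_loc (fun s : R => flux1 (V t) (W t) (Y t) s th)).
      * pose proof (proj1 (proj2 (near3_slices _ _ _ _ (interior_near S eps t u th Ht Hu)))) as L.
        revert L. apply filter_imp. intros s [_ Hs]. symmetry. apply E1.
        apply cyl_dom_interior; auto. lra.
      * apply Derive_correct. exact (Ck3_ex_D 0 U _ dirX t u th S1 HU).
    + apply (cont3_2d (D3 dirX (fun t => flux1 (V t) (W t) (Y t)))).
      exact (Ck3_D 0 U _ dirX S1 t u th HU).
    + apply Derive_correct. exact (Ck3_ex_D 0 U _ dirY t u th S2 HU).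
    + apply (cont3_2d (D3 dirY (fun t => flux2 (V t) (W t) (Y t)))).
      exact (Ck3_D 0 U _ dirY S2 t u th HU).
    + apply ED. exact Hu.
  - intros u Hu.
    destruct (translate_invariant (Y t) 0 (2 * PI) u 0 (theta_period t u 0 Ht Hu))
      as [I1 [_ [_ [I2 _]]]].
    rewrite Rplus_0_r, Rplus_0_l in I1, I2.
    assert (Hi : in_surface S u) by (apply interior_in_surface; lra).
    pose proof (proj1 (sf_wd _ _ _ SF t Ht) u 0 Hi) as I3.
    pose proof (V_period t u 0 Ht Hi) as I4. rewrite Rplus_0_l in I3, I4.
    unfold flux2, W, field_W. rewrite I1, I2, I3, I4. reflexivity.
Qed.

Lemma flux_loop t th : Rabs t < eps -> shape S = Loop ->
  V t (u0 S + len S) th = V t (u0 S) th ->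
  flux1 (V t) (W t) (Y t) (u1 S) th = flux1 (V t) (W t) (Y t) (u0 S) th.
Proof.
  intros Ht Sh HV.
  pose proof (proj2 (sf_wd _ _ _ SF t Ht)) as Per. rewrite Sh in Per.
  fold (len S) in Per.
  destruct (translate_invariant (Y t) (len S) 0 (u0 S) th) as [_ [I1 [_ [I2 _]]]].
  { apply locally_2d_forall. intros p q. rewrite Rplus_0_r. apply Per. }
  rewrite Rplus_0_r in I1, I2.
  assert (E : u0 S + len S = u1 S) by (unfold len; ring).
  pose proof (Per (u0 S) th) as I3. rewrite E in *.
  unfold flux1, W, field_W. rewrite I1, I2, I3, HV. reflexivity.
Qed.
End Flux.

(** * First variations *)

Lemma cylinder_or_pole S u : u0 S <= u <= u1 S ->
  (forall th, chart_dom (cylinder_chart S) u th) \/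
  exists sg c, polar_chart S u sg c /\ forall th, ~ chart_dom (cylinder_chart S) u th.
Proof.
  intros Hu. destruct (shape S) as [e0 e1|] eqn:Sh.
  - destruct (Req_dec u (u0 S)) as [->|N0]; [|destruct (Req_dec u (u1 S)) as [->|N1]].
    + destruct e0.
      * left. intros th. cbn. rewrite Sh. pose proof (u0_lt_u1 S). destruct e1; lra.
      * right. exists 1, (pole0_chart S). split. apply (pole0_polar S e1 Sh).
        intros th. cbn. rewrite Sh. lra.
    + destruct e1.
      * left. intros th. cbn. rewrite Sh. pose proof (u0_lt_u1 S). destruct e0; lra.
      * right. exists (-1), (pole1_chart S). split. apply (pole1_polar S e0 Sh).
        intros th. cbn. rewrite Sh. lra.
    + left. intros th. apply cyl_dom_interior. lra.
  - left. intros th. cbn. rewrite Sh. exact I.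
Qed.

Lemma polar_rep_closed S ue sg c Z u th : polar_chart S ue sg c -> well_defined S Z ->
  u0 S <= u <= u1 S -> Z u th = local_rep c Z (px ue sg u th) (py ue u th).
Proof.
  intros P W Hu. destruct (Req_dec u ue) as [->|N].
  - assert (E : ue + sg * radius (px ue sg ue th) (py ue ue th) = ue).
    { rewrite (polar_radius S ue sg c); auto; [ring | lra]. }
    unfold local_rep. rewrite (pc_param _ _ _ _ P). cbn [fst snd].
    rewrite E, (pc_constant _ _ _ _ P Z W th). symmetry. apply (pc_constant _ _ _ _ P Z W).
  - apply (polar_rep S); auto.
    + pose proof (pc_side _ _ _ _ P u Hu) as Q. destruct Q as [Q|Q]; auto. exfalso.
      apply N. assert (Z0 : sg * (sg * (u - ue)) = 0) by (rewrite <- Q; ring).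
      rewrite <- Rmult_assoc, (pc_sg _ _ _ _ P) in Z0. lra.
    + intros th'. apply (proj1 W). apply interior_in_surface. exact Hu.
Qed.

Lemma wd_period S Z u th k : well_defined S Z -> in_surface S u ->
  Z u (th + IZR k * (2 * PI)) = Z u th.
Proof.
  intros W Hu. apply (shift_period (fun th => Z u th)). intros x. apply W. exact Hu.
Qed.

Lemma fundamental S u th : in_surface S u -> exists u' th',
  rect (u0 S) (u1 S) 0 (2 * PI) u' th' /\
  forall Z, well_defined S Z -> Z u th = Z u' th'.
Proof.
  intros Hu. destruct (shift_into (2 * PI) 0 th two_pi_pos) as [k Hk].
  rewrite Rplus_0_l in Hk.
  destruct (shape S) as [e0 e1|] eqn:Sh.
  - exists u, (th + IZR k * (2 * PI)). split.
    + split; auto. unfold in_surface in Hu. rewrite Sh in Hu. exact Hu.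
    + intros Z W. symmetry. apply (wd_period S); auto.
  - destruct (shift_into (len S) (u0 S) u (len_pos S)) as [m Hm].
    exists (u + IZR m * len S), (th + IZR k * (2 * PI)). split.
    + split; auto. unfold len in *. lra.
    + intros Z W. rewrite (wd_period S); auto.
      * symmetry. apply (shift_period (fun u => Z u th)). intros x.
        pose proof (proj2 W) as Per. rewrite Sh in Per. apply Per.
      * unfold in_surface. rewrite Sh. exact I.
Qed.

Section Variations.
Variables (S : surface) (co : R) (X : R -> R -> vec).
Hypothesis zX : forall u th, in_surface S u -> cz (X u th) <> 0.

(** Compactness keeps the varied surfaces off the plane z = 0 for a short time. *)
Lemma variation_family eps Y : variation S X eps Y ->
  exists eps1, eps1 <= eps /\ surface_family S eps1 Y.
Proof.
  intros [He [Sm [WR E0]]]. destruct Sm as [d [Hd Sm]].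
  assert (Z0 : Rabs 0 < eps) by (rewrite Rabs_R0; auto).
  destruct (tube (u0 S) (u1 S) 0 (2 * PI) (fun t u th => u0 S <= u <= u1 S ->
    cz (Y t u th) <> 0)) as [q Hq].
  { intros u th [Hu _].
    assert (K : forall c x y, In c (charts S) -> chart_dom c x y ->
       cz (local_rep c (Y 0) x y) <> 0 ->
       near3 (fun t x y => cz (local_rep c (Y t) x y) <> 0) 0 x y).
    { intros c x y Hc Hd' Hz. specialize (Sm c Hc). cbv zeta in Sm.
      apply (cont3_neq0 (fun t x y => cz (local_rep c (Y t) x y))); auto.
      apply (Ck3_cont_pt 4 (fun t x y => Rabs t < eps /\ chart_nbhd c d x y)).
      - apply (time_nbhd_open S eps c d Hc).
      - apply Sm.
      - split; auto. apply (dom_nbhd S); auto. }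
    destruct (cylinder_or_pole S u Hu) as [D|[sg [c [P _]]]].
    - generalize (K (cylinder_chart S) u th (in_cylinder S) (D th)).
      unfold local_rep; cbn [to_param cylinder_chart fst snd]. intros K1.
      assert (H0 : cz (Y 0 u th) <> 0).
      { rewrite E0. apply zX. all: apply interior_in_surface; auto. }
      generalize (K1 H0). apply near3_imp. auto.
    - assert (R0 : u0 S <= u <= u1 S -> Y 0 u th = local_rep c (Y 0) (px u sg u th) (py u u th)).
      { intros _. apply (polar_rep_closed S u sg c); auto. apply WR; auto. }
      assert (D : chart_dom c (px u sg u th) (py u u th)).
      { apply (pc_dom _ _ _ _ P). rewrite (polar_radius S u sg c); auto; pose proof (len_pos S); 
        replace (sg * (u - u)) with 0 by ring; lra. }
      assert (H0 : cz (local_rep c (Y 0) (px u sg u th) (py u u th)) <> 0).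
      { rewrite <- R0 by auto. rewrite E0. apply zX. all: apply interior_in_surface; auto. }
      pose proof (K c _ _ (pc_in _ _ _ _ P) D H0) as K1.
      apply (pull_near u sg (fun t x y => cz (local_rep c (Y t) x y) <> 0)) in K1.
      generalize (near3_and _ _ _ _ _ (time_open eps 0 u th Z0) K1). apply near3_imp.
      intros t u' th' [Ht Hz] Hu'.
      rewrite (polar_rep_closed S u sg c (Y t) u' th' P); auto. apply WR; auto. }
  exists (Rmin eps q). split. apply Rmin_l.
  assert (L : forall t, Rabs t < Rmin eps q -> Rabs t < eps /\ Rabs t < q).
  { intros t Ht. pose proof (Rmin_l eps q). pose proof (Rmin_r eps q). lra. }
  constructor.
  - apply Rmin_glb_lt; auto. apply q.
  - exists d. split; auto. intros c Hc. specialize (Sm c Hc). cbv zeta in *.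
    refine (VCk3_sub 4 _ _ (fun t => local_rep c (Y t)) _ Sm).
    intros t x y [Ht Hn]. split; auto. apply L; auto.
  - intros t Ht. apply WR. apply L; auto.
  - intros t Ht. apply WR. apply L; auto.
  - intros t u th Ht Hu. destruct (L t Ht) as [H1 H2].
    destruct (fundamental S u th Hu) as [u' [th' [[Hu' Hth'] E]]].
    rewrite (E (Y t)). apply Hq; auto. split; auto. apply WR; auto.
Qed.
End Variations.

Lemma G_energy_dint S co Z : G_energy S co Z =
  sint S (dens_area Z) + 2 * co * sint S (dens_normal Z).
Proof. reflexivity. Qed.

Lemma helfrich_energy_dint S co Z :
  helfrich_energy S co Z = sint S (dens_helfrich co Z).
Proof. reflexivity. Qed.

Lemma end_on_boundary S e0 e1 u th : shape S = Arc e0 e1 -> u = u0 S \/ u = u1 S ->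
  chart_dom (cylinder_chart S) u th -> on_boundary S u.
Proof.
  intros Sh Hu D. cbn in D. unfold on_boundary. rewrite Sh in *.
  destruct e0, e1, Hu; subst; auto; lra.
Qed.

Lemma dint_zero S f : (forall u th, u0 S < u < u1 S -> f u th = 0) ->
  sint S f = 0.
Proof.
  intros H. rewrite (dint_ext _ _ _ _ (ends_le S) (Rlt_le _ _ two_pi_pos) f (fun _ _ => 0)) by auto.
  unfold dint. rewrite (RInt_ext (V := R_CompleteNormedModule) _ (fun _ => 0)).
  - rewrite RInt_const. apply Rmult_0_r.
  - intros x _. rewrite RInt_const. apply Rmult_0_r.
Qed.

Section Derivatives.
Variables (S : surface) (eps : R) (Y : R -> R -> R -> vec).
Hypothesis SF : surface_family S eps Y.
Variable co : R.

Let zero_time : Rabs 0 < eps.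
Proof. rewrite Rabs_R0. apply (sf_eps _ _ _ SF). Qed.

Lemma velocity_period t u u' th th' : Rabs t < eps ->
  (forall s, Rabs s < eps -> Y s u th = Y s u' th') ->
  DV dirT Y t u th = DV dirT Y t u' th'.
Proof.
  intros Ht H.
  assert (L : forall f : vec -> R, locally t (fun s => f (Y s u th) = f (Y s u' th'))).
  { intros f. generalize (time_near eps t Ht). apply filter_imp.
    intros s Hs. rewrite H; auto. }
  apply vec_eq; apply Derive_ext_loc; apply L.
Qed.

(** The divergence in [first_variation_G] integrates to zero: at a boundary
    circle the velocity vanishes, at a pole the flux does, and on a torus the
    two ends cancel. *)
Lemma G_derivative M :
  (forall u th, on_boundary S u -> DV dirT Y 0 u th = vzero) ->
  scont S M ->
  (forall u th, u0 S < u < u1 S -> M u th =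
     - (2 / cz (Y 0 u th) ^ 2 * defect co (Y 0) u th *
        dot (DV dirT Y 0 u th) (normal_vec (Y 0) u th))) ->
  is_derive (fun t => G_energy S co (Y t)) 0 (sint S M).
Proof.
  intros V0 CM EM.
  destruct (time_derivative S eps Y SF dens_area density_area) as [D1 [C1 [H1 I1]]].
  destruct (time_derivative S eps Y SF dens_normal density_normal) as [D2 [C2 [H2 I2]]].
  destruct (local_rep_regular S eps Y SF) as [r [Hr RF]].
  set (V := DV dirT Y).
  assert (SV : forall c, In c (charts S) ->
    VCk3 1 (chart_open eps r Y c) (fun t => local_rep c (V t))).
  { intros c Hc. apply (VCk3_le _ (rf_open _ _ (RF c Hc)) 1 3). lia.
    apply (VCk3_D _ 3 (fun t => local_rep c (Y t)) dirT). apply (RF c Hc). }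
  assert (PV : forall t u th, Rabs t < eps -> in_surface S u -> V t u (th + 2 * PI) = V t u th).
  { intros t u th Ht Hu. apply velocity_period; auto.
    intros s Hs. apply (sf_wd _ _ _ SF s Hs). exact Hu. }
  destruct (flux_extend S eps Y SF r Hr RF 0 1 (2 * co) V SV PV) as [P [P1 P2]].
  assert (CD : scont S
    (fun u th => (D1 u th + 2 * co * D2 u th) + (-1) * M u th)).
  { apply cont_rect_lin; auto. apply cont_rect_lin; auto. }
  assert (FT := flux_theorem S eps Y SF r Hr RF 0 1 (2 * co) V SV PV P
    (fun u th => (D1 u th + 2 * co * D2 u th) + (-1) * M u th) 0 zero_time P1
    (fun t u th Ht Hu => proj1 (P2 t u th Ht Hu)) CD).
  assert (Ends : forall th, P 0 (u1 S) th = P 0 (u0 S) th).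
  { intros th. pose proof (u0_lt_u1 S) as L.
    destruct (shape S) as [e0 e1|] eqn:Sh.
    - assert (K : forall u, u = u0 S \/ u = u1 S -> P 0 u th = 0).
      { intros u Hu. assert (Hu' : u0 S <= u <= u1 S) by (destruct Hu; lra).
        destruct (cylinder_or_pole S u Hu') as [D|[sg [c [_ D]]]].
        - rewrite P1; auto. unfold flux1, V.
          rewrite V0 by (apply (end_on_boundary S e0 e1 u th); auto).
          unfold dot, vzero; cbn. ring.
        - apply P2; auto. }
      rewrite !K; auto.
    - assert (Dom : forall u, chart_dom (cylinder_chart S) u th) by (intros; cbn; rewrite Sh; exact I).
      rewrite !P1; auto; try lra.
      apply (flux_loop S eps Y SF 0 1 (2 * co) V); auto.
      apply velocity_period; auto. intros s Hs.
      pose proof (proj2 (sf_wd _ _ _ SF s Hs)) as Per. rewrite Sh in Per. apply Per. }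
  assert (E : sint S D1 + 2 * co * sint S D2
    = sint S M).
  { pose proof (ends_le S) as AB. pose proof (Rlt_le _ _ two_pi_pos) as TP.
    rewrite dint_lin in FT; auto; [|apply cont_rect_lin; auto].
    rewrite dint_lin in FT; auto.
    assert (Z : RInt (fun th => P 0 (u1 S) th) 0 (2 * PI) = RInt (fun th => P 0 (u0 S) th) 0 (2 * PI)).
    { apply RInt_ext. intros th _. apply Ends. }
    rewrite Z in FT. rewrite Rminus_diag in FT.
    apply Rminus_diag_uniq.
    transitivity (sint S D1 + 2 * co * sint S D2
      + (-1) * sint S M).
    - ring.
    - apply FT. intros u th Hu. rewrite H1, H2, EM by auto.
      pose proof (first_variation_G _ _ (RF _ (in_cylinder S)) co 0 u th
        (interior_open S eps Y SF r 0 u th Hr zero_time Hu)) as FV.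
      change (D3 dirT (fun t => dens_area (Y t)) 0 u th + 2 * co * D3 dirT (fun t => dens_normal (Y t)) 0 u th =
        (D3 dirX (fun t => flux1 (V t) (field_W 0 1 (2 * co) (Y t)) (Y t)) 0 u th +
         D3 dirY (fun t => flux2 (V t) (field_W 0 1 (2 * co) (Y t)) (Y t)) 0 u th)
        - 2 / cz (Y 0 u th) ^ 2 * defect co (Y 0) u th *
          dot (V 0 u th) (normal_vec (Y 0) u th)) in FV.
      rewrite FV. unfold V. ring. }
  rewrite <- E.
  apply (is_derive_plus (fun t => sint S (dens_area (Y t)))).
  - exact I1.
  - apply (is_derive_scal (fun t => sint S (dens_normal (Y t)))). exact I2.
Qed.

(** A square has derivative zero where it vanishes. *)
Lemma defect_energy_derivative :
  (forall u th, u0 S < u < u1 S -> defect co (Y 0) u th = 0) ->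
  is_derive (fun t => sint S (dens_defect co (Y t))) 0 0.
Proof.
  intros H0.
  destruct (time_derivative S eps Y SF (dens_defect co) (density_defect co)) as [D [_ [H1 I1]]].
  rewrite (dint_zero S D) in I1; auto.
  intros u th Hu. rewrite H1 by auto.
  destruct (local_rep_regular S eps Y SF) as [r [Hr RF]].
  pose proof (RF _ (in_cylinder S)) as Rc.
  pose proof (interior_open S eps Y SF r 0 u th Hr zero_time Hu) as HU.
  pose proof (Ck3_ex_D 1 _ _ dirT 0 u th (smooth_defect _ _ Rc co) HU) as Ed.
  pose proof (Ck3_ex_D 2 _ _ dirT 0 u th (smooth_A _ _ Rc) HU) as Ea.
  change (ex_D3 dirT (fun t => defect co (Y t)) 0 u th) in Ed.
  change (ex_D3 dirT (fun t => area_density (Y t)) 0 u th) in Ea.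
  assert (I2 : is_derive (fun x : R => x ^ 2) (defect co (Y 0) u th) 0).
  { rewrite H0 by auto. auto_derive; auto. ring. }
  destruct (D3_comp dirT (fun x => x ^ 2) _ 0 u th Ed (ex_intro _ _ I2)) as [Es Q1].
  destruct (D3_mult dirT _ _ 0 u th Es Ea) as [_ Q2].
  assert (Q3 : D3 dirT (fun t u th => defect co (Y t) u th ^ 2) 0 u th = 0).
  { etransitivity. exact Q1.
    transitivity (D3 dirT (fun t => defect co (Y t)) 0 u th * 0); [|ring].
    apply (f_equal (Rmult _)). exact (is_derive_unique _ _ _ I2). }
  etransitivity. exact Q2. cbv beta in *. rewrite H0 by auto.
  replace (D3 dirT _ 0 u th) with 0 by (symmetry; exact Q3). ring.
Qed.

(** [C] is the flux of [grad z / z] through the boundary.  It only depends on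
    the surface near the boundary, where a variation with compact support does
    not change it. *)
Lemma helfrich_identity eta : 0 < eta ->
  (forall t u th, Rabs t < eps -> in_surface S u -> near_boundary S eta u ->
     Y t u th = Y 0 u th) ->
  exists C, forall t, Rabs t < eps ->
    helfrich_energy S co (Y t) =
    sint S (dens_defect co (Y t)) - G_energy S co (Y t) - C.
Proof.
  intros Heta Sup.
  destruct (local_rep_regular S eps Y SF) as [r [Hr RF]].
  pose (V := fun _ _ _ : R => E3).
  assert (SV : forall c, In c (charts S) ->
    VCk3 1 (chart_open eps r Y c) (fun t => local_rep c (V t))).
  { intros c Hc. apply (VCk3_const _ (rf_open _ _ (RF c Hc)) 1 E3). }
  assert (PV : forall t u th, Rabs t < eps -> in_surface S u -> V t u (th + 2 * PI) = V t u th).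
  { reflexivity. }
  destruct (flux_extend S eps Y SF r Hr RF 1 0 0 V SV PV) as [P [P1 P2]].
  pose proof (u0_lt_u1 S) as L.
  assert (Ends : forall t th, Rabs t < eps ->
    P t (u1 S) th - P t (u0 S) th = P 0 (u1 S) th - P 0 (u0 S) th).
  { intros t th Ht. destruct (shape S) as [e0 e1|] eqn:Sh.
    - assert (K : forall u a b, (u = u0 S \/ u = u1 S) -> a < b -> a <= u <= b ->
         u0 S <= a -> b <= u1 S ->
         (chart_dom (cylinder_chart S) u th -> forall v, a < v < b -> near_boundary S eta v) ->
         P t u th = P 0 u th).
      { intros u a b Hu Hab Hu' Ha Hb NB.
        assert (Hus : u0 S <= u <= u1 S) by lra.
        destruct (cylinder_or_pole S u Hus) as [D|[sg [c [_ D]]]].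
        - apply Rminus_diag_uniq.
          apply (zero_closure a b (th - 1) (th + 1) (fun u th => P t u th - P 0 u th) u th); auto; try lra.
          + split; lra.
          + apply continuity_2d_pt_minus; apply (cont3_2d P); apply P2; auto.
          + intros v w Hv _. assert (Hv' : u0 S < v < u1 S) by lra.
            rewrite !P1; auto; try lra; try (apply cyl_dom_interior; lra).
            assert (Lv : locally_2d (fun p q => Y t p q = Y 0 p q) v w).
            { assert (Lab : locally_2d (fun p _ => a < p < b) v w).
              { assert (La : 0 < Rmin (v - a) (b - v)) by (apply Rmin_glb_lt; lra).
                exists (mkposreal _ La). cbn. intros p q Hp _.
                pose proof (Rmin_l (v - a) (b - v)). pose proof (Rmin_r (v - a) (b - v)).
                apply Rabs_def2 in Hp. lra. }
              revert Lab. apply locally_2d_impl. apply locally_2d_forall. intros p q Hp.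
              apply Sup; auto. apply interior_in_surface; lra. }
            unfold flux1, V. rewrite (field_W_ext 1 0 0 _ _ v w Lv).
            destruct (vpd_ext _ _ _ _ Lv) as [_ E2]. rewrite E2. ring.
        - rewrite (proj2 (P2 t u th Ht Hus)), (proj2 (P2 0 u th zero_time Hus)); auto. }
      set (h := Rmin eta (u1 S - u0 S)).
      assert (h0 : 0 < h) by (apply Rmin_glb_lt; lra).
      assert (h1 : h <= eta) by apply Rmin_l. assert (h2 : h <= u1 S - u0 S) by apply Rmin_r.
      rewrite (K (u0 S) (u0 S) (u0 S + h)), (K (u1 S) (u1 S - h) (u1 S)); auto; try lra.
      + intros D v Hv. unfold near_boundary. rewrite Sh. right.
        cbn in D. rewrite Sh in D. destruct e1; [split; auto; lra | destruct e0; lra].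
      + intros D v Hv. unfold near_boundary. rewrite Sh. left.
        cbn in D. rewrite Sh in D. destruct e0; [split; auto; lra | destruct e1; lra].
    - assert (Dom : forall u, chart_dom (cylinder_chart S) u th) by (intros; cbn; rewrite Sh; exact I).
      rewrite !P1; auto; try lra.
      rewrite (flux_loop S eps Y SF 1 0 0 V t th), (flux_loop S eps Y SF 1 0 0 V 0 th); auto. ring. }
  exists (RInt (fun th => P 0 (u1 S) th) 0 (2 * PI) - RInt (fun th => P 0 (u0 S) th) 0 (2 * PI)).
  intros t Ht. pose proof (ends_le S) as AB. pose proof (Rlt_le _ _ two_pi_pos) as TP.
  assert (IP : forall s u, Rabs s < eps -> u0 S <= u <= u1 S ->
    ex_RInt (fun th => P s u th) 0 (2 * PI)).
  { intros s u Hs Hu. apply ex_RInt_cont.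
    intros th _. apply (continuity_2d_slice (P s)). apply (cont3_2d P). apply P2; auto. }
  assert (EP : RInt (fun th => P t (u1 S) th) 0 (2 * PI) - RInt (fun th => P t (u0 S) th) 0 (2 * PI)
    = RInt (fun th => P 0 (u1 S) th) 0 (2 * PI) - RInt (fun th => P 0 (u0 S) th) 0 (2 * PI)).
  { assert (B1 : u0 S <= u1 S <= u1 S) by lra. assert (B0 : u0 S <= u0 S <= u1 S) by lra.
    transitivity (RInt (fun th => P t (u1 S) th - P t (u0 S) th) 0 (2 * PI)).
    - symmetry. exact (RInt_minus _ _ _ _ (IP t _ Ht B1) (IP t _ Ht B0)).
    - transitivity (RInt (fun th => P 0 (u1 S) th - P 0 (u0 S) th) 0 (2 * PI)).
      + apply RInt_ext. intros th _. apply Ends. exact Ht.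
      + exact (RInt_minus _ _ _ _ (IP 0 _ zero_time B1) (IP 0 _ zero_time B0)). }
  rewrite <- EP.
  destruct (density_integrable S eps Y SF _ t density_area Ht) as [f1 [C1 Q1]].
  destruct (density_integrable S eps Y SF _ t density_normal Ht) as [f2 [C2 Q2]].
  destruct (density_integrable S eps Y SF _ t (density_helfrich co) Ht) as [fH [CH QH]].
  destruct (density_integrable S eps Y SF _ t (density_defect co) Ht) as [fD [CD QD]].
  set (D := fun u th => ((fD u th + (-1) * f1 u th) + (- (2 * co)) * f2 u th) + (-1) * fH u th).
  assert (CDD : scont S D).
  { unfold D. repeat apply cont_rect_lin; auto. }
  rewrite <- (flux_theorem S eps Y SF r Hr RF 1 0 0 V SV PV P D t Ht P1
    (fun t u th Ht Hu => proj1 (P2 t u th Ht Hu)) CDD).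
  - rewrite helfrich_energy_dint, G_energy_dint. unfold D.
    rewrite !dint_lin; auto; repeat apply cont_rect_lin; auto.
    rewrite (dint_ext _ _ _ _ AB TP fD (dens_defect co (Y t))), (dint_ext _ _ _ _ AB TP f1 (dens_area (Y t))),
     (dint_ext _ _ _ _ AB TP f2 (dens_normal (Y t))), (dint_ext _ _ _ _ AB TP fH (dens_helfrich co (Y t))); auto.
    ring.
  - intros u th Hu. unfold D. rewrite Q1, Q2, QH, QD by auto.
    pose proof (helfrich_density_identity _ _ (RF _ (in_cylinder S)) co t u th
      (interior_open S eps Y SF r t u th Hr Ht Hu)) as HI.
    change (dens_helfrich co (Y t) u th = dens_defect co (Y t) u th -
      (dens_area (Y t) u th + 2 * co * dens_normal (Y t) u th) -
      (D3 dirX (fun t => flux1 (V t) (field_W 1 0 0 (Y t)) (Y t)) t u th +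
       D3 dirY (fun t => flux2 (V t) (field_W 1 0 0 (Y t)) (Y t)) t u th)) in HI.
    rewrite HI. ring.
Qed.
End Derivatives.

Section Critical.
Variables (S : surface) (co : R) (X : R -> R -> vec).
Hypothesis zX : forall u th, in_surface S u -> cz (X u th) <> 0.
Hypothesis RME : reduced_membrane_equation S co X.

Lemma defect_zero Z : (forall u th, in_surface S u -> Z u th = X u th) ->
  forall u th, u0 S < u < u1 S -> defect co Z u th = 0.
Proof.
  intros E u th Hu.
  assert (L : locally_2d (fun a b => Z a b = X a b) u th).
  { generalize (interior_2d S u th Hu). apply locally_2d_impl. apply locally_2d_forall.
    intros p q Hp. apply E. apply interior_in_surface. lra. }
  destruct (dens_ext co Z X u th L) as [_ [_ [_ [_ E']]]]. rewrite E'.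
  pose proof (RME _ (in_cylinder S) u th (cyl_dom_interior S u th Hu)) as K.
  change (mean_curvature X u th + co = - (cz (unit_normal X u th) / cz (X u th))) in K.
  unfold defect. rewrite K. ring.
Qed.

Lemma membrane_G_critical : G_critical S co X.
Proof.
  intros eps Y Var Van.
  destruct (variation_family S X zX eps Y Var) as [eps1 [Le SF]].
  destruct Var as [He [_ [_ E0]]].
  pose proof (defect_zero (Y 0) E0) as D0.
  rewrite <- (dint_zero S (fun _ _ => 0)) at 2 by auto.
  apply (G_derivative S eps1 Y SF co).
  - intros u th Hb.
    assert (L : forall f : vec -> R, Derive (fun s => f (Y s u th)) 0 = 0).
    { intros f. rewrite (Derive_ext_loc _ (fun _ => f (X u th))). apply Derive_const.
      assert (Z : Rabs 0 < eps) by (rewrite Rabs_R0; auto).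
      generalize (time_near eps 0 Z). apply filter_imp. intros s Hs. rewrite Van; auto. }
    apply vec_eq; apply L.
  - intros u th _. apply continuity_2d_pt_const.
  - intros u th Hu. rewrite D0 by auto. ring.
Qed.

(** By [helfrich_identity] the Helfrich energy is a stationary quantity minus [G]
    minus a constant, so its first variation is that of [- G]. *)
Lemma membrane_helfrich_critical : helfrich_critical S co X.
Proof.
  intros eps Y Var [eta [Heta Sup]].
  destruct (variation_family S X zX eps Y Var) as [eps1 [Le SF]].
  assert (Van : vanishes_on_boundary S X eps Y).
  { intros t u th Ht Hb. apply Sup; auto.
    - pose proof (u0_lt_u1 S). unfold on_boundary in Hb. unfold in_surface.
      destruct (shape S); auto. lra.
    - unfold on_boundary in Hb. unfold near_boundary. destruct (shape S); auto.
      destruct Hb as [[? ?]|[? ?]]; [left|right]; split; auto; lra. }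
  pose proof (membrane_G_critical eps Y Var Van) as GC.
  destruct Var as [He [_ [_ E0]]].
  destruct (helfrich_identity S eps1 Y SF co eta Heta) as [C HC].
  { intros t u th Ht Hu Hn. rewrite E0 by auto. apply Sup; auto. lra. }
  apply (is_derive_ext_loc (fun t =>
    sint S (dens_defect co (Y t)) - G_energy S co (Y t) - C)).
  - assert (Z : Rabs 0 < eps1) by (rewrite Rabs_R0; apply (sf_eps _ _ _ SF)).
    generalize (time_near eps1 0 Z). apply filter_imp. intros t Ht. symmetry. auto.
  - replace 0 with (minus (minus 0 0) 0) at 2 by (unfold minus, plus, opp; cbn; ring).
    apply (is_derive_minus (fun t => sint S (dens_defect co (Y t)) -
      G_energy S co (Y t))).
    + apply (is_derive_minus (fun t => sint S (dens_defect co (Y t)))).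
      * apply (defect_energy_derivative S eps1 Y SF). apply defect_zero. exact E0.
      * exact GC.
    + apply (is_derive_const (V := R_NormedModule)).
Qed.
End Critical.

(** * Periodic bump functions *)

Definition pospart (x : R) : R := Rmax 0 x.

Lemma pospart_ge x : 0 <= pospart x.
Proof. apply Rmax_l. Qed.

Lemma is_derive_pospart_pow c n x :
  is_derive (fun x => c * pospart x ^ S (S n)) x (c * INR (S (S n)) * pospart x ^ S n).
Proof.
  destruct (Rtotal_order x 0) as [H|[H|H]].
  - apply (is_derive_ext_loc (fun _ : R => 0)).
    + generalize (open_lt 0 x H). apply filter_imp. intros y Hy.
      unfold pospart. rewrite Rmax_left by lra. cbn. ring.
    + unfold pospart. rewrite Rmax_left by lra.
      replace (c * INR (S (S n)) * 0 ^ S n) with 0 by (cbn [pow]; ring).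
      apply (is_derive_const (V := R_NormedModule)).
  - subst x. apply is_derive_Reals. intros eps He.
    assert (D0 : 0 < Rmin 1 (eps / (1 + Rabs c))).
    { apply Rmin_glb_lt. lra. apply Rdiv_lt_0_compat; auto. pose proof (Rabs_pos c); lra. }
    exists (mkposreal _ D0). intros h Hh0 Hh. cbn in Hh.
    pose proof (Rmin_l 1 (eps / (1 + Rabs c))). pose proof (Rmin_r 1 (eps / (1 + Rabs c))).
    assert (P0 : pospart 0 = 0) by (unfold pospart; apply Rmax_left; lra).
    rewrite Rplus_0_l, P0.
    replace (c * 0 ^ S (S n)) with 0 by (cbn [pow]; ring).
    replace (c * INR (S (S n)) * 0 ^ S n) with 0 by (cbn [pow]; ring).
    rewrite !Rminus_0_r.
    assert (Hp : 0 <= pospart h <= Rabs h).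
    { unfold pospart, Rmax, Rabs. destruct (Rle_dec 0 h), (Rcase_abs h); lra. }
    assert (Hn : 0 <= pospart h ^ n <= 1).
    { split. apply pow_le; lra. rewrite <- (pow1 n). apply pow_incr. lra. }
    assert (hp : 0 < Rabs h) by (apply Rabs_pos_lt; auto).
    unfold Rdiv. rewrite !Rabs_mult, Rabs_inv. rewrite (Rabs_right (pospart h ^ S (S n))) by (apply Rle_ge, pow_le; lra).
    cbn [pow].
    apply Rle_lt_trans with (Rabs c * Rabs h).
    + apply (Rmult_le_reg_r (Rabs h)); auto.
      replace (Rabs c * (pospart h * (pospart h * pospart h ^ n)) * / Rabs h * Rabs h) with
        (Rabs c * (pospart h * (pospart h * pospart h ^ n))) by (field; lra).
      rewrite Rmult_assoc. apply Rmult_le_compat_l. apply Rabs_pos.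
      assert (pospart h * pospart h ^ n <= Rabs h) by nra. nra.
    + assert (E : Rabs h * (1 + Rabs c) < eps).
      { apply Rlt_le_trans with (eps / (1 + Rabs c) * (1 + Rabs c)).
        - apply Rmult_lt_compat_r; pose proof (Rabs_pos c); lra.
        - right. field. pose proof (Rabs_pos c); lra. }
      pose proof (Rabs_pos c). nra.
  - apply (is_derive_ext_loc (fun y : R => c * y ^ S (S n))).
    + generalize (open_gt 0 x H). apply filter_imp. intros y Hy.
      unfold pospart. rewrite Rmax_right by lra. reflexivity.
    + unfold pospart. rewrite Rmax_right by lra. auto_derive; auto.
      change (Nat.pred (S (S n))) with (S n). rewrite (S_INR (S n)). 
      match goal with |- ?a = ?b => replace a with b; [reflexivity|] end.
      rewrite S_INR. cbn [pow]. destruct n; cbn; ring.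
Qed.

Lemma Ck1_pospart_pow k n c : (k < n)%nat -> Ck1 k (fun _ => True) (fun x => c * pospart x ^ n).
Proof.
  revert n c. induction k as [|k IH]; intros n c L.
  - intros x _. destruct n as [|[|n]]; [lia| |].
    + apply (continuous_scal_r c (fun x => pospart x ^ 1)).
      apply (continuous_ext pospart). intros y; cbn; ring.
      apply continuity_pt_filterlim.
      intros eps He. exists eps. split; auto. intros y [_ Hy].
      eapply Rle_lt_trans; [|exact Hy]. change (Rabs (pospart y - pospart x) <= Rabs (y - x)).
      unfold pospart, Rmax, Rabs. repeat destruct Rle_dec; repeat destruct Rcase_abs; lra.
    + apply (@ex_derive_continuous R_AbsRing R_NormedModule). eexists. apply is_derive_pospart_pow.
  - destruct n as [|[|n]]; try lia. split.
    + intros x _. eexists. apply is_derive_pospart_pow.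
    + apply (Ck1_ext k _ (fun x => (c * INR (S (S n))) * pospart x ^ S n)).
      * apply open_true.
      * intros x _. symmetry. apply is_derive_unique. apply is_derive_pospart_pow.
      * apply IH. lia.
Qed.

Lemma Ck1_trig k a b : Ck1 k (fun _ => True) (fun x => a * cos x + b * sin x).
Proof.
  assert (D : forall a b x, is_derive (fun x => a * cos x + b * sin x) x (b * cos x + (- a) * sin x)).
  { intros. auto_derive; auto. ring. }
  revert a b. induction k as [|k IH]; intros a b.
  - intros x _. apply (@ex_derive_continuous R_AbsRing R_NormedModule). eexists. apply D.
  - split.
    + intros x _. eexists. apply D.
    + apply (Ck1_ext k _ (fun x => b * cos x + (- a) * sin x)); auto.
      * apply open_true.
      * intros x _. symmetry. apply is_derive_unique. apply D.
Qed.

Lemma Ck3_cos k U f : open3 U -> Ck3 k U f -> Ck3 k U (fun t x y => cos (f t x y)).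
Proof.
  intros O H. apply (Ck3_ext k U (fun t x y => 1 * cos (f t x y) + 0 * sin (f t x y)) _ O).
  intros; ring. apply (Ck3_comp k U (fun _ => True) (fun x => 1 * cos x + 0 * sin x)); auto.
  apply Ck1_trig.
Qed.

Lemma Ck3_pospart5 U f : open3 U -> Ck3 4 U f -> Ck3 4 U (fun t x y => pospart (f t x y) ^ 5).
Proof.
  intros O H. apply (Ck3_ext 4 U (fun t x y => 1 * pospart (f t x y) ^ 5) _ O).
  intros; ring. apply (Ck3_comp 4 U (fun _ => True) (fun x => 1 * pospart x ^ 5)); auto.
  apply Ck1_pospart_pow. lia.
Qed.

(** A bump of period [p] around [m], with half-width [e].  Being periodic it is
    a function on the surface in the angle, and on a torus in [u] as well; the
    fifth power makes it of class C^4. *)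
Definition bump (p e m x : R) : R :=
  pospart (cos (2 * PI / p * (x - m)) - cos (2 * PI / p * e)) ^ 5.

Section Bump.
Variables p e m : R.
Hypothesis p0 : 0 < p.
Hypothesis e0 : 0 < e < p / 2.

Let scale x : 2 * PI / p * (x + p) = 2 * PI / p * x + 2 * PI.
Proof. field. lra. Qed.

Lemma bump_ge x : 0 <= bump p e m x.
Proof. apply pow_le. apply pospart_ge. Qed.

Lemma bump_period x : bump p e m (x + p) = bump p e m x.
Proof.
  unfold bump. replace (x + p - m) with (x - m + p) by ring.
  rewrite scale, cos_plus, cos_2PI, sin_2PI. do 3 f_equal. ring.
Qed.

Lemma bump_center : 0 < bump p e m m.
Proof.
  pose proof PI_RGT_0. assert (q0 : 0 < 2 * PI / p) by (apply Rdiv_lt_0_compat; lra).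
  apply pow_lt. unfold pospart. apply Rlt_le_trans with
    (cos (2 * PI / p * (m - m)) - cos (2 * PI / p * e)); [|apply Rmax_r].
  replace (2 * PI / p * (m - m)) with 0 by ring.
  assert (cos (2 * PI / p * e) < cos 0).
  { apply cos_decreasing_1; try lra.
    - apply Rmult_le_pos; lra.
    - replace PI with (2 * PI / p * (p / 2)) at 2 by (field; lra).
      apply Rmult_le_compat_l; lra.
    - apply Rmult_lt_0_compat; lra. }
  lra.
Qed.

Lemma bump_support x : e <= Rabs (x - m) <= p - e -> bump p e m x = 0.
Proof.
  intros Hx. pose proof PI_RGT_0.
  assert (q0 : 0 < 2 * PI / p) by (apply Rdiv_lt_0_compat; lra).
  set (q := 2 * PI / p) in *.
  assert (qp : q * p = 2 * PI) by (unfold q; field; lra).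
  unfold bump. fold q.
  assert (C : cos (q * (x - m)) <= cos (q * e)).
  { assert (E : cos (q * (x - m)) = cos (q * Rabs (x - m))).
    { unfold Rabs. destruct (Rcase_abs (x - m)); auto.
      rewrite <- cos_neg. f_equal. ring. }
    rewrite E. set (d := Rabs (x - m)) in *.
    destruct (Rle_dec d (p / 2)) as [H1|H1].
    - apply cos_decr_1; nra.
    - replace (cos (q * d)) with (cos (q * (p - d))).
      + apply cos_decr_1; nra.
      + replace (q * (p - d)) with (- (q * d) + 2 * PI) by (rewrite <- qp; ring).
        rewrite cos_plus, cos_2PI, sin_2PI, cos_neg. ring. }
  unfold pospart. rewrite Rmax_left by lra. cbn. ring.
Qed.
End Bump.

Lemma bump_smooth p e m U f : open3 U -> Ck3 4 U f ->
  Ck3 4 U (fun t x y => bump p e m (f t x y)).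
Proof.
  intros O H. apply Ck3_pospart5; auto. apply Ck3_minus; auto; [|apply Ck3_const; auto].
  apply Ck3_cos; auto. apply Ck3_mult; auto. apply Ck3_const; auto.
  apply Ck3_minus; auto. apply Ck3_const; auto.
Qed.

(** * From criticality to the reduced membrane equation *)

Lemma vscal_zero v w : vadd v (vscal 0 w) = v.
Proof. apply vec_eq; cbn; ring. Qed.

Lemma variation_const S X : immersion_C4 S X -> variation S X 1 (fun _ => X).
Proof.
  intros [W [[d [Hd Sm]] Rg]]. split; [lra|]. split; [|split].
  - exists d. split; auto. intros c Hc U.
    assert (O : open3 U) by (apply (time_nbhd_open S); auto).
    destruct (Sm c Hc) as [A [B C]].
    split; [|split];
      [ apply (Ck2_Ck3 4 (chart_nbhd c d) U (fun x y => cx (local_rep c X x y)))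
      | apply (Ck2_Ck3 4 (chart_nbhd c d) U (fun x y => cy (local_rep c X x y)))
      | apply (Ck2_Ck3 4 (chart_nbhd c d) U (fun x y => cz (local_rep c X x y))) ];
      auto; intros t x y K; apply K.
  - intros t _. auto.
  - auto.
Qed.

Lemma polar_point S ue sg c x y : polar_chart S ue sg c -> 0 < radius x y < len S ->
  exists u th, u0 S < u < u1 S /\ px ue sg u th = x /\ py ue u th = y.
Proof.
  intros P Hr. pose proof (pc_sg _ _ _ _ P) as sg2.
  destruct (angle_spec x y (proj1 Hr)) as [C D].
  exists (ue + sg * radius x y), (sg * angle x y).
  assert (Sg := sign_cases sg ltac:(assumption)).
  split; [|split].
  - apply (pc_range _ _ _ _ P).
    replace (sg * (ue + sg * radius x y - ue)) with (sg * sg * radius x y) by ring.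
    rewrite sg2. lra.
  - transitivity (radius x y * cos (angle x y)); [|exact C]. unfold px. destruct Sg; subst sg.
    + replace (1 * angle x y) with (angle x y) by ring. ring.
    + replace (-1 * angle x y) with (- angle x y) by ring. rewrite cos_neg. ring.
  - transitivity (radius x y * sin (angle x y)); [|exact D]. unfold py. destruct Sg; subst sg.
    + replace (1 * angle x y) with (angle x y) by ring. ring.
    + replace (-1 * angle x y) with (- angle x y) by ring. rewrite sin_neg. ring.
Qed.

Section BumpVariation.
Variables (S : surface) (X : R -> R -> vec).
Hypothesis IX : immersion_C4 S X.
Variables (m th0 e : R) (E : vec).
Hypothesis e_pos : 0 < e.
Hypothesis m_in : u0 S + 3 * e <= m <= u1 S - 3 * e.
Hypothesis e_pi : e < PI.

Definition profile (u th : R) : R := bump (len S) e m u * bump (2 * PI) e th0 th.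
(** The direction [E] of the variation is constant, because the unit normal of a
    C^4 immersion is only of class C^3. *)
Definition bumped (t u th : R) : vec := vadd (X u th) (vscal (t * profile u th) E).

Let e_len : 0 < e < len S / 2.
Proof. unfold len. lra. Qed.

Lemma profile_far u th : u0 S - e <= u <= u1 S + e -> e <= Rabs (u - m) -> profile u th = 0.
Proof.
  intros Hu H. unfold profile. rewrite (bump_support (len S) e m (len_pos S) e_len).
  ring. split; auto. unfold len. unfold Rabs in *. destruct (Rcase_abs (u - m)); lra.
Qed.

Lemma bumped_zero u th : bumped 0 u th = X u th.
Proof. unfold bumped. rewrite Rmult_0_l. apply vscal_zero. Qed.

Lemma bumped_far t u th : u0 S - e <= u <= u1 S + e -> e <= Rabs (u - m) ->
  bumped t u th = X u th.
Proof.
  intros Hu H. unfold bumped. rewrite profile_far by auto. rewrite Rmult_0_r. apply vscal_zero.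
Qed.

Lemma bumped_near_far t u th : u0 S <= u <= u1 S -> 2 * e <= Rabs (u - m) ->
  locally_2d (fun a b => bumped t a b = X a b) u th.
Proof.
  intros Hu H. exists (mkposreal _ e_pos). cbn. intros a b Ha _.
  apply Rabs_def2 in Ha. apply bumped_far. lra.
  unfold Rabs in *. destruct (Rcase_abs (u - m)), (Rcase_abs (a - m)); lra.
Qed.

Lemma bumped_wd t : well_defined S (bumped t).
Proof.
  destruct IX as [[W1 W2] _]. split.
  - intros u th Hu. unfold bumped, profile. rewrite W1 by auto.
    rewrite (bump_period (2 * PI)) by (apply two_pi_pos). reflexivity.
  - destruct (shape S) as [a b|] eqn:Sh.
    + split; intros Ha th.
      * rewrite !bumped_far; try (apply W2; auto); try lra; rewrite Rabs_left; lra.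
      * rewrite !bumped_far; try (apply W2; auto); try lra; rewrite Rabs_right; lra.
    + intros u th. unfold bumped, profile. fold (len S). rewrite (bump_period (len S)) by apply len_pos.
      unfold len. rewrite W2. reflexivity.
Qed.

Lemma VCk3_shift U F g : open3 U -> VCk3 4 U F -> Ck3 4 U g ->
  VCk3 4 U (fun t x y => vadd (F t x y) (vscal (t * g t x y) E)).
Proof.
  intros O HF Hg. apply VCk3_add; auto. apply VCk3_scal; auto.
  - apply Ck3_mult; auto. apply (Ck3_coord 4 U dirT O).
  - apply VCk3_const; auto.
Qed.

Lemma X_smooth d : (forall c, In c (charts S) ->
    Ck2 4 (chart_nbhd c d) (fun x y => cx (local_rep c X x y)) /\
    Ck2 4 (chart_nbhd c d) (fun x y => cy (local_rep c X x y)) /\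
    Ck2 4 (chart_nbhd c d) (fun x y => cz (local_rep c X x y))) ->
  forall c U, In c (charts S) -> open3 U -> (forall t x y, U t x y -> chart_nbhd c d x y) ->
  VCk3 4 U (fun _ => local_rep c X).
Proof.
  intros H c U Hc O HU. destruct (H c Hc) as [A [B C]].
  split; [|split];
      [ apply (Ck2_Ck3 4 (chart_nbhd c d) U (fun x y => cx (local_rep c X x y)))
      | apply (Ck2_Ck3 4 (chart_nbhd c d) U (fun x y => cy (local_rep c X x y)))
      | apply (Ck2_Ck3 4 (chart_nbhd c d) U (fun x y => cz (local_rep c X x y))) ]; auto.
Qed.

Lemma Ck3_radius U : open3 U -> (forall t x y, U t x y -> 0 < radius x y) ->
  Ck3 4 U (fun _ x y => radius x y).
Proof.
  intros O H.
  pose proof (Ck3_coord 4 U dirX O) as Cx. pose proof (Ck3_coord 4 U dirY O) as Cy.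
  apply (Ck3_sqrt 4 U (fun _ x y => x ^ 2 + y ^ 2) O).
  - apply Ck3_plus; auto.
    + exact (Ck3_pow 4 U _ 2 O Cx).
    + exact (Ck3_pow 4 U _ 2 O Cy).
  - intros t x y Hu. pose proof (H t x y Hu). rewrite <- radius_sqr. nra.
Qed.

(** Away from the pole the bump in the angle is a smooth function of
    [cos (angle)] and [sin (angle)], so that the cut of [angle] is invisible. *)
Lemma bump_angle sg x y : 0 < radius x y -> sg * sg = 1 ->
  bump (2 * PI) e th0 (sg * angle x y) =
  pospart ((x / radius x y * cos th0 + sg * (y / radius x y) * sin th0) - cos e) ^ 5.
Proof.
  intros Hr Hs. destruct (angle_spec x y Hr) as [C D].
  unfold bump. pose proof PI_RGT_0.
  replace (2 * PI / (2 * PI)) with 1 by (field; lra). rewrite !Rmult_1_l.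
  rewrite cos_minus.
  assert (Sg := sign_cases sg ltac:(assumption)).
  assert (C' : cos (angle x y) = x / radius x y).
  { apply (Rmult_eq_reg_l (radius x y)); [|lra]. rewrite C. field. lra. }
  assert (D' : sin (angle x y) = y / radius x y).
  { apply (Rmult_eq_reg_l (radius x y)); [|lra]. rewrite D. field. lra. }
  assert (Ec : cos (sg * angle x y) = x / radius x y).
  { rewrite <- C'. destruct Sg; subst sg.
    - replace (1 * angle x y) with (angle x y) by ring. reflexivity.
    - replace (-1 * angle x y) with (- angle x y) by ring. apply cos_neg. }
  assert (Es : sin (sg * angle x y) = sg * (y / radius x y)).
  { rewrite <- D'. destruct Sg; subst sg.
    - replace (1 * angle x y) with (angle x y) by ring. ring.
    - replace (-1 * angle x y) with (- angle x y) by ring. rewrite sin_neg. ring. }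
  rewrite Ec, Es. reflexivity.
Qed.

Lemma polar_chart_end ue sg c : polar_chart S ue sg c ->
  forall rho, 0 <= rho < e -> u0 S - e <= ue + sg * rho <= u1 S + e /\ e <= Rabs (ue + sg * rho - m).
Proof.
  intros P rho Hrho. pose proof (pc_end _ _ _ _ P) as HE.
  assert (Sg := sign_cases sg (pc_sg _ _ _ _ P)).
  pose proof (pc_side _ _ _ _ P (u0 S)) as A. pose proof (pc_side _ _ _ _ P (u1 S)) as B.
  pose proof (u0_lt_u1 S).
  assert (EU : ue = u0 S \/ ue = u1 S) by (destruct Sg; subst sg; lra).
  destruct Sg, EU; subst; unfold Rabs; destruct Rcase_abs; lra.
Qed.

Lemma bumped_smooth eps : C4_family S eps bumped.
Proof.
  destruct IX as [_ [[d [Hd Sm]] _]]. exists d. split; auto. intros c Hc U.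
  change (VCk3 4 U (fun t => local_rep c (bumped t))).
  assert (O : open3 U) by (apply (time_nbhd_open S); auto).
  destruct (charts_cases S c Hc) as [Ec|[ue [sg P]]].
  - subst c. apply (VCk3_shift U (fun _ => local_rep (cylinder_chart S) X) (fun _ => profile)); auto.
    + apply (X_smooth d Sm); auto. intros t x y K. apply K.
    + apply Ck3_mult; auto.
      * apply (bump_smooth _ _ _ U (coord dirX)); auto. apply Ck3_coord; auto.
      * apply (bump_smooth _ _ _ U (coord dirY)); auto. apply Ck3_coord; auto.
  - set (U1 := fun t x y => U t x y /\ 0 < radius x y).
    set (U2 := fun t x y => U t x y /\ radius x y < e).
    assert (O1 : open3 U1).
    { intros t x y [K1 K2]. apply near3_and. apply O; exact K1.
      assert (K3 : - radius x y < 0) by lra.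
      generalize (cont3_lt _ t x y 0 (cont3_opp _ _ _ _ (radius_cont t x y)) K3).
      apply near3_imp. intros; lra. }
    assert (O2 : open3 U2).
    { intros t x y [K1 K2]. apply near3_and. apply O; exact K1.
      apply cont3_lt; auto. apply radius_cont. }
    assert (rep : forall t x y, local_rep c (bumped t) x y =
      vadd (local_rep c X x y) (vscal (t * profile (ue + sg * radius x y) (sg * angle x y)) E)).
    { intros t x y. unfold bumped, local_rep. rewrite (pc_param _ _ _ _ P). reflexivity. }
    assert (V1 : VCk3 4 U1 (fun t => local_rep c (bumped t))).
    { pose proof (Ck3_radius U1 O1 (fun t x y K => proj2 K)) as CR.
      assert (Cu : Ck3 4 U1 (fun _ x y => ue + sg * radius x y)).
      { apply Ck3_plus; auto. apply Ck3_const; auto. apply Ck3_mult; auto. apply Ck3_const; auto. }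
      assert (Cq : forall d', Ck3 4 U1 (fun t x y => coord d' t x y / radius x y)).
      { intros d'. apply Ck3_div; auto. apply Ck3_coord; auto.
        intros t x y K. destruct K. lra. }
      assert (Cg : Ck3 4 U1 (fun t x y => bump (2 * PI) e th0 (sg * angle x y))).
      { apply (Ck3_ext 4 U1 (fun _ x y =>
          pospart ((x / radius x y * cos th0 + sg * (y / radius x y) * sin th0) - cos e) ^ 5) _ O1).
        - intros t x y K. symmetry. apply bump_angle. apply K. apply (pc_sg _ _ _ _ P).
        - apply Ck3_pospart5; auto. apply Ck3_minus; auto; [|apply Ck3_const; auto].
          apply Ck3_plus; auto; apply Ck3_mult; auto; try (apply Ck3_const; auto).
          + apply (Cq dirX).
          + apply Ck3_mult; auto. apply Ck3_const; auto. apply (Cq dirY). }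
      assert (Cp : Ck3 4 U1 (fun _ x y => profile (ue + sg * radius x y) (sg * angle x y))).
      { apply Ck3_mult; auto. apply bump_smooth; auto. }
      assert (CX : VCk3 4 U1 (fun _ => local_rep c X)).
      { apply (X_smooth d Sm); auto. intros t x y K. apply K. }
      apply (VCk3_ext U1 O1 4 _ _ (fun t x y _ => eq_sym (rep t x y))).
      exact (VCk3_shift U1 _ _ O1 CX Cp). }
    assert (V2 : VCk3 4 U2 (fun t => local_rep c (bumped t))).
    { assert (CX : VCk3 4 U2 (fun _ => local_rep c X)).
      { apply (X_smooth d Sm); auto. intros t x y K. apply K. }
      revert CX. apply (VCk3_ext U2 O2).
      intros t x y [_ K]. unfold local_rep. rewrite (pc_param _ _ _ _ P). cbn [fst snd].
      symmetry. apply bumped_far; apply (polar_chart_end ue sg c P); split; auto; apply radius_pos. }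
    apply (VCk3_union 4 U1 U2); auto.
    intros t x y K. destruct (Rlt_dec (radius x y) e); [right | left]; split; auto; lra.
Qed.

Lemma translate_normal t p q u th :
  locally_2d (fun a b => bumped t (a + p) (b + q) = bumped t a b) u th ->
  normal_vec (bumped t) (u + p) (th + q) = normal_vec (bumped t) u th.
Proof. intros H. apply (translate_invariant (bumped t) p q u th H). Qed.

Lemma bumped_period_near t u th k : u0 S < u < u1 S ->
  locally_2d (fun a b => bumped t (a + 0) (b + IZR k * (2 * PI)) = bumped t a b) u th.
Proof.
  intros Hu. generalize (interior_2d S u th Hu). apply locally_2d_impl. apply locally_2d_forall.
  intros a b Ha. rewrite Rplus_0_r. apply (wd_period S). apply bumped_wd.
  apply interior_in_surface. lra.
Qed.

(** Nothing changes away from the support, and the support is compact modulo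
    the periods. *)
Lemma bumped_regular : exists eps, 0 < eps <= 1 /\
  forall t, Rabs t < eps -> regular S (bumped t).
Proof.
  destruct IX as [WX [_ Rg]].
  destruct (bumped_smooth 1) as [d [Hd Sm]].
  pose proof (Sm _ (in_cylinder S)) as SmC. cbv zeta in SmC.
  set (U := fun t x y => Rabs t < 1 /\ chart_nbhd (cylinder_chart S) d x y) in *.
  assert (O : open3 U) by (apply (time_nbhd_open S); apply in_cylinder).
  change (VCk3 4 U bumped) in SmC.
  assert (Cyl : forall t u th, U t u th -> normal_vec (bumped t) u th <> vzero ->
    near3 (fun t u th => normal_vec (bumped t) u th <> vzero) t u th).
  { intros t u th Hu Hn.
    destruct (VCk3_cross U O 3 _ _ (VCk3_D U 3 _ dirX SmC) (VCk3_D U 3 _ dirY SmC)) as [N1 [N2 N3]].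
    apply (vcont_neq0 (fun t => normal_vec (bumped t))); auto.
    - exact (Ck3_cont_pt 3 U _ t u th O N1 Hu).
    - exact (Ck3_cont_pt 3 U _ t u th O N2 Hu).
    - exact (Ck3_cont_pt 3 U _ t u th O N3 Hu). }
  destruct (tube (m - 2 * e) (m + 2 * e) 0 (2 * PI)
    (fun t u th => normal_vec (bumped t) u th <> vzero)) as [q Hq].
  { intros u th [Hu _].
    assert (Dom : chart_dom (cylinder_chart S) u th) by (apply cyl_dom_interior; lra).
    apply Cyl.
    - split. rewrite Rabs_R0; lra. apply (dom_nbhd S); auto. apply in_cylinder.
    - assert (L : locally_2d (fun a b => bumped 0 a b = X a b) u th).
      { apply locally_2d_forall. apply bumped_zero. }
      rewrite (proj1 (unit_normal_ext _ _ _ _ L)).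
      apply (Rg _ (in_cylinder S) u th Dom). }
  exists (Rmin 1 q). split. split; [apply Rmin_glb_lt; [lra | apply q] | apply Rmin_l].
  intros t Ht0. assert (Ht1 : Rabs t < 1) by (pose proof (Rmin_l 1 q); lra).
  assert (Ht : Rabs t < q) by (pose proof (Rmin_r 1 q); lra).
  assert (R1 : forall u th, u0 S <= u <= u1 S -> chart_dom (cylinder_chart S) u th ->
    normal_vec (bumped t) u th <> vzero).
  { intros u th Hu Dom. destruct (Rle_dec (2 * e) (Rabs (u - m))) as [H|H].
    - rewrite (proj1 (unit_normal_ext _ _ _ _ (bumped_near_far t u th Hu H))).
      apply (Rg _ (in_cylinder S) u th Dom).
    - assert (Hum : m - 2 * e <= u <= m + 2 * e).
      { unfold Rabs in H. destruct (Rcase_abs (u - m)); lra. }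
      destruct (shift_into (2 * PI) 0 th two_pi_pos) as [k Hk].
      assert (Hi : u0 S < u < u1 S) by lra.
      rewrite <- (translate_normal t 0 (IZR k * (2 * PI)) u th (bumped_period_near t u th k Hi)).
      rewrite Rplus_0_r. apply Hq; auto. split; auto. lra. }
  assert (R2 : forall u th, chart_dom (cylinder_chart S) u th ->
    normal_vec (bumped t) u th <> vzero).
  { intros u th Dom. destruct (shape S) as [a b|] eqn:Sh.
    - apply R1; auto. pose proof (cyl_dom_range S u th Dom) as K. unfold in_surface in K.
      rewrite Sh in K. exact K.
    - destruct (shift_into (len S) (u0 S) u (len_pos S)) as [k Hk].
      rewrite <- (translate_normal t (IZR k * len S) 0 u th).
      + rewrite Rplus_0_r. apply R1. unfold len in *; lra. cbn. rewrite Sh. exact I.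
      + apply locally_2d_forall. intros p r. rewrite Rplus_0_r.
        apply (shift_period (fun u => bumped t u r)). intros x.
        pose proof (proj2 (bumped_wd t)) as Per. rewrite Sh in Per. apply Per. }
  intros c Hc x y Dom. destruct (charts_cases S c Hc) as [Ec|[ue [sg P]]].
  - subst c. exact (R2 x y Dom).
  - pose proof (proj1 (pc_dom _ _ _ _ P x y) Dom) as Hr. pose proof (radius_pos x y) as Hr0.
    destruct (Rlt_dec (radius x y) e) as [Hs|Hs].
    + assert (L : locally_2d (fun a b => local_rep c (bumped t) a b = local_rep c X a b) x y).
      { generalize (near3_2d _ _ _ _ (cont3_lt _ 0 x y e (radius_cont 0 x y) Hs)).
        apply locally_2d_impl. apply locally_2d_forall. intros a b Hab.
        unfold local_rep. rewrite (pc_param _ _ _ _ P). cbn [fst snd].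
        apply bumped_far; apply (polar_chart_end ue sg c P); split; auto; apply radius_pos. }
      rewrite (proj1 (unit_normal_ext _ _ _ _ L)). apply (Rg c Hc x y Dom).
    + destruct (polar_point S ue sg c x y P) as [u [th [Hu [Ex Ey]]]]; [lra|].
      intros N0. apply (R2 u th (cyl_dom_interior S u th Hu)).
      pose proof (polar_rep_near S ue sg c (bumped t) u th P (bumped_wd t) Hu) as L.
      rewrite (proj1 (unit_normal_ext _ _ _ _ L)).
      pose proof (Sm c Hc) as SmP. cbv zeta in SmP.
      set (UP := fun t x y => Rabs t < 1 /\ chart_nbhd c d x y) in *.
      assert (OP : open3 UP) by (apply (time_nbhd_open S); auto).
      change (VCk3 4 UP (fun t => local_rep c (bumped t))) in SmP.
      destruct (pull_DV ue sg UP _ t u th OP (VCk3_le UP OP 1 4 _ ltac:(lia) SmP)) as [E1 E2].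
      { rewrite Ex, Ey. split; auto. apply (dom_nbhd S); auto. }
      unfold normal_vec at 1. rewrite E1, E2, cross_polar, Ex, Ey.
      change (vscal (sg * (u - ue)) (normal_vec (local_rep c (bumped t)) x y) = vzero).
      rewrite N0. apply vec_eq; cbn; ring.
Qed.
End BumpVariation.

Section Converse.
Variables (S : surface) (co : R) (X : R -> R -> vec).
Hypothesis IX : immersion_C4 S X.
Hypothesis zX : forall u th, in_surface S u -> cz (X u th) <> 0.

(** The integrand of [G_derivative] for the constant velocity [E]. *)
Definition variation_density (E : vec) (u th : R) : R :=
  - (2 / cz (X u th) ^ 2 * defect co X u th * dot E (normal_vec X u th)).

(** The surface itself is treated as a constant family, so that the results on
    families apply to it. *)
Lemma constant_family : exists eps d, 0 < eps /\ 0 < d /\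
  (forall c, In c (charts S) ->
     regular_family (chart_open eps d (fun _ => X) c) (fun _ => local_rep c X)) /\
  (forall c x y, In c (charts S) -> chart_dom c x y ->
     chart_open eps d (fun _ => X) c 0 x y).
Proof.
  destruct (variation_family S X zX 1 (fun _ => X) (variation_const S X IX)) as [eps [_ SF]].
  destruct (local_rep_regular S eps (fun _ => X) SF) as [d [Hd RF]].
  exists eps, d. split; [apply (sf_eps _ _ _ SF)|]. split; auto. split; auto.
  intros c x y Hc Dom. apply (dom_chart_open S eps (fun _ => X) SF); auto.
  rewrite Rabs_R0. apply (sf_eps _ _ _ SF).
Qed.

Lemma defect_continuous c x y : In c (charts S) -> chart_dom c x y ->
  continuity_2d_pt (defect co (local_rep c X)) x y.
Proof.
  intros Hc Dom. destruct constant_family as [eps [d [He [Hd [RF HO]]]]].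
  pose proof (RF c Hc) as Rc.
  apply (cont3_2d (fun _ => defect co (local_rep c X)) 0).
  apply (Ck3_cont_pt 2 _ _ 0 x y (rf_open _ _ Rc) (smooth_defect _ _ Rc co)). auto.
Qed.

Lemma variation_density_continuous E u th : u0 S < u < u1 S -> continuity_2d_pt (variation_density E) u th.
Proof.
  intros Hu. destruct constant_family as [eps [d [He [Hd [RF HO]]]]].
  pose proof (RF _ (in_cylinder S)) as Rc. pose proof (rf_open _ _ Rc) as O.
  apply (cont3_2d (fun _ => variation_density E) 0).
  refine (Ck3_cont_pt 2 _ _ 0 u th O _ (HO _ u th (in_cylinder S) (cyl_dom_interior S u th Hu))).
  apply Ck3_opp; auto. apply Ck3_mult; auto. apply Ck3_mult; auto.
  - apply Ck3_div; auto. apply Ck3_const; auto.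
    + apply Ck3_pow; auto. apply (Ck3_le 2 3 _ _ O (ltac:(lia)) (smooth_z _ _ Rc)).
    + intros t x y K. apply pow_nonzero. apply (rf_z _ _ Rc t x y K).
  - apply (smooth_defect _ _ Rc co).
  - apply (Ck3_dot _ O 2 (fun _ _ _ => E) (fun _ => normal_vec X)). apply VCk3_const; auto.
    apply (VCk3_le _ O 2 3 _ (ltac:(lia)) (smooth_N _ _ Rc)).
Qed.

Lemma profile_continuous m th0 e u th : continuity_2d_pt (profile S m th0 e) u th.
Proof.
  assert (O : open3 (fun _ _ _ => True)).
  { intros t x y _. apply near3_box. exists (mkposreal 1 Rlt_0_1). trivial. }
  apply (cont3_2d (fun _ => profile S m th0 e) 0).
  refine (Ck3_cont_pt 4 (fun _ _ _ => True) _ 0 u th O _ I).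
  apply Ck3_mult; auto.
  - apply (bump_smooth _ _ _ _ (coord dirX)); auto. apply Ck3_coord; auto.
  - apply (bump_smooth _ _ _ _ (coord dirY)); auto. apply Ck3_coord; auto.
Qed.

Hypothesis Gc : G_critical S co X.

Lemma bump_integral m th0 e E : 0 < e -> u0 S + 3 * e <= m <= u1 S - 3 * e -> e < PI ->
  scont S (fun u th => profile S m th0 e u th * variation_density E u th) /\
  sint S (fun u th => profile S m th0 e u th * variation_density E u th) = 0.
Proof.
  intros He Hm Hpi.
  set (Y := bumped S X m th0 e E).
  assert (CM : scont S (fun u th => profile S m th0 e u th * variation_density E u th)).
  { intros u th [Hu _]. destruct (Rlt_dec (Rabs (u - m)) (2 * e)) as [H|H].
    - apply Rabs_def2 in H. apply continuity_2d_pt_mult.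
      + apply profile_continuous.
      + apply variation_density_continuous. lra.
    - apply (continuity_2d_pt_ext_loc (fun _ _ => 0)); [|apply continuity_2d_pt_const].
      exists (mkposreal _ He). cbn. intros a b Ha _. apply Rabs_def2 in Ha.
      rewrite (profile_far S m th0 e); auto; try ring; try lra.
      unfold Rabs in *. destruct (Rcase_abs (u - m)), (Rcase_abs (a - m)); lra. }
  split. exact CM.
  destruct (bumped_regular S X IX m th0 e E He Hm Hpi) as [eps [Heps Rg]].
  assert (Far : forall t u th, on_boundary S u -> profile S m th0 e u th = 0 /\ Y t u th = X u th).
  { intros t u th Hb. unfold on_boundary in Hb. destruct (shape S); [|contradiction].
    assert (K : u0 S - e <= u <= u1 S + e /\ e <= Rabs (u - m)).
    { destruct Hb as [[_ ->]|[_ ->]]; unfold Rabs; destruct Rcase_abs; lra. }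
    destruct K as [K1 K2]. split.
    - apply profile_far; auto.
    - apply bumped_far; auto. }
  assert (Var : variation S X eps Y).
  { split; [lra|]. split; [|split].
    - apply bumped_smooth; auto.
    - intros t Ht. split. apply bumped_wd; auto. apply Rg. exact Ht.
    - intros u th _. apply bumped_zero. }
  assert (Van : vanishes_on_boundary S X eps Y).
  { intros t u th _ Hb. apply (Far t u th Hb). }
  pose proof (Gc eps Y Var Van) as D0.
  destruct (variation_family S X zX eps Y Var) as [eps1 [_ SF]].
  assert (Vel : forall u th, DV dirT Y 0 u th = vscal (profile S m th0 e u th) E).
  { intros u th. apply vec_eq; apply is_derive_unique; unfold Y, bumped; cbn;
      auto_derive; auto; ring. }
  assert (E0 : forall u th, locally_2d (fun a b => Y 0 a b = X a b) u th).
  { intros u th. apply locally_2d_forall. intros a b. apply bumped_zero. }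
  pose proof (G_derivative S eps1 Y SF co (fun u th => profile S m th0 e u th * variation_density E u th)) as D1.
  transitivity (Derive (fun t => G_energy S co (Y t)) 0); [|apply is_derive_unique; exact D0].
  symmetry. apply is_derive_unique. apply D1; auto.
  - intros u th Hb. rewrite Vel, (proj1 (Far 0 u th Hb)). apply vec_eq; cbn; ring.
  - intros u th Hu. rewrite Vel.
    destruct (dens_ext co _ _ u th (E0 u th)) as [_ [_ [_ [_ Ed]]]]. rewrite Ed.
    rewrite (proj1 (unit_normal_ext _ _ u th (E0 u th))).
    replace (Y 0 u th) with (X u th) by (symmetry; apply bumped_zero).
    unfold variation_density, dot, vscal; cbn. ring.
Qed.

(** If the defect were nonzero at a point, a bump around that point, in the
    direction of the normal there and with the right sign, would change [G] to
    first order. *)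
Lemma defect_zero_rect u th : u0 S < u < u1 S -> 0 < th < 2 * PI -> defect co X u th = 0.
Proof.
  intros Hu Hth. destruct (Req_dec (defect co X u th) 0) as [Z|N]; auto. exfalso.
  set (E := vscal (- defect co X u th) (normal_vec X u th)).
  assert (Dom : chart_dom (cylinder_chart S) u th) by (apply cyl_dom_interior; auto).
  assert (T0 : 0 < variation_density E u th).
  { assert (Hz : cz (X u th) <> 0) by (apply zX; apply interior_in_surface; lra).
    pose proof (dot_pos _ (proj2 (proj2 IX) _ (in_cylinder S) u th Dom)) as P.
    change (0 < dot (normal_vec X u th) (normal_vec X u th)) in P.
    replace (variation_density E u th) with (2 * (defect co X u th / cz (X u th)) ^ 2 *
      dot (normal_vec X u th) (normal_vec X u th)).
    - apply Rmult_lt_0_compat; auto. apply Rmult_lt_0_compat; [lra|].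
      rewrite <- Rsqr_pow2. apply Rsqr_pos_lt. unfold Rdiv.
      apply Rmult_integral_contrapositive. split; auto. apply Rinv_neq_0_compat; auto.
    - unfold variation_density, E, dot, vscal; cbn. field. exact Hz. }
  destruct (variation_density_continuous E u th Hu (mkposreal _ T0)) as [r Hr]. cbn in Hr.
  set (h := Rmin (Rmin (u - u0 S) (u1 S - u)) (Rmin th (2 * PI - th))).
  assert (h0 : 0 < h) by (repeat apply Rmin_glb_lt; lra).
  assert (h1 : h <= u - u0 S /\ h <= u1 S - u /\ h <= th /\ h <= 2 * PI - th).
  { unfold h. pose proof (Rmin_l (Rmin (u - u0 S) (u1 S - u)) (Rmin th (2 * PI - th))).
    pose proof (Rmin_r (Rmin (u - u0 S) (u1 S - u)) (Rmin th (2 * PI - th))).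
    pose proof (Rmin_l (u - u0 S) (u1 S - u)). pose proof (Rmin_r (u - u0 S) (u1 S - u)).
    pose proof (Rmin_l th (2 * PI - th)). pose proof (Rmin_r th (2 * PI - th)). lra. }
  set (e := Rmin r (h / 3)).
  assert (e0 : 0 < e) by (apply Rmin_glb_lt; [apply r | lra]).
  assert (e1 : e <= r) by apply Rmin_l. assert (e2 : e <= h / 3) by apply Rmin_r.
  destruct (bump_integral u th e E) as [CM I0]; auto; try lra.
  assert (eL : 0 < e < len S / 2) by (unfold len; lra).
  assert (eP : 0 < e < 2 * PI / 2) by lra.
  assert (Pos : 0 < sint S (fun a b => profile S u th e a b * variation_density E a b)).
  { apply (dint_pos_pt _ _ _ _ _ u th Hu Hth CM).
    - intros a b [Ha Hb].
      destruct (Rle_dec e (Rabs (a - u))) as [H1|H1].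
      { rewrite profile_far; auto; try lra. }
      destruct (Rle_dec e (Rabs (b - th))) as [H2|H2].
      { unfold profile. rewrite (bump_support (2 * PI) e th two_pi_pos eP b); [lra|].
        split; auto. unfold Rabs; destruct Rcase_abs; lra. }
      apply Rmult_le_pos.
      + apply Rmult_le_pos; apply bump_ge.
      + assert (K : Rabs (variation_density E a b - variation_density E u th) < variation_density E u th) by (apply Hr; lra).
        apply Rabs_def2 in K. lra.
    - apply Rmult_lt_0_compat; auto. apply Rmult_lt_0_compat; apply bump_center; auto.
      apply len_pos. apply two_pi_pos. }
  lra.
Qed.

Lemma defect_periodic k p u th :
  locally_2d (fun a b => X (a + k) (b + p) = X a b) u th ->
  defect co X (u + k) (th + p) = defect co X u th.
Proof.
  intros L. destruct (translate_invariant X k p u th L) as [_ [_ [_ [E1 E2]]]].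
  unfold defect. rewrite E1, E2, (near2_pt _ _ _ L). reflexivity.
Qed.

(** The bumps reach a dense set of parameters; continuity and periodicity do the
    rest, first on the cylinder and then at the poles. *)
Lemma defect_zero_open u th : u0 S < u < u1 S -> defect co X u th = 0.
Proof.
  intros Hu. destruct (shift_into (2 * PI) 0 th two_pi_pos) as [k Hk].
  rewrite <- (defect_periodic 0 (IZR k * (2 * PI)) u th).
  - rewrite Rplus_0_r.
    apply (zero_closure (u0 S) (u1 S) 0 (2 * PI) (defect co X)).
    + apply u0_lt_u1.
    + apply two_pi_pos.
    + split; lra.
    + apply (defect_continuous (cylinder_chart S)). apply in_cylinder. apply cyl_dom_interior; auto.
    + intros; apply defect_zero_rect; auto.
  - generalize (interior_2d S u th Hu). apply locally_2d_impl. apply locally_2d_forall.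
    intros a b Ha. rewrite Rplus_0_r. apply (wd_period S). apply IX.
    apply interior_in_surface. lra.
Qed.

Lemma defect_zero_cylinder u th : chart_dom (cylinder_chart S) u th -> defect co X u th = 0.
Proof.
  intros Dom.
  assert (K : forall u, u0 S <= u <= u1 S -> chart_dom (cylinder_chart S) u th -> defect co X u th = 0).
  { intros v Hv Dv. apply (zero_closure (u0 S) (u1 S) (th - 1) (th + 1) (defect co X)).
    - apply u0_lt_u1.
    - lra.
    - split; lra.
    - apply (defect_continuous (cylinder_chart S)); auto. apply in_cylinder.
    - intros; apply defect_zero_open; auto. }
  destruct (shape S) as [a b|] eqn:Sh.
  - apply K; auto. pose proof (cyl_dom_range S u th Dom) as Q. unfold in_surface in Q.
    rewrite Sh in Q. exact Q.
  - destruct (shift_into (len S) (u0 S) u (len_pos S)) as [k Hk].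
    rewrite <- (defect_periodic (IZR k * len S) 0 u th).
    + rewrite Rplus_0_r. apply K. unfold len in *; lra. cbn. rewrite Sh. exact I.
    + apply locally_2d_forall. intros p r. rewrite Rplus_0_r.
      apply (shift_period (fun u => X u r)). intros x.
      pose proof (proj2 (proj1 IX)) as Per. rewrite Sh in Per. apply Per.
Qed.

Lemma defect_zero_polar ue sg c x y : polar_chart S ue sg c -> radius x y < len S ->
  defect co (local_rep c X) x y = 0.
Proof.
  intros P Hr. pose proof (pc_in _ _ _ _ P) as Hc.
  assert (K : forall x y, 0 < radius x y < len S -> defect co (local_rep c X) x y = 0).
  { clear x y Hr. intros x y Hr. destruct (polar_point S ue sg c x y P Hr) as [u [th [Hu [Ex Ey]]]].
    destruct constant_family as [eps [d [He [Hd [RF HO]]]]].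
    pose proof (polar_rep_near S ue sg c X u th P (proj1 IX) Hu) as L.
    assert (Dom : chart_dom c x y) by (apply (pc_dom _ _ _ _ P); lra).
    destruct (dens_polar ue sg _ (fun _ => local_rep c X) (RF c Hc) co 0 u th) as [_ [_ [_ [_ Q]]]].
    - rewrite Ex, Ey. apply HO; auto.
    - apply (pc_range _ _ _ _ P u). exact Hu.
    - rewrite Ex, Ey in Q. rewrite <- Q.
      destruct (dens_ext co _ _ u th L) as [_ [_ [_ [_ Q']]]]. rewrite <- Q'.
      apply defect_zero_cylinder. apply cyl_dom_interior. exact Hu. }
  destruct (Rle_lt_or_eq_dec 0 (radius x y) (radius_pos x y)) as [H|H]; auto.
  pose proof (len_pos S) as LP. pose proof (radius_sqr x y) as Q. rewrite <- H in Q.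
  assert (x = 0) by nra. assert (y = 0) by nra. subst x y.
  apply (zero_closure 0 (len S / 2) 0 (len S / 2) (defect co (local_rep c X))); try lra.
  - split; lra.
  - apply defect_continuous; auto. apply (pc_dom _ _ _ _ P). lra.
  - intros x y Hx Hy. apply K. pose proof (radius_sqr x y). pose proof (radius_pos x y). split; nra.
Qed.

Lemma critical_membrane : reduced_membrane_equation S co X.
Proof.
  intros c Hc x y Dom.
  assert (D0 : defect co (local_rep c X) x y = 0).
  { destruct (charts_cases S c Hc) as [->|[ue [sg P]]].
    - exact (defect_zero_cylinder x y Dom).
    - apply (defect_zero_polar ue sg c); auto. apply (pc_dom _ _ _ _ P). exact Dom. }
  unfold defect in D0. lra.
Qed.
End Converse.

Theorem theorem4p2 :
  forall (S : surface) (co : R) (X : R -> R -> vec),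
    immersion_C4 S X ->
    axially_symmetric S X ->
    (forall c, In c (charts S) -> forall x y, chart_dom c x y ->
       mean_curvature (local_rep c X) x y <> - co) ->
    (forall u theta, in_surface S u -> cz (X u theta) <> 0) ->
    (reduced_membrane_equation S co X <-> G_critical S co X) /\
    (reduced_membrane_equation S co X -> helfrich_critical S co X).
Proof.
  intros S co X IX _ _ zX. split; [split|].
  - exact (membrane_G_critical S co X zX).
  - exact (critical_membrane S co X IX zX).
  - exact (membrane_helfrich_critical S co X zX).
Qed.
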